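(* Let $d\ge1$, $m\ge2$, and let $a\in C^m([0,\infty))$ satisfy $a_0\le a(t)\le a_1$ for all $t\ge0$ with constants $0<a_0\le a_1$. Let $\Theta,\Xi$ be positive monotone increasing functions on $[0,\infty)$ and let $\Lambda$ be a positive, continuous, strictly increasing function on $[0,\infty)$ with $\lim_{t\to\infty}\Lambda(t)=\infty$. Assume: - there is a constant $a_\infty>0$ with $\int_0^t|a(s)-a_\infty|\,ds\le\Theta(t)$ for all $t\ge0$; - there are constants $C_k>0$ with $|a^{(k)}(t)|\le C_k\,\Xi(t)^{-k}$ for all $t\ge0$, $k=1,\dots,m$; - $\Theta(t)/\Lambda(t)$ is monotone increasing and $\lim_{t\to\infty}\Theta(t)/\Lambda(t)=\infty$; - there is a constant $C_0>0$ with $\Lambda(t)\le C_0\,\Xi(t)$ for all $t\ge0$; - $\Xi^{-m}\in L^1([0,\infty))$ and $\displaystyle\sup_{t\ge0}\Big\{\Lambda(t)^m\,\Theta(t)^{-1}\int_t^\infty\Xi(s)^{-m}\,ds\Big\}<\infty$. Let $\{M_j\}_{j=0}^\infty$ be a logarithmically convex sequence satisfying $$L(N,\{M_j\}):=\inf_{\tau\ge1}\left\{\frac{T\big[\{M_j/j!\}\big](\tau)}{\exp\big(\tau^{-1}\Theta(\Lambda^{-1}(N\tau))\big)}\right\}>0$$ for a positive real number $N$. For a constant $\rho>0$, consider the following conditions on $(u_0,u_1)$: $$\sum_{k\in\mathbb{Z}^d}k^\alpha D_j^+u_0[k]=0\ \ (j=1,\dots,d),\qquad \sum_{k\in\mathbb{Z}^d}k^\alpha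 u_1[k]=0\qquad\text{for all }\alpha\in\mathbb{N}_0^d, \tag{A}$$ $$\sup_{k\in\mathbb{Z}^d}\Big\{\Big(\sum_{j=1}^d|D_j^+u_0[k]|+|u_1[k]|\Big)|k|^{d+1}\,T[\{M_j\}]\big(\rho^{-1}|k|\big)\Big\}<\infty. \tag{B}$$ (i) If $L(N,\{M_j\})>0$ for every $N>0$, and $(u_0,u_1)$ satisfies (A), and (B) for some positive constant $\rho$, then there exists a positive constant $N_0$ such that $U(N_0,u_0,u_1)<\infty$ and $E(t)\lesssim U(N_0,u_0,u_1)$ for all $t\ge0$. (ii) If $$\lim_{N\to\infty}\ \inf_{\tau\ge\frac1{2\sqrt d}}\left\{\frac{\Theta(\Lambda^{-1}(N\tau))}{N\,\Theta(\Lambda^{-1}(\tau))}\right\}=\infty ,$$ then there exist positive constants $\rho$ and $N_0$ such that for every $(u_0,u_1)$ satisfying (A), and (B) with this $\rho$, one has $U(N_0,u_0,u_1)<\infty$ and $E(t)\lesssim U(N_0,u_0,u_1)$ for all $t\ge0$.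
   Context: The problem is the semi-discrete wave equation on $\mathbb{Z}^d$ $$u''(t)[k]-a(t)^2\sum_{j=1}^d\big(u(t)[k+e_j]-2u(t)[k]+u(t)[k-e_j]\big)=0\quad(t\ge0,\ k\in\mathbb{Z}^d),\qquad u(0)=u_0,\ u'(0)=u_1,$$ with $u_0,u_1\in l^2(\mathbb{Z}^d)$, $\{e_j\}$ the standard basis of $\mathbb{R}^d$, and $u$ the solution with $u,u'$ continuous in $t$ with values in $l^2(\mathbb{Z}^d)$. $D_j^+f[k]:=f[k+e_j]-f[k]$, and the total energy is $$E(t):=\sum_{k}|u'(t)[k]|^2+a(t)^2\sum_{j=1}^d\sum_{k}|D_j^+u(t)[k]|^2 .$$ $\mathbb{T}:=[-\pi,\pi]$. For $f\in l^2(\mathbb{Z}^d)$, $\hat f(\theta):=\sum_{k}e^{-\mathrm{i}k\cdot\theta}f[k]$. $\xi(\theta)=(2\sin(\theta_1/2),\dots,2\sin(\theta_d/2))$ and $|\cdot|$ is the Euclidean norm. The initial energy density is $\mathcal{E}(0,\theta)=|\hat u_1(\theta)|^2+a(0)^2|\xi(\theta)|^2|\hat u_0(\theta)|^2$, and for $N>0$ $$U(N,u_0,u_1):=\int_{\mathbb{T}^d}\exp\Big(2|\xi(\theta)|\,\Theta\Big(\Lambda^{-1}\Big(\frac{N}{|\xi(\theta)|}\Big)\Big)\Big)\,\mathcal{E}(0,\theta)\,d\theta .$$ $\Lambda^{-1}:[\Lambda(0),\infty)\to[0,\infty)$ is the inverse function of $\Lambda$; by convention $\Lambda^{-1}(r):=0$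 for $0<r<\Lambda(0)$. A sequence of positive reals $\{M_j\}_{j=0}^\infty$ is logarithmically convex if $M_j/M_{j-1}\le M_{j+1}/M_j$ for all $j\in\mathbb{N}=\{1,2,\dots\}$. For a sequence of positive reals $\{M_j\}$ the associated function is $T[\{M_j\}](\tau):=\sup_{j\in\mathbb{N}}\{\tau^j/M_j\}$, $\tau\ge0$ (possibly $+\infty$; convention $0\cdot\infty=0$). $\mathbb{N}_0=\mathbb{N}\cup\{0\}$; $k^\alpha=k_1^{\alpha_1}\cdots k_d^{\alpha_d}$. $f\lesssim g$ means $f\le Cg$ with a positive constant $C$ (here independent of $t$). *)

(* Defs.v *)
From HB Require Import structures.
From mathcomp Require Import all_boot all_order all_algebra.
From mathcomp Require Import complex.
From mathcomp Require Import all_classical all_reals all_analysis.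
Set Implicit Arguments.
Unset Strict Implicit.
Unset Printing Implicit Defensive.
Import Order.TTheory GRing.Theory Num.Theory numFieldNormedType.Exports.

Import Normc.

Local Open Scope classical_set_scope.
Local Open Scope ring_scope.
Local Open Scope complex_scope.

(* Lebesgue measure on R^n, as the n-fold product of the one-dimensional one
   transported along (x, t) |-> x :: t; the case n = 0 is the unit point mass. *)

Section lebesgue_tuple.
Context {R : realType}.
Local Notation Rm := (measurableTypeR R).

Definition consT n (p : Rm * n.-tuple Rm) : n.+1.-tuple Rm :=
  [the n.+1.-tuple Rm of p.1 :: p.2].

Lemma measurable_consT n : measurable_fun setT (@consT n).
Proof. exact: measurable_cons. Qed.

Section step.
Variables (n : nat) (mu : {sigma_finite_measure set (n.-tuple Rm) -> \bar R}).

Definition leb_step : set (n.+1.-tuple Rm) -> \bar R :=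
  pushforward ((@lebesgue_measure R) \x mu)%E (@consT n).

Let leb_step0 : leb_step set0 = 0%E.
Proof. by rewrite /leb_step /pushforward preimage_set0 measure0. Qed.

Let leb_step_ge0 A : (0 <= leb_step A)%E.
Proof. by rewrite /leb_step /pushforward measure_ge0. Qed.

Let leb_step_sigma : semi_sigma_additive leb_step.
Proof.
move=> F mF tF mUF; rewrite /leb_step /pushforward preimage_bigcup.
apply: measure_semi_sigma_additive.
- by move=> k; rewrite -[X in measurable X]setTI; exact: measurable_consT.
- apply/trivIsetP => /= i j _ _ ij; rewrite -preimage_setI.
  by move/trivIsetP : tF => /(_ _ _ _ _ ij) ->//; rewrite preimage_set0.
- rewrite -preimage_bigcup -[X in measurable X]setTI.
  exact: measurable_consT.
Qed.

HB.instance Definition _ := isMeasure.Build _ _ _ leb_step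
  leb_step0 leb_step_ge0 leb_step_sigma.

Let leb_step_sigma_finite : sigma_finite setT leb_step.
Proof.
have /sigma_finiteP[F [FT Fnd Foo]] := sigma_finiteT (@lebesgue_measure R).
have /sigma_finiteP[G [GT Gnd Goo]] := sigma_finiteT mu.
pose tl (t : n.+1.-tuple Rm) : n.-tuple Rm := [tuple of behead t].
pose H i := [set t : n.+1.-tuple Rm |
  F i (tnth t ord0) /\ G i (tl t)].
have preH i : @consT n @^-1` H i = F i `*` G i.
  have e1 x t : tnth (consT (x, t)) ord0 = x by [].
  have e2 x t : tl (consT (x, t)) = t by exact/val_inj.
  by apply/funext => -[x t]; rewrite /preimage /H /setX /mkset e1 e2.
exists H.
  apply/esym; rewrite -subTset => t _.
  have : setT (tnth t ord0) by [].
  rewrite FT => -[i _ Fi].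
  have : setT (tl t) by [].
  rewrite GT => -[j _ Gj].
  exists (maxn i j) => //; split.
    by move: Fi; apply/subsetPset/Fnd; exact: leq_maxl.
  by move: Gj; apply/subsetPset/Gnd; exact: leq_maxr.
move=> i; have [mF fF] := Foo i; have [mG fG] := Goo i; split.
  rewrite (_ : H i = (setT `&` (fun t : n.+1.-tuple Rm => tnth t ord0) @^-1` F i)
      `&` (setT `&` tl @^-1` G i)); last first.
    by rewrite !setTI.
  apply: measurableI; first exact: measurable_tnth.
  exact: measurable_behead.
rewrite [ltLHS](_ : _ = ((@lebesgue_measure R) \x mu)%E (F i `*` G i)).
  rewrite product_measure1E// lte_mul_pinfty ?measure_ge0//.
  by rewrite ge0_fin_numE ?measure_ge0.
by rewrite /leb_step /pushforward preH.
Qed.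

HB.instance Definition _ := Measure_isSigmaFinite.Build _ _ _ leb_step
  leb_step_sigma_finite.

Definition leb_stepM : {sigma_finite_measure set (n.+1.-tuple Rm) -> \bar R} :=
  leb_step.
End step.

Fixpoint lebesgue_tuple n : {sigma_finite_measure set (n.-tuple Rm) -> \bar R} :=
  match n with
  | 0 => \d_([tuple] : 0.-tuple Rm)
  | n'.+1 => leb_stepM (lebesgue_tuple n')
  end.

End lebesgue_tuple.

(* Vectors of Z^d are row vectors 'rV[int]_d, with e_j = delta_mx 0 j; frequencies
   are tuples; sequences on Z^d take values in the complex numbers R[i]. *)

Section halfline.
Context {R : realType}.
Implicit Types f : R -> R.

(* Derivatives on [0, +oo), one-sided at 0: only values f s with s >= 0 enter. *)
Definition hquot f (t s : R) : R := (f s - f t) / (s - t).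

Definition hderivable f t := cvg (hquot f t s @[s --> within `[0, +oo[ t^']).

Definition hderive f t : R := lim (hquot f t s @[s --> within `[0, +oo[ t^']).

Definition hderiven (k : nat) f : R -> R := iter k hderive f.

Definition Cm_halfline (m : nat) f :=
  (forall k t, (k < m)%N -> 0 <= t -> hderivable (hderiven k f) t) /\
  {within `[0, +oo[, continuous (hderiven m f)}.

(* Inverse of a strictly increasing continuous L : [0,oo) -> [L 0,oo); the default
   value of xget gives the convention that it is 0 below L 0. *)
Definition Linv (L : R -> R) (r : R) : R :=
  xget 0 [set t | 0 <= t /\ L t = r].

End halfline.

Section lattice.
Context {R : realType} {d : nat}.
Local Notation C := R[i].
Local Notation Zd := 'rV[int]_d.
Local Notation freq := (d.-tuple (measurableTypeR R)).
Implicit Types (f : Zd -> C) (k : Zd) (u : R -> Zd -> C) (theta : freq).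

Definition znorm k : R := Num.sqrt (\sum_(j < d) (k 0 j)%:~R ^+ 2).

Definition zmonom (alpha : 'I_d -> nat) k : C :=
  (\prod_(j < d) k 0 j ^+ alpha j)%:~R.

Definition fdiff (j : 'I_d) f : Zd -> C := fun k => f (k + delta_mx 0 j) - f k.

Definition l2sq f : \bar R := (\esum_(k in [set: Zd]) (normc (f k) ^+ 2)%:E)%E.

Definition in_l2 f := (l2sq f < +oo)%E.

(* Series over Z^d are summed over the cubes {-n,...,n}^d.  This is immaterial for
   absolutely summable f, and makes the Fourier series of an arbitrary f in l^2
   converge almost everywhere to its L^2 sum. *)
Definition cube (n : nat) : set Zd := [set k | forall j, `|k 0 j| <= n%:Z].

Definition zpartial f (n : nat) : C := \sum_(k \in cube n) f k.

Definition zsum_is f (z : C) :=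
  (complex.Re (zpartial f n) @[n --> \oo] --> complex.Re z) /\
  (complex.Im (zpartial f n) @[n --> \oo] --> complex.Im z).

Definition zsum f : C :=
  lim (complex.Re (zpartial f n) @[n --> \oo]) +i*
  lim (complex.Im (zpartial f n) @[n --> \oo]).

Definition zdot k theta : R := \sum_(j < d) (k 0 j)%:~R * tnth theta j.

Definition cexpN (x : R) : C := cos x -i* sin x.

Definition fourier f theta : C := zsum (fun k => cexpN (zdot k theta) * f k).

Definition torus : set freq := [set theta | forall j, - pi <= tnth theta j <= pi].

Definition xinorm theta : R :=
  Num.sqrt (\sum_(j < d) (2 * sin (tnth theta j / 2)) ^+ 2).

Definition energy_density0 (a : R -> R) (u0 u1 : Zd -> C) theta : R :=
  normc (fourier u1 theta) ^+ 2 +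
  a 0 ^+ 2 * xinorm theta ^+ 2 * normc (fourier u0 theta) ^+ 2.

Definition U (a Theta Lambda : R -> R) (N : R) (u0 u1 : Zd -> C) : \bar R :=
  (\int[lebesgue_tuple d]_(theta in torus)
    (expR (2 * xinorm theta * Theta (Linv Lambda (N / xinorm theta)))
       * energy_density0 a u0 u1 theta)%:E)%E.

Definition tderivable u (t : R) := forall k,
  hderivable (fun s => complex.Re (u s k)) t /\
  hderivable (fun s => complex.Im (u s k)) t.

Definition tderive u : R -> Zd -> C := fun t k =>
  hderive (fun s => complex.Re (u s k)) t +i*
  hderive (fun s => complex.Im (u s k)) t.

Definition l2_continuous u := forall t : R, 0 <= t ->
  in_l2 (u t) /\
  l2sq (fun k => u s k - u t k) @[s --> within `[0, +oo[ (nbhs t)] --> 0%E.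

Definition wave_solution (a : R -> R) (u0 u1 : Zd -> C) u :=
  [/\ l2_continuous u, l2_continuous (tderive u),
      u 0 = u0, tderive u 0 = u1 &
      forall t : R, 0 <= t ->
        [/\ tderivable u t, tderivable (tderive u) t &
            forall k, tderive (tderive u) t k
              - (a t ^+ 2)%:C * (\sum_(j < d)
                  (u t (k + delta_mx 0 j) - 2 * u t k
                   + u t (k - delta_mx 0 j))) = 0]].

Definition energy (a : R -> R) u (t : R) : \bar R :=
  (l2sq (tderive u t) +
   (a t ^+ 2)%:E * \sum_(j < d) l2sq (fdiff j (u t)))%E.

End lattice.

Section sequences.
Context {R : realType}.
Implicit Types (M : nat -> R).

Definition log_convex M :=
  forall j, (0 < j)%N -> M j / M j.-1 <= M j.+1 / M j.

Definition assoc_fun M (tau : R) : \bar R :=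
  ereal_sup [set (tau ^+ j / M j)%:E | j in [set j | (0 < j)%N]].

Definition Lfunctional (Theta Lambda : R -> R) (N : R) M : \bar R :=
  ereal_inf [set (assoc_fun (fun j => M j / j`!%:R)%R tau *
    (expR (tau^-1 * Theta (Linv Lambda (N * tau))))^-1%:E)%E
    | tau in [set tau : R | (1 <= tau)%R]].

Definition moment_condition d (u0 u1 : 'rV[int]_d -> R[i]) :=
  forall alpha : 'I_d -> nat,
    (forall j, zsum_is (fun k => zmonom alpha k * fdiff j u0 k) 0) /\
    zsum_is (fun k => zmonom alpha k * u1 k) 0.

(* mule has 0 * +oo = 0, as in the stated convention. *)
Definition decay_condition d M (rho : R) (u0 u1 : 'rV[int]_d -> R[i]) :=
  (ereal_sup [set (((\sum_(j < d) normc (fdiff j u0 k) + normc (u1 k))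
      * znorm k ^+ d.+1)%:E * assoc_fun M (rho^-1 * znorm k))%E
    | k in [set: 'rV[int]_d]] < +oo)%E.

End sequences.

(* Main.v *)
Require Import Defs.
From mathcomp Require Import all_boot all_order all_algebra.
From mathcomp Require Import complex ring lra.
From mathcomp Require Import all_classical all_reals all_analysis measurable_realfun.
Set Implicit Arguments.
Unset Strict Implicit.
Unset Printing Implicit Defensive.
Import Order.TTheory GRing.Theory Num.Theory numFieldNormedType.Exports.

Local Open Scope classical_set_scope.
Local Open Scope ring_scope.

Local Notation Cre := (@complex.Re _).
Local Notation Cim := (@complex.Im _).
Local Notation normc := Normc.normc.

(** After the Fourier transform each mode solves [v'' + (lam a(t)) ^ 2 v = 0] with
    [lam = |xi(theta)|].  Split the time axis at [t_lam = Linv Lambda (N / lam)].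
    Before [t_lam] one uses the energy with [ainf] in place of [a]: its logarithmic
    derivative is at most a constant times [lam |a - ainf|], which integrates to
    [O(lam Theta(t_lam))].  After [t_lam] the quantity [lam Xi] is large and
    [m - 1] Newton steps give an approximate solution [y] of the Riccati equation
    with residual [O(lam ^ 2 (lam Xi) ^ -m)]; the quadratic form
    [|v' - y v| ^ 2 / Im y] is equivalent to the energy, and its logarithmic
    derivative integrates to [O(lam + lam ^ (1 - m) \int_(t_lam) Xi ^ -m)], which
    is [O(lam + lam Theta(t_lam))].  As [Theta / Lambda] increases, enlarging [N]
    replaces any constant in front of [lam Theta(t_lam)] by 2.

    Finiteness of [U]: because all moments vanish, each Taylor polynomial of the
    exponential sums to zero against the data, so the energy density is at
    most [C ((r |xi|) ^ j M_j / j!) ^ 2] for every [j > 0]; the infimum over [j] is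
    [C T(1 / (r |xi|)) ^ -2], which the positivity of [L] compares with the
    exponential weight. *)

(** * One-sided calculus on the half line *)

(** On the lattice side the obstacle is regularity: a solution is only known to be continuous in
    time with values in l^2, while the mode equation is wanted at every frequency, from series that
    can be differentiated term by term. The decay condition bounds only the differences of [u0];
    [u0] itself is recovered by summing them along rays to infinity, where l^2 forces the limit 0.
    The resulting bound by [weight] survives on bounded time intervals, with time remainders that
    are also controlled by [weight], so every Fourier series involved converges absolutely. Parseval
    is then needed only as an upper bound of the lattice sum by the integral.

    Modes are kept real: sines are cosines with phase [- (pi / 2)], so a single kernel
    [cos (zdot k t + c)] serves throughout.

    Since [xinorm] never exceeds [2 * Num.sqrt d%:R], the terms of size [lam] in the exponents
    become a constant factor, and the [N0] and [C] of the mode estimate depend neither on time nor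
    on the data. The two cases of the theorem differ only in how the exponent at [N0] is compared
    with the one inside [Lfunctional]. *)

Section HalfLine.
Context {R : realType}.
Implicit Types (f g : R -> R) (s t l : R).

Definition hder f t l := hquot f t s @[s --> within `[0, +oo[ t^'] --> l.

Lemma near_hdnbhs t (P : R -> Prop) :
  (\forall s \near within `[0, +oo[ t^', P s) <->
  exists2 e, 0 < e & forall s, 0 <= s -> s != t -> `|s - t| < e -> P s.
Proof.
split=> [|[e e0 H]].
- rewrite /within /= /dnbhs /within /= => /nbhs_ballP [e /= e0 H].
  exists e => // s s0 st ste; apply: (H s) => //; last by rewrite in_itv /= s0.
  by rewrite /ball /= distrC.
- rewrite /within /= /dnbhs /within /=; apply/nbhs_ballP; exists e => //= s.
  rewrite /ball /= distrC => ste st s0; apply: H => //.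
  by move: s0; rewrite in_itv /= andbT.
Qed.

#[local] Instance hdnbhs_filter t : Filter (within `[(0:R), +oo[ t^').
Proof. exact: within_filter. Qed.

#[local] Instance hdnbhs_proper t : 0 <= t -> ProperFilter (within `[(0:R), +oo[ t^').
Proof.
move=> t0; apply: Build_ProperFilter_ex => P /near_hdnbhs[e e0 H].
exists (t + e / 2); apply: H; first by rewrite addr_ge0// ltW// divr_gt0.
- by rewrite gt_eqF// ltrDl divr_gt0.
- rewrite [_ + _ - _]addrAC subrr add0r gtr0_norm ?divr_gt0//.
  by rewrite ltr_pdivrMr// mulr_natr mulr2n ltrDl.
Qed.

(** Clearing the denominator removes the exclusion of [s = t] and leaves an inequality that can be
    summed over the lattice or transported along equalities on the half line. *)
Lemma hderP f t l : hder f t l <->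
  forall e, 0 < e -> exists2 dl, 0 < dl & forall s, 0 <= s -> `|s - t| < dl ->
    `|f s - f t - l * (s - t)| <= e * `|s - t|.
Proof.
have key s : s != t -> f s - f t - l * (s - t) = (hquot f t s - l) * (s - t).
  by move=> st; rewrite mulrBl /hquot divfK// subr_eq0.
split=> [/cvgrPdist_le H e e0|H].
- have /near_hdnbhs[dl dl0 K] := H e e0.
  exists dl => // s s0 sd; have [->|st] := eqVneq s t.
    by rewrite !subrr mulr0 subrr normr0 mulr0.
  by rewrite key// normrM ler_wpM2r// distrC K.
- apply/cvgrPdist_le => e e0; have [dl dl0 K] := H e e0.
  apply/near_hdnbhs; exists dl => // s s0 st sd.
  have := K _ s0 sd; rewrite key// normrM distrC ler_pM2r//.
  by rewrite normr_gt0 subr_eq0.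
Qed.

Lemma hder_continuous f t l : hder f t l ->
  f s @[s --> within `[0, +oo[ t^'] --> f t.
Proof.
move=> /hderP /(_ 1 ltr01) [dl dl0 H]; apply/cvgrPdist_lt => e e0.
apply/near_hdnbhs; exists (Num.min dl (e / (`|l| + 1))).
  by rewrite lt_min dl0 divr_gt0.
move=> s s0 st; rewrite lt_min => /andP[/(H _ s0) A B].
rewrite distrC -[f s - f t](subrK (l * (s - t))).
rewrite (le_lt_trans (ler_normD _ _))//.
rewrite (le_lt_trans (lerD A (lexx _)))// normrM -mulrDl addrC.
by rewrite mulrC -ltr_pdivlMr.
Qed.

Lemma hderD f g t l k : hder f t l -> hder g t k ->
  hder (fun s => f s + g s) t (l + k).
Proof.
move=> fl gk; rewrite /hder.
rewrite [X in X @ _ --> _](_ : _ = (fun s => hquot f t s + hquot g t s)); last first.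
  by apply/funext => s; rewrite /hquot -mulrDl; congr (_ * _); ring.
exact: cvgD.
Qed.

Lemma hderM f g t l k : hder f t l -> hder g t k ->
  hder (fun s => f s * g s) t (l * g t + f t * k).
Proof.
move=> fl gk; rewrite /hder addrC.
rewrite [X in X @ _ --> _](_ : _ =
   (fun s => f s * hquot g t s + hquot f t s * g t)); last first.
  by apply/funext => s; rewrite /hquot; ring.
by apply: cvgD; apply: cvgM => //; [exact: hder_continuous fl|exact: cvg_cst].
Qed.

Lemma hder_cst (c t : R) : hder (fun=> c) t 0.
Proof.
rewrite /hder [X in X @ _ --> _](_ : _ = fun=> 0); first exact: cvg_cst.
by apply/funext => s; rewrite /hquot subrr mul0r.
Qed.

Lemma hderZ f t l (c : R) : hder f t l -> hder (fun s => c * f s) t (c * l).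
Proof.
by move=> fl; have := hderM (hder_cst c t) fl; rewrite mul0r add0r.
Qed.

Lemma hderN f t l : hder f t l -> hder (fun s => - f s) t (- l).
Proof.
move=> /(@hderZ _ _ _ (-1)); rewrite mulN1r.
by rewrite (_ : (fun s => -1 * f s) = (fun s => - f s))//; apply/funext => s; rewrite mulN1r.
Qed.

Lemma hderB f g t l k : hder f t l -> hder g t k ->
  hder (fun s => f s - g s) t (l - k).
Proof. by move=> fl /hderN; exact: hderD. Qed.

Lemma hderV f t l : f t != 0 -> hder f t l ->
  hder (fun s => (f s)^-1) t (- l * (f t)^-1 ^+ 2).
Proof.
move=> ft0 fl; rewrite /hder.
have fc := hder_continuous fl.
have H : (- hquot f t s) * ((f t)^-1 * (f s)^-1)
     @[s --> within `[0, +oo[ t^'] --> - l * (f t)^-1 ^+ 2.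
  apply: cvgM; first exact: cvgN.
  by rewrite expr2; apply: cvgM; [exact: cvg_cst|exact: cvgV].
apply: cvg_trans H; apply: near_eq_cvg.
have : \forall s \near within `[(0:R), +oo[ t^', f s != 0.
  have /cvgrPdist_lt/(_ `|f t|) := fc; rewrite normr_gt0 => /(_ ft0).
  apply: filterS => s; apply: contraTneq => ->; by rewrite subr0 ltxx.
apply: filterS => s fs0; rewrite /hquot mulNr mulrAC -mulNr; congr (_ * _).
by field; rewrite ft0 fs0.
Qed.

Lemma hderivableE f t : hderivable f t -> hder f t (hderive f t).
Proof. by []. Qed.

(** Away from 0 a full neighbourhood of [t] lies in the half line, so the one-sided notion agrees
    with the two-sided one and the classical theorems become available. *)
Lemma hder_is_derive f t l : 0 < t -> hder f t l -> is_derive t 1 f l.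
Proof.
move=> t0 /hderP fl.
have H : h^-1 *: (f (h *: 1 + t) - f t) @[h --> 0^'] --> l.
  apply/cvgrPdist_le => e e0; have [dl dl0 K] := fl e e0.
  rewrite /dnbhs; near=> h.
  have h0 : h != 0 by near: h; exact: withinT.
  have ht : 0 <= h + t.
    have : `|h| < t by near: h; apply: dnbhs0_lt.
    rewrite ltr_norml => /andP[+ _]; rewrite -subr_gt0 opprK => /ltW.
    by [].
  have hd : `|h| < dl by near: h; apply: dnbhs0_lt.
  have := K _ ht; rewrite addrK => /(_ hd).
  rewrite -(ler_pM2l (_ : 0 < `|h|^-1)); last by rewrite invr_gt0 normr_gt0.
  rewrite [`|h|^-1 * (e * _)]mulrCA mulVf ?normr_eq0// mulr1; apply: le_trans.
  rewrite -normfV -normrM mulrBr mulrCA mulVf// mulr1 distrC.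
  by rewrite /GRing.scale /= mulr1.
apply: DeriveDef; first by apply/cvg_ex; exists l.
exact/cvg_lim.
Unshelve. all: by end_near. Qed.

Lemma hder_within_continuous f a b : 0 <= a ->
  (forall t, a <= t <= b -> exists l, hder f t l) ->
  {within `[a, b], continuous f}.
Proof.
move=> a0 H; apply/subspace_continuousP => x; rewrite /= in_itv /= => xab.
have [l /hder_continuous fl] := H x xab.
apply/cvgrPdist_lt => e e0; move/cvgrPdist_lt : fl => /(_ e e0).
move=> /near_hdnbhs[dl dl0 K].
rewrite /within /=; apply/nbhs_ballP; exists dl => //= s.
rewrite /ball /= distrC => sd; rewrite in_itv /= => /andP[as' _].
have [->|sx] := eqVneq s x; first by rewrite subrr normr0.
by apply: K => //; exact: le_trans as'.
Qed.

Lemma hder_MVT f (df : R -> R) a b : 0 <= a -> a <= b ->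
  (forall t, a <= t <= b -> hder f t (df t)) ->
  exists2 c, a <= c <= b & f b - f a = df c * (b - a).
Proof.
move=> a0 ab H.
have [||c] := @MVT_segment R f df a b ab.
- move=> x; rewrite in_itv /= => /andP[ax xb]; apply: hder_is_derive.
    exact: le_lt_trans ax.
  by apply: H; rewrite !ltW.
- by apply: hder_within_continuous => // t tab; exists (df t); exact: H.
by rewrite in_itv /= => cab E; exists c.
Qed.

Lemma hder_lip f (df : R -> R) a b C : 0 <= a -> a <= b ->
  (forall t, a <= t <= b -> hder f t (df t)) ->
  (forall t, a <= t <= b -> `|df t| <= C) ->
  `|f b - f a| <= C * (b - a).
Proof.
move=> a0 ab H HC; have [c cab ->] := hder_MVT a0 ab H.
rewrite normrM [`|b - a|]ger0_norm ?subr_ge0// ler_wpM2r ?subr_ge0//.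
exact: HC.
Qed.

(** [Q * expR (- G)] has a nonpositive derivative. Derivatives are asked for in the open interval
    only: at time 0 they are one-sided, and in [pseudo_zone] the function [G] is an integral with
    variable upper limit. *)
Lemma gronwall (Q dQ G dG : R -> R) a b : a <= b ->
  {within `[a, b], continuous Q} -> {within `[a, b], continuous G} ->
  (forall t, a < t < b -> is_derive t 1 Q (dQ t)) ->
  (forall t, a < t < b -> is_derive t 1 G (dG t)) ->
  (forall t, a < t < b -> dQ t <= dG t * Q t) ->
  Q b <= Q a * expR (G b - G a).
Proof.
move=> ab cQ cG HQ HG H.
pose f t := Q t * expR (- G t).
pose df t := (dQ t - dG t * Q t) * expR (- G t).
have fab : f b <= f a.
  move: ab; rewrite le_eqVlt => /predU1P[->//|ab].
  have [||c cab E] := @MVT R f df a b ab.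
  - move=> t; rewrite in_itv /= => tab; have := HQ t tab; have := HG t tab => ? ?.
    have E : is_derive t 1 (expR \o (- G)) (expR (- G t) * - dG t).
      exact: is_derive1_comp.
    have -> : df t = Q t *: (expR (- G t) * - dG t) + (expR \o (- G)) t *: dQ t.
      by rewrite /df /GRing.scale /=; change ((- G) t) with (- G t); ring.
    exact: (is_deriveM _ E).
  - apply/subspace_continuousP => t tab; rewrite /f.
    move/subspace_continuousP : cQ => /(_ t tab) cQ.
    move/subspace_continuousP : cG => /(_ t tab) cG.
    apply: cvgM; first exact: cQ.
    by apply: (cvg_comp _ _ (cvgN cG)); exact: continuous_expR.
  rewrite -subr_le0 E pmulr_lle0 ?subr_gt0// /df pmulr_lle0 ?expR_gt0//.
  by rewrite subr_le0 H//; move: cab; rewrite in_itv.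
have -> : Q b = f b * expR (G b) by rewrite /f -mulrA -expRD addNr expR0 mulr1.
by rewrite [G b - G a]addrC expRD mulrA ler_wpM2r ?expR_ge0.
Qed.

Lemma hder_gronwall (Q dQ : R -> R) a b c : 0 <= a -> a <= b ->
  (forall t, a <= t <= b -> hder Q t (dQ t)) ->
  (forall t, a <= t <= b -> dQ t <= c * Q t) ->
  Q b <= Q a * expR (c * (b - a)).
Proof.
move=> a0 ab HQ H; rewrite mulrBr.
have tab t : a < t < b -> a <= t <= b by move=> /andP[? ?]; rewrite !ltW.
apply: (@gronwall _ dQ (fun t => c * t) (fun=> c)) => //.
- by apply: hder_within_continuous => // t {}/HQ; exists (dQ t).
- apply: continuous_subspaceT => x; apply: cvgM; [exact: cvg_cst|exact: cvg_id].
- move=> t /[dup] /andP[at_ _] /tab /HQ; apply: hder_is_derive.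
  exact: le_lt_trans at_.
- by move=> t _; apply: is_derive_eq; rewrite /GRing.scale /= mulr1.
- by move=> t /tab /H.
Qed.

End HalfLine.

(** * Approximate solutions of the Riccati equation *)

Section Symbols.
Context {R : realType}.
Variable Xi : R -> R.
Hypothesis Xi_gt0 : forall t, 0 <= t -> 0 < Xi t.
Implicit Types (f g : R -> R -> R) (lam t : R).

(* Symbols of order [-j] with [r] time derivatives: in the zone [lam Xi >= 1] the
   [k]-th derivative is [O(lam ^ k (lam Xi) ^ -(j + k))] for [k <= r]. *)
Fixpoint Sym (r j : nat) f : Prop :=
  (exists2 C, 0 <= C & forall lam t, 0 < lam -> 0 <= t -> 1 <= lam * Xi t ->
     `|f lam t| <= C * (lam * Xi t) ^- j) /\
  if r is r'.+1 then
    exists2 g, (forall lam t, 0 < lam -> 0 <= t -> hder (f lam) t (lam * g lam t))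
             & Sym r' j.+1 g
  else True.

Lemma SymS r j f : Sym r.+1 j f -> Sym r j f.
Proof.
elim: r j f => [|r IH] j f; first by case=> H _; split.
by case=> H [g Hg Sg]; split=> //; exists g => //; exact: IH.
Qed.

Lemma Sym_regW r r' j f : (r' <= r)%N -> Sym r j f -> Sym r' j f.
Proof.
move=> /subnK <-; elim: (r - r')%N => [//|n IH]; rewrite addSn => /SymS; exact: IH.
Qed.

Lemma Sym_orderW r j k f : (k <= j)%N -> Sym r j f -> Sym r k f.
Proof.
elim: r j k f => [|r IH] j k f kj [[C C0 HC] H].
all: have HC' : exists2 C, 0 <= C & forall lam t, 0 < lam -> 0 <= t ->
  1 <= lam * Xi t -> `|f lam t| <= C * (lam * Xi t) ^- k.
1,3: exists C => // lam t l0 t0 s1; apply: le_trans (HC _ _ l0 t0 s1) _;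
  rewrite ler_wpM2l// lef_pV2 ?posrE ?exprn_gt0 ?(lt_le_trans _ s1)//;
  exact: ler_weXn2l.
- by split.
- by case: H => g Hg Sg; split => //; exists g => //; exact: IH Sg.
Qed.

Lemma SymD r j f g : Sym r j f -> Sym r j g ->
  Sym r j (fun lam t => f lam t + g lam t).
Proof.
elim: r j f g => [|r IH] j f g [[C C0 HC] H] [[D D0 HD] K].
all: have HE : exists2 C, 0 <= C & forall lam t, 0 < lam -> 0 <= t ->
  1 <= lam * Xi t -> `|f lam t + g lam t| <= C * (lam * Xi t) ^- j.
1,3: exists (C + D); [exact: addr_ge0|move=> lam t l0 t0 s1];
  rewrite (le_trans (ler_normD _ _))// mulrDl lerD ?HC ?HD//.
- by split.
- case: H => f1 Hf Sf; case: K => g1 Hg Sg; split => //.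
  exists (fun lam t => f1 lam t + g1 lam t); last exact: IH.
  by move=> lam t l0 t0; rewrite mulrDr; apply: hderD; [exact: Hf|exact: Hg].
Qed.

Lemma SymM r j k f g : Sym r j f -> Sym r k g ->
  Sym r (j + k) (fun lam t => f lam t * g lam t).
Proof.
elim: r j k f g => [|r IH] j k f g /[dup] SF [[C C0 HC] H] /[dup] SG [[D D0 HD] K].
all: have HE : exists2 C, 0 <= C & forall lam t, 0 < lam -> 0 <= t ->
  1 <= lam * Xi t -> `|f lam t * g lam t| <= C * (lam * Xi t) ^- (j + k).
1,3: exists (C * D); [exact: mulr_ge0|move=> lam t l0 t0 s1];
  rewrite normrM exprD invfM mulrACA ler_pM// ?HC ?HD//.
- by split.
- case: H => f1 Hf Sf; case: K => g1 Hg Sg; split => //.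
  exists (fun lam t => f1 lam t * g lam t + f lam t * g1 lam t).
    move=> lam t l0 t0; rewrite mulrDr [X in hder _ _ X](_ : _ =
      lam * f1 lam t * g lam t + f lam t * (lam * g1 lam t)); last by ring.
    by apply: hderM; [exact: Hf|exact: Hg].
  apply: SymD; first by rewrite -addSn; apply: IH => //; exact: SymS.
  by rewrite -addnS; apply: IH => //; exact: SymS.
Qed.

Lemma SymMW r j k l f g : (l <= j + k)%N -> Sym r j f -> Sym r k g ->
  Sym r l (fun lam t => f lam t * g lam t).
Proof. by move=> ljk Sf Sg; apply: Sym_orderW ljk _; exact: SymM. Qed.

Lemma Sym0 r j : Sym r j (fun _ _ => 0).
Proof.
elim: r j => [|r IH] j; (split=> //; first by exists 0 => // lam t *;
  rewrite mul0r normr0).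
by exists (fun _ _ => 0) => // lam t _ _; rewrite mulr0; exact: hder_cst.
Qed.

Lemma Sym_cst r (c : R) : Sym r 0 (fun _ _ => c).
Proof.
case: r => [|r]; (split=> //; first by exists `|c| => // lam t l0 t0 s1;
    rewrite expr0 invr1 mulr1).
exists (fun _ _ => 0); last exact: Sym0.
by move=> lam t _ _; rewrite mulr0; exact: hder_cst.
Qed.

Lemma SymZ r j (c : R) f : Sym r j f -> Sym r j (fun lam t => c * f lam t).
Proof. by move=> Sf; rewrite -[j]add0n; apply: SymM => //; exact: Sym_cst. Qed.

Lemma SymB r j f g : Sym r j f -> Sym r j g ->
  Sym r j (fun lam t => f lam t - g lam t).
Proof.
move=> Sf /(SymZ (-1)) Sg; rewrite (_ : (fun lam t => _) =
  (fun lam t => f lam t + -1 * g lam t)); first exact: SymD.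
by apply/funext => lam; apply/funext => t; rewrite mulN1r.
Qed.

Section Speed.
Variables (m : nat) (a : R -> R) (a0 a1 : R).
Hypotheses (a0_gt0 : 0 < a0) (a_bnd : forall t, 0 <= t -> a0 <= a t <= a1).
Hypothesis a_der : forall k t, (k < m)%N -> 0 <= t ->
  hder (hderiven k a) t (hderiven k.+1 a t).
Hypothesis a_symbol : forall k, (1 <= k <= m)%N -> exists2 Ck : R, 0 < Ck &
  forall t, 0 <= t -> `|hderiven k a t| <= Ck * Xi t ^- k.

Let a_gt0 t : 0 <= t -> 0 < a t.
Proof. by move=> /a_bnd/andP[+ _]; exact: lt_le_trans. Qed.

Lemma Sym_speed : Sym m 0 (fun _ t => a t).
Proof.
(* The induction needs all normalised derivatives [lam ^- i * a^(i)] at once: the one with index [i]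
   has order [i] and [r = m - i] derivatives left. *)
suff H r i : (i + r = m)%N -> Sym r i (fun lam t => lam ^- i * hderiven i a t).
  have := H m 0%N erefl.
  by rewrite (_ : (fun lam t => _) = (fun _ t => a t))//;
    apply/funext => lam; apply/funext => t; rewrite expr0 invr1 mul1r.
elim: r i => [|r IH] i im.
all: have HE : exists2 C, 0 <= C & forall lam t, 0 < lam -> 0 <= t ->
  1 <= lam * Xi t -> `|lam ^- i * hderiven i a t| <= C * (lam * Xi t) ^- i.
1,3: case: i im => [|i] im; [exists a1 => [|lam t l0 t0 s1]|];
 [by have /andP[] := a_bnd (lexx 0); move=> ha /(le_trans ha); exact: le_trans (ltW a0_gt0)
 |by rewrite expr0 invr1 mulr1 mul1r /= ger0_norm ?(ltW (a_gt0 t0))//;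
    case/andP: (a_bnd t0)
 |have [|Ck Ck0 HC] := @a_symbol i.+1; [by rewrite -im leq_addr|];
  exists Ck; [exact: ltW|move=> lam t l0 t0 s1];
  rewrite exprMn invfM mulrCA normrM gtr0_norm ?invr_gt0 ?exprn_gt0//;
  rewrite ler_pM2l ?invr_gt0 ?exprn_gt0//; exact: HC].
- by split.
- split=> //; exists (fun lam t => lam ^- i.+1 * hderiven i.+1 a t); last first.
    by apply: IH; rewrite addSnnS.
  move=> lam t l0 t0; rewrite exprS invfM !mulrA mulfV ?gt_eqF// mul1r.
  by apply: hderZ; apply: a_der => //; rewrite -im -addSnnS leq_addr.
Qed.

(** The derivative [- a' / a ^ 2] is a symbol of order 1 times two copies of the inverse, which are
    needed with one derivative less; hence the induction on [r]. *)
Lemma Sym_speedV : Sym m 0 (fun _ t => (a t)^-1).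
Proof.
have := Sym_speed; suff H r : Sym r 0 (fun _ t => a t) -> Sym r 0 (fun _ t => (a t)^-1).
  exact: H.
elim: r => [|r IH] Sa.
all: have HE : exists2 C, 0 <= C & forall lam t, 0 < lam -> 0 <= t ->
  1 <= lam * Xi t -> `|(a t)^-1| <= C * (lam * Xi t) ^- 0.
1,3: exists a0^-1; [by rewrite invr_ge0 ltW|move=> lam t l0 t0 s1];
  rewrite expr0 invr1 mulr1 gtr0_norm ?invr_gt0 ?a_gt0//
  lef_pV2 ?posrE ?a_gt0//; by case/andP: (a_bnd t0).
- by split.
- split=> //; case: (Sa) => _ [g Hg Sg].
  exists (fun lam t => -1 * g lam t * ((a t)^-1 * (a t)^-1)).
    move=> lam t l0 t0; have := hderV (lt0r_neq0 (a_gt0 t0)) (Hg _ _ l0 t0).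
    by congr hder; ring.
  rewrite -[1%N]/((1 + (0 + 0))%N); apply: SymM; first exact: SymZ.
  by apply: SymM; apply: IH; exact: SymS.
Qed.

(* [lam * (X + i (Z + a))] is an approximate solution of the Riccati equation
   [y' + y ^ 2 + (lam * a) ^ 2 = 0] of the logarithmic derivative of an
   oscillating solution, with residual [lam ^ 2 * (A + i B)].  One Newton step
   [y - residual / (2 i lam a)] improves the residual by one order. *)
Definition riccati (X Z A B : R -> R -> R) := forall lam t, 0 < lam -> 0 <= t ->
  hder (X lam) t (lam * (A lam t - X lam t ^+ 2 + (Z lam t + a t) ^+ 2 - a t ^+ 2)) /\
  hder (fun s => Z lam s + a s) t (lam * (B lam t - 2 * X lam t * (Z lam t + a t))).

(** The start [y = i lam a] has residual [i lam a'], of relative order 1. Each Newton step gains one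
    order and spends one derivative of [a], because the correction itself is differentiated in the
    new residual. *)
Lemma riccati_stage n : (n < m)%N -> exists X Z A B,
  [/\ Sym (m - n) 1 X, Sym (m - n) 1 Z, Sym (m - n.+1) n.+1 A,
      Sym (m - n.+1) n.+1 B & riccati X Z A B].
Proof.
elim: n => [|n IH] nm.
  have := Sym_speed; rewrite subn0; case: m nm => // m' _.
  case=> _ [g Hg Sg]; rewrite subSS subn0.
  exists (fun _ _ => 0), (fun _ _ => 0), (fun _ _ => 0), g; split=> //; try exact: Sym0.
  move=> lam t l0 t0; split.
    by rewrite expr0n /= subr0 add0r add0r subrr mulr0; exact: hder_cst.
  rewrite mulr0 mul0r subr0 (_ : (fun s => 0 + a s) = a); first exact: Hg.
  by apply/funext => s; rewrite add0r.
have [X [Z [A [B [SX SZ SA SB RXZ]]]]] := IH (ltnW nm).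
have SV : Sym (m - n.+1) 0 (fun _ t => (a t)^-1).
  exact: Sym_regW (leq_subr _ _) Sym_speedV.
pose dX lam t := - 2^-1 * (B lam t * (a t)^-1).
pose dZ lam t := 2^-1 * (A lam t * (a t)^-1).
have SdX : Sym (m - n.+1) n.+1 dX.
  by apply: SymZ; apply: (@SymMW _ n.+1 0) => //; rewrite addn0.
have SdZ : Sym (m - n.+1) n.+1 dZ.
  by apply: SymZ; apply: (@SymMW _ n.+1 0) => //; rewrite addn0.
have mE : (m - n.+1 = (m - n.+2).+1)%N by rewrite subnSK.
have {SX} SX : Sym (m - n.+1) 1 X by apply: Sym_regW SX; rewrite leq_sub2l.
have {SZ} SZ : Sym (m - n.+1) 1 Z by apply: Sym_regW SZ; rewrite leq_sub2l.
have SdX' := SdX; have SdZ' := SdZ.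
move: SdX' SdZ'; rewrite {1 2}mE => -[_ [gX HgX SgX]] [_ [gZ HgZ SgZ]].
have w f j : Sym (m - n.+1) j f -> Sym (m - n.+2) j f.
  by apply: Sym_regW; rewrite leq_sub2l.
(* The correction cancels the old residual against [2 i lam a] times itself. What remains is its
   derivative, its products with [X] and [Z] (order [1 + n.+1]) and its square (order
   [n.+1 + n.+1]), all of order at least [n.+2]. *)
exists (fun lam t => X lam t + dX lam t), (fun lam t => Z lam t + dZ lam t),
  (fun lam t => gX lam t + (2 * (X lam t * dX lam t) - 2 * (Z lam t * dZ lam t)
     + (dX lam t * dX lam t - dZ lam t * dZ lam t))),
  (fun lam t => gZ lam t + (2 * (X lam t * dZ lam t) + 2 * (Z lam t * dX lam t)
     + 2 * (dX lam t * dZ lam t))); split.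
- by apply: SymD => //; exact: Sym_orderW SdX.
- by apply: SymD => //; exact: Sym_orderW SdZ.
- have W : (n.+2 <= n.+1 + n.+1)%N by rewrite addSnnS leq_addl.
  apply: SymD => //; apply: SymD; first by
    apply: SymB; apply: SymZ; apply: (@SymMW _ 1 n.+1) => //; exact: w.
  by apply: SymB; apply: SymMW W _ _; exact: w.
- have W : (n.+2 <= n.+1 + n.+1)%N by rewrite addSnnS leq_addl.
  apply: SymD => //; apply: SymD; first by
    apply: SymD; apply: SymZ; apply: (@SymMW _ 1 n.+1) => //; exact: w.
  by apply: SymZ; apply: SymMW W _ _; exact: w.
- move=> lam t l0 t0; have [HX HZ] := RXZ lam t l0 t0.
  have an0 := lt0r_neq0 (a_gt0 t0); split.
    have := hderD HX (HgX lam t l0 t0); congr hder.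
    by rewrite /dX /dZ; field.
  have -> : (fun s => Z lam s + dZ lam s + a s) = (fun s => Z lam s + a s + dZ lam s).
    by apply/funext => s; rewrite addrAC.
  have := hderD HZ (HgZ lam t l0 t0); congr hder.
  by rewrite /dX /dZ; field.
Qed.

End Speed.
End Symbols.

(** * Energy of a single mode *)

Lemma eq_ler (R : numDomainType) (x y : R) : x = y -> x <= y.
Proof. by move->. Qed.

Section Oscillator.
Context {R : realType}.
Implicit Types (a v : R -> R) (lam t : R).

Definition oscillator a lam v (v1 : R -> R) := forall t, 0 <= t ->
  hder v t (v1 t) /\ hder v1 t (- (a t ^+ 2 * lam ^+ 2 * v t)).

Definition osc_energy (b lam : R) v (v1 : R -> R) t := v1 t ^+ 2 + b ^+ 2 * lam ^+ 2 * v t ^+ 2.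

Lemma osc_energy_ge0 (b lam : R) v (v1 : R -> R) t : 0 <= osc_energy b lam v v1 t.
Proof. by rewrite addr_ge0 ?sqr_ge0// mulr_ge0 ?sqr_ge0// mulr_ge0 ?sqr_ge0. Qed.

(** The left side is [B P ^ 2 - 2 A P W - B W ^ 2], a traceless form with eigenvalues plus or minus
    [sqrt (A ^ 2 + B ^ 2)]. The proof displays the difference of the two sides as a combination of
    squares with nonnegative coefficients. *)
Lemma riccati_form_le (A B M P W : R) : `|A| <= M -> `|B| <= M ->
  2 * P * (B * P - A * W) - B * (W ^+ 2 + P ^+ 2) <= 2 * M * (W ^+ 2 + P ^+ 2).
Proof.
move=> /[!ler_norml] /andP[A1 A2] /andP[B1 B2].
have h1 : 0 <= (M - B) * P ^+ 2 by rewrite mulr_ge0 ?sqr_ge0 ?subr_ge0.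
have h2 : 0 <= (B + M) * W ^+ 2 by rewrite mulr_ge0 ?sqr_ge0// -[M]opprK subr_ge0.
have h3 : 0 <= (A + M) * (P + W) ^+ 2 by rewrite mulr_ge0 ?sqr_ge0// -[M]opprK subr_ge0.
have h4 : 0 <= (M - A) * (P - W) ^+ 2 by rewrite mulr_ge0 ?sqr_ge0 ?subr_ge0.
rewrite -subr_ge0 [X in 0 <= X](_ : _ = (M - B) * P ^+ 2 + (B + M) * W ^+ 2 +
  2^-1 * ((A + M) * (P + W) ^+ 2 + (M - A) * (P - W) ^+ 2)); last by field.
by apply: addr_ge0; [exact: addr_ge0|rewrite mulr_ge0 ?invr_ge0//; exact: addr_ge0].
Qed.

Section Riccati_energy.
Variables (a : R -> R) (X Z A B : R -> R -> R).
Hypothesis RXZ : riccati a X Z A B.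
Variables (lam : R) (v v1 : R -> R).
Hypotheses (lam_gt0 : 0 < lam) (Hv : oscillator a lam v v1).

(* For real [v] this is [|v1 - y v| ^ 2], where [y = lam (X + i (Z + a))]. *)
Definition ric_num t := (v1 t - lam * X lam t * v t) ^+ 2 +
  (lam * (Z lam t + a t) * v t) ^+ 2.

Definition ric_energy t := ric_num t / (lam * (Z lam t + a t)).

Definition ric_denergy t := let z := lam * (Z lam t + a t) in
  let P := z * v t in let W := v1 t - lam * X lam t * v t in
  lam ^+ 2 / z ^+ 2 *
  (2 * P * (B lam t * P - A lam t * W) - B lam t * (W ^+ 2 + P ^+ 2)).

(** For an exact Riccati solution [y] the function [w = v1 - y v] satisfies [w' = - y w], while
    [Im y] has logarithmic derivative [- 2 Re y]; so [|w| ^ 2 / Im y] is conserved and only the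
    residual [A + i B] contributes to the derivative. *)
Lemma ric_energy_der t : 0 <= t -> 0 < Z lam t + a t ->
  hder ric_energy t (ric_denergy t).
Proof.
move=> t0 z0; have [hv hv1] := Hv t0; have [hX hZ] := RXZ lam_gt0 t0.
have hz := @hderZ _ _ _ _ lam hZ.
have hW := hderB hv1 (hderM (@hderZ _ _ _ _ lam hX) hv).
have hP := hderM hz hv.
have zn0 : lam * (Z lam t + a t) != 0 by rewrite mulf_neq0 ?gt_eqF.
have := hderM (hderD (hderM hW hW) (hderM hP hP))
  (@hderV _ (fun s => lam * (Z lam s + a s)) _ _ zn0 hz).
rewrite /ric_energy /ric_num; congr hder; rewrite /ric_denergy; field.
by rewrite gt_eqF //= gt_eqF.
Qed.

Variables (a0 a1 : R).
Hypotheses (a0_gt0 : 0 < a0) (a_bnd : forall t, 0 <= t -> a0 <= a t <= a1).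

Lemma ric_denergy_le t M : 0 <= t -> `|Z lam t| <= a0 / 2 ->
  `|A lam t| <= M -> `|B lam t| <= M ->
  ric_denergy t <= 4 * M / a0 * lam * ric_energy t.
Proof.
move=> t0 Zt At Bt; have M0 : 0 <= M by exact: le_trans (normr_ge0 _) At.
have /andP[aa0 aa1] := a_bnd t0.
have z2 : a0 / 2 <= Z lam t + a t.
  move: Zt; rewrite ler_norml => /andP[zl _]; have := lerD zl aa0.
  by rewrite addrC {1}(splitr a0) addrK.
have z0 : 0 < Z lam t + a t by apply: lt_le_trans z2; rewrite divr_gt0.
rewrite /ric_denergy; set z := lam * (Z lam t + a t).
have zgt0 : 0 < z by rewrite mulr_gt0.
set P := z * _; set W := (v1 t - _).
apply: (@le_trans _ _ (lam ^+ 2 / z ^+ 2 * (2 * M * (W ^+ 2 + P ^+ 2)))).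
  by rewrite ler_wpM2l ?divr_ge0 ?sqr_ge0// riccati_form_le.
have -> : ric_energy t = (W ^+ 2 + P ^+ 2) / z by [].
have -> : lam ^+ 2 / z ^+ 2 * (2 * M * (W ^+ 2 + P ^+ 2)) =
   (2 * M * lam ^+ 2 / z) * ((W ^+ 2 + P ^+ 2) / z).
  by field; rewrite gt_eqF.
rewrite ler_wpM2r ?divr_ge0 ?addr_ge0 ?sqr_ge0 ?(ltW zgt0)//.
rewrite ler_pdivrMr// [X in _ <= X](_ : _ = 2 * M * lam ^+ 2 * (2 / a0 * (Z lam t + a t))).
  rewrite -[X in X <= _]mulr1 ler_wpM2l//.
    by rewrite mulr_ge0 ?sqr_ge0// mulr_ge0.
  rewrite (_ : 2 / a0 * _ = (Z lam t + a t) / (a0 / 2)); last by field; rewrite gt_eqF.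
  by rewrite ler_pdivlMr ?divr_gt0// mul1r.
by rewrite /z; field; rewrite gt_eqF.
Qed.

(** The algebra behind [ric_energy_equiv], with [p = lam v], [w = v1], [x = X] and [al = Z + a]. The
    variable [r] stands for [(a1 / a0) ^ 2], so that no division occurs; the products that the final
    arithmetic needs are supplied beforehand. *)
Lemma quad_equiv (c p w x al r : R) : a0 <= c <= a1 -> a1 ^+ 2 = a0 ^+ 2 * r ->
  0 <= r -> - (a0 / 2) <= x -> x <= a0 / 2 ->
  a0 / 2 <= al -> al <= 3 / 2 * a1 ->
  let n := (w - x * p) ^+ 2 + (al * p) ^+ 2 in let e := w ^+ 2 + (c * p) ^+ 2 in
  n <= (2 + 3 * r) * e /\ e <= (2 + 4 * r) * n.
Proof.
move=> /andP[c0 c1] ra r0 xl xu al1 al2 n e.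
have sq (y b : R) : - b <= y -> y <= b -> y ^+ 2 <= b ^+ 2.
  move=> y1 y2; have yb : `|y| <= b by rewrite ler_norml y1.
  have b0 : 0 <= b by exact: le_trans (normr_ge0 _) yb.
  by rewrite -[y ^+ 2]real_normK ?num_real// lerXn2r ?nnegrE.
have x2 : x ^+ 2 <= (a0 / 2) ^+ 2 by exact: sq.
have al2' : al ^+ 2 <= (3 / 2 * a1) ^+ 2 by apply: sq => //; lra.
have al1' : (a0 / 2) ^+ 2 <= al ^+ 2 by apply: sq => //; lra.
have c0' : a0 ^+ 2 <= c ^+ 2 by apply: sq => //; lra.
have c1' : c ^+ 2 <= a1 ^+ 2 by apply: sq => //; lra.
have a01 : a0 ^+ 2 <= a1 ^+ 2 by exact: le_trans c1'.
have p2 := sqr_ge0 p; have w2 := sqr_ge0 w; have u2 := sqr_ge0 (w - x * p).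
have := ler_wpM2r p2 x2; have := ler_wpM2r p2 al2'.
have := ler_wpM2r p2 al1'; have := ler_wpM2r p2 c1'.
have := ler_wpM2l r0 (ler_wpM2r p2 c0'); have := ler_wpM2l r0 (ler_wpM2r p2 al1').
have := mulr_ge0 r0 w2; have := mulr_ge0 r0 u2.
have := mulr_ge0 r0 p2; have := ler_wpM2r p2 a01.
rewrite /n /e !exprMn ra !exprVn.
move=> h1 h2 h3 h4 h5 h6 h7 h8 h9 h10.
split; rewrite -subr_ge0; nra.
Qed.

Lemma ric_energy_equiv t : 0 <= t -> `|X lam t| <= a0 / 2 -> `|Z lam t| <= a0 / 2 ->
  lam * ric_energy t <= (4 + 9 * a1 ^+ 2 / a0 ^+ 2) / a0 * osc_energy (a t) lam v v1 t
  /\ osc_energy (a t) lam v v1 t <= 4 * a1 * (1 + 2 * a1 ^+ 2 / a0 ^+ 2) * (lam * ric_energy t).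
Proof.
move=> t0 Xt Zt; have /andP[aa0 aa1] := a_bnd t0.
have a10 : 0 < a1 by rewrite (lt_le_trans a0_gt0)// (le_trans aa0).
move: Xt Zt; rewrite !ler_norml => /andP[Xl Xu] /andP[Zl Zu].
set al := Z lam t + a t.
have al1 : a0 / 2 <= al by rewrite /al; lra.
have al2 : al <= 3 / 2 * a1 by rewrite /al; lra.
have al0 : 0 < al by apply: lt_le_trans al1; rewrite divr_gt0.
pose r := a1 ^+ 2 / a0 ^+ 2.
have r0 : 0 <= r by rewrite divr_ge0 ?sqr_ge0.
have rE : a1 ^+ 2 = a0 ^+ 2 * r by rewrite /r mulrC divfK// expf_neq0 ?gt_eqF.
have [] := @quad_equiv (a t) (lam * v t) (v1 t) (X lam t) al r _ rE r0 Xl Xu al1 al2.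
  by rewrite aa0.
have -> : v1 t ^+ 2 + (a t * (lam * v t)) ^+ 2 = osc_energy (a t) lam v v1 t.
  by rewrite /osc_energy; ring.
have -> : (v1 t - X lam t * (lam * v t)) ^+ 2 + (al * (lam * v t)) ^+ 2 =
  al * (lam * ric_energy t).
  by rewrite /ric_energy /ric_num -/al; field; rewrite !gt_eqF.
set E := osc_energy _ _ _ _ _; set Q := lam * _ => H1 H2.
have E0 : 0 <= E by exact: osc_energy_ge0.
have Q0 : 0 <= Q.
  by rewrite mulr_ge0 ?(ltW lam_gt0)// divr_ge0 ?addr_ge0 ?sqr_ge0// mulr_ge0 ?ltW.
rewrite -[9 * _ / _]mulrA -[2 * _ / _]mulrA -/r; split.
  rewrite (_ : _ / a0 * E = (4 + 9 * r) * E / a0); last by rewrite mulrAC.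
  rewrite ler_pdivlMr//.
  have : a0 / 2 * Q <= (2 + 3 * r) * E by apply: le_trans H1; exact: ler_wpM2r.
  have := mulr_ge0 r0 E0; nra.
apply: (le_trans H2).
have : (2 + 4 * r) * (al * Q) <= (2 + 4 * r) * (3 / 2 * a1 * Q).
  apply: ler_wpM2l; last exact: ler_wpM2r.
  by rewrite addr_ge0// mulr_ge0.
move/le_trans; apply.
have := mulr_ge0 (ltW a10) Q0; have := mulr_ge0 r0 (mulr_ge0 (ltW a10) Q0); nra.
Qed.

End Riccati_energy.
End Oscillator.

(** * The zone where [lam * Xi] is large *)

Section Zones.
Context {R : realType}.
Variables (m : nat) (Xi a : R -> R) (a0 a1 : R).
Hypothesis Xi_gt0 : forall t, 0 <= t -> 0 < Xi t.
Hypothesis Xi_homo : {in `[0, +oo[ &, {homo Xi : s t / s <= t}}.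
Hypotheses (a0_gt0 : 0 < a0) (a_bnd : forall t, 0 <= t -> a0 <= a t <= a1).
Hypothesis m_gt1 : (1 < m)%N.
Hypothesis a_der : forall k t, (k < m)%N -> 0 <= t ->
  hder (hderiven k a) t (hderiven k.+1 a t).
Hypothesis a_symbol : forall k, (1 <= k <= m)%N -> exists2 Ck : R, 0 < Ck &
  forall t, 0 <= t -> `|hderiven k a t| <= Ck * Xi t ^- k.

Let Xi_le s t : 0 <= s -> s <= t -> Xi s <= Xi t.
Proof.
by move=> s0 st; apply: Xi_homo => //; rewrite in_itv /= andbT// (le_trans s0).
Qed.

Let a1_gt0 : 0 < a1.
Proof. by have /andP[h1 h2] := a_bnd (lexx 0); rewrite (lt_le_trans a0_gt0)// (le_trans h1). Qed.

Lemma riccati_approx : exists X Z A B, exists2 K, 0 < K &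
  riccati a X Z A B /\
  forall lam t, 0 < lam -> 0 <= t -> 1 <= lam * Xi t ->
    [/\ `|X lam t| <= K * (lam * Xi t)^-1, `|Z lam t| <= K * (lam * Xi t)^-1,
        `|A lam t| <= K * (lam * Xi t) ^- m & `|B lam t| <= K * (lam * Xi t) ^- m].
Proof.
(* This is the last possible stage: the residual has order [m] and no derivative is left. *)
have [] := @riccati_stage R Xi m a a0 a1 a0_gt0 a_bnd a_der a_symbol m.-1.
  by rewrite ltn_predL (ltn_trans _ m_gt1).
move=> X [Z [A [B [+ + + + RXZ]]]]; rewrite prednK ?(ltn_trans _ m_gt1)//.
rewrite subnn => SX SZ [[CA CA0 HA] _] [[CB CB0 HB] _].
have [[CX CX0 HX] _] := Sym_regW (leq0n _) SX.
have [[CZ CZ0 HZ] _] := Sym_regW (leq0n _) SZ.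
exists X, Z, A, B, (1 + CX + CZ + CA + CB).
  by lra.
split=> // lam t l0 t0 s1.
have s0 j : 0 <= (lam * Xi t) ^- j.
  by rewrite invr_ge0 exprn_ge0// (le_trans _ s1).
split.
- apply: le_trans (HX _ _ l0 t0 s1) _; rewrite -[(_ * _)^-1]/((_ ^+ 1)^-1).
  by apply: ler_wpM2r => //; lra.
- apply: le_trans (HZ _ _ l0 t0 s1) _; rewrite -[(_ * _)^-1]/((_ ^+ 1)^-1).
  by apply: ler_wpM2r => //; lra.
- by apply: le_trans (HA _ _ l0 t0 s1) _; apply: ler_wpM2r => //; lra.
- by apply: le_trans (HB _ _ l0 t0 s1) _; apply: ler_wpM2r => //; lra.
Qed.

(* [J] stands for the tail integral of [Xi ^- m]: since [Xi] is monotone, Gronwall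
   on unit intervals needs only its unit decrements. *)
Lemma hyperbolic_zone : exists kappa K, [/\ 0 < kappa, 0 < K &
  forall lam v v1 J t0 t, 0 < lam -> oscillator a lam v v1 ->
    (forall s, 0 <= s -> 0 <= J s) ->
    (forall s, 0 <= s -> Xi (s + 1) ^- m <= J s - J (s + 1)) ->
    0 <= t0 -> kappa <= lam * Xi t0 -> t0 <= t ->
    osc_energy (a t) lam v v1 t <=
      K * expR (K * lam * (1 + lam ^- m * J t0)) * osc_energy (a t0) lam v v1 t0].
Proof.
have [X [Z [A [B [K0 K00 [RXZ HK]]]]]] := riccati_approx.
(* The summand 1 places the zone inside [lam * Xi >= 1]; the other one makes [K0 / (lam * Xi)],
   hence [X] and [Z], at most [a0 / 2], which keeps [Z + a] away from 0. *)
pose kappa := 1 + 2 * K0 / a0.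
have kappa1 : 1 <= kappa by rewrite lerDl divr_ge0 ?mulr_ge0 ?ltW.
have [b b0 bE] : exists2 b, 0 < b & b = 4 * K0 / a0.
  by exists (4 * K0 / a0) => //; rewrite divr_gt0// mulr_gt0.
pose C1 := (4 + 9 * a1 ^+ 2 / a0 ^+ 2) / a0.
pose C2 := 4 * a1 * (1 + 2 * a1 ^+ 2 / a0 ^+ 2).
have C10 : 0 < C1.
  by rewrite divr_gt0// ltr_wpDr// divr_ge0 ?sqr_ge0// mulr_ge0 ?sqr_ge0.
have C20 : 0 < C2.
  have r0 : 0 <= 2 * a1 ^+ 2 / a0 ^+ 2 by rewrite divr_ge0 ?sqr_ge0// mulr_ge0 ?sqr_ge0.
  by apply: mulr_gt0; [exact: mulr_gt0|lra].
exists kappa, (b + C2 * C1); split.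
- exact: lt_le_trans kappa1.
- by rewrite addr_gt0// mulr_gt0.
move=> lam v v1 J t0 t l0 Hv J0 HJ t00 k0 t0t.
have bl0 : 0 < b * lam by exact: mulr_gt0.
have reg s : t0 <= s -> [/\ 0 <= s, kappa <= lam * Xi s & 1 <= lam * Xi s].
  move=> t0s; have s0 : 0 <= s by exact: le_trans t0s.
  have : kappa <= lam * Xi s.
    by apply: (le_trans k0); rewrite ler_pM2l// Xi_le.
  by move=> h; split=> //; exact: le_trans h.
have small s : t0 <= s -> `|X lam s| <= a0 / 2 /\ `|Z lam s| <= a0 / 2.
  move=> /reg[s0 ks s1]; have [HX HZ _ _] := HK _ _ l0 s0 s1.
  have h : K0 * (lam * Xi s)^-1 <= a0 / 2.
    have : 2 * K0 / a0 <= lam * Xi s by apply: le_trans ks; rewrite lerDr.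
    rewrite ler_pdivrMr// => h; rewrite ler_pdivrMr ?(lt_le_trans _ s1)//.
    by rewrite mulrAC ler_pdivlMr// mulrC (le_trans h)// mulrC.
  by split; [exact: le_trans HX h|exact: le_trans HZ h].
(* An upper bound for the logarithmic growth rate of [Q]. It decreases in [s], so its value at the
   left end controls a whole unit interval. *)
pose beta s := b * lam * (lam * Xi s) ^- m.
have beta0 s : t0 <= s -> 0 <= beta s.
  move=> /reg[_ _ s1]; rewrite mulr_ge0 ?(ltW bl0)//.
  by rewrite invr_ge0 exprn_ge0// (le_trans _ s1).
have beta_le s s' : t0 <= s -> s <= s' -> beta s' <= beta s.
  move=> t0s ss'; have [s0 _ s1] := reg s t0s.
  have [s'0 _ s'1] := reg s' (le_trans t0s ss').
  rewrite ler_wpM2l ?(ltW bl0)//.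
  rewrite lef_pV2 ?posrE ?exprn_gt0 ?(lt_le_trans _ s1) ?(lt_le_trans _ s'1)//.
  apply: lerXn2r; rewrite ?nnegrE ?(le_trans ler01 s1) ?(le_trans ler01 s'1)//.
  by rewrite ler_pM2l// Xi_le.
pose Q := ric_energy a X Z lam v v1.
have Zpos s : t0 <= s -> 0 < Z lam s + a s.
  move=> t0s; have [s0 _ _] := reg s t0s; have [_] := small s t0s.
  have /andP[h1 _] := a_bnd s0; rewrite ler_norml => /andP[h2 _].
  by move: (a0_gt0); lra.
have Q0 s : t0 <= s -> 0 <= Q s.
  move=> /Zpos z0; rewrite divr_ge0 ?addr_ge0 ?sqr_ge0// mulr_ge0 ?ltW//.
have step s h : t0 <= s -> 0 <= h -> h <= 1 -> Q (s + h) <= Q s * expR (beta s).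
  move=> t0s h0 h1; have [s0 _ _] := reg s t0s.
  apply: (@le_trans _ _ (Q s * expR (beta s * (s + h - s)))).
    apply: (@hder_gronwall _ Q (ric_denergy a X Z A B lam v v1)) => //.
    - by rewrite lerDl.
    - move=> u /andP[su _]; apply: ric_energy_der => //; first exact: le_trans su.
      by apply: Zpos; exact: le_trans su.
    - move=> u /andP[su _]; have t0u := le_trans t0s su.
      have [u0 _ u1] := reg u t0u; have [_ Zu] := small u t0u.
      have [_ _ HA HB] := HK _ _ l0 u0 u1.
      apply: (le_trans (ric_denergy_le X v v1 l0 a0_gt0 a_bnd u0 Zu HA HB)).
      apply: ler_wpM2r; first exact: Q0.
      apply: le_trans (beta_le _ _ t0s su).
      by rewrite /beta bE le_eqVlt; apply/orP; left; apply/eqP; ring.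
  rewrite addrAC subrr add0r ler_wpM2l ?Q0// ler_expR.
  by rewrite -[leRHS]mulr1 ler_wpM2l// beta0.
(* A telescoping potential: the interval starting at [t0 + n] costs [beta (t0 + n)], which [Phi]
   already contains, and the next [beta (t0 + n + 1)] is paid by the decrement of [J]. *)
pose Phi s := beta s + b * lam * lam ^- m * J s.
have tail0 s : t0 <= s -> 0 <= b * lam * lam ^- m * J s.
  by move=> /reg[s0 _ _]; rewrite mulr_ge0 ?J0// mulr_ge0 ?(ltW bl0)// invr_ge0 exprn_ge0// ltW.
have t0n n : t0 <= t0 + n%:R by rewrite lerDl.
have iter n : Q (t0 + n%:R) <= Q t0 * expR (Phi t0 - Phi (t0 + n%:R)).
  elim: n => [|n IH]; first by rewrite addr0 subrr expR0 mulr1.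
  rewrite -natr1 addrA.
  apply: (le_trans (step _ 1 (t0n n) ler01 (lexx 1))).
  apply: (le_trans (ler_wpM2r (expR_ge0 _) IH)).
  rewrite -mulrA -expRD ler_wpM2l ?Q0// ler_expR.
  have [tn0 _ _] := reg _ (t0n n).
  have := HJ _ tn0; rewrite -(ler_pM2l (_ : 0 < b * lam * lam ^- m)); last first.
    by rewrite mulr_gt0// invr_gt0 exprn_gt0.
  have -> : b * lam * lam ^- m * Xi (t0 + n%:R + 1) ^- m = beta (t0 + n%:R + 1).
    by rewrite /beta exprMn invfM mulrA.
  rewrite /Phi mulrBr; lra.
have tt0 : 0 <= t - t0 by rewrite subr_ge0.
have /andP[nle nlt] := truncn_itv tt0.
set n := Num.truncn _ in nle nlt.
have Qt : Q t <= Q t0 * expR (Phi t0).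
  have -> : t = t0 + n%:R + (t - t0 - n%:R) by ring.
  apply: (le_trans (step _ _ (t0n n) _ _)); first by rewrite subr_ge0.
    by rewrite lerBlDl natr1 ltW.
  apply: (le_trans (ler_wpM2r (expR_ge0 _) (iter n))).
  rewrite -mulrA -expRD ler_wpM2l ?Q0// ler_expR /Phi.
  have := tail0 _ (t0n n); lra.
have Phi0 : Phi t0 <= b * lam * (1 + lam ^- m * J t0).
  rewrite mulrDr mulr1 mulrA lerD2r /beta -[leRHS]mulr1 ler_wpM2l//.
    exact: ltW.
  have [_ _ s1] := reg t0 (lexx _).
  by rewrite invf_le1 ?exprn_ege1// exprn_gt0// (lt_le_trans _ s1).
have [t00' _ _] := reg t0 (lexx _); have [tg0 _ _] := reg t t0t.
have [Xt0 Zt0] := small t0 (lexx _); have [Xt Zt] := small t t0t.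
have [E1 _] := ric_energy_equiv v v1 l0 a0_gt0 a_bnd t00' Xt0 Zt0.
have [_ E2] := ric_energy_equiv v v1 l0 a0_gt0 a_bnd tg0 Xt Zt.
apply: (le_trans E2); rewrite -/C2.
apply: (@le_trans _ _ (C2 * (lam * (Q t0 * expR (b * lam * (1 + lam ^- m * J t0)))))).
  rewrite ler_wpM2l ?(ltW C20)// ler_wpM2l ?(ltW l0)// (le_trans Qt)//.
  by rewrite ler_wpM2l ?Q0// ler_expR.
have Et0 := @osc_energy_ge0 R (a t0) lam v v1 t0.
apply: (@le_trans _ _ (C2 * (expR (b * lam * (1 + lam ^- m * J t0)) *
   (C1 * osc_energy (a t0) lam v v1 t0)))).
  apply: ler_wpM2l; first exact: ltW.
  have := ler_wpM2l (expR_ge0 (b * lam * (1 + lam ^- m * J t0))) E1.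
  apply: le_trans; apply: eq_ler.
  rewrite -/Q; ring.
rewrite (_ : C2 * _ = C2 * C1 * expR (b * lam * (1 + lam ^- m * J t0)) *
   osc_energy (a t0) lam v v1 t0); last by ring.
have CC := mulr_gt0 C20 C10.
apply: ler_wpM2r => //; apply: ler_pM; [exact: ltW|exact: expR_ge0|by rewrite lerDr ltW|].
rewrite ler_expR; apply: ler_wpM2r.
  by rewrite addr_ge0// mulr_ge0 ?J0// invr_ge0 exprn_ge0 ?ltW.
by apply: ler_wpM2r; [exact: ltW|rewrite lerDl ltW].
Qed.

End Zones.

(** * The early zone, with the limit speed in the energy *)

Section PseudoZone.
Context {R : realType}.
Local Notation mu := (@lebesgue_measure R).

Lemma pseudo_zone (a Theta : R -> R) (a0 a1 ainf lam : R) (v v1 : R -> R) :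
  0 < a0 -> (forall t, 0 <= t -> a0 <= a t <= a1) ->
  (forall t, 0 <= t -> exists l, hder a t l) -> 0 < ainf ->
  (forall t, 0 <= t -> (\int[mu]_(s in `[0%R, t]) `|a s - ainf|%:E
       <= (Theta t)%:E)%E) ->
  0 < lam -> oscillator a lam v v1 ->
  forall t, 0 <= t ->
  osc_energy ainf lam v v1 t <=
    osc_energy ainf lam v v1 0 * expR ((a1 + ainf) / ainf * lam * Theta t).
Proof.
move=> a0_gt0 a_bnd a_der ainf0 aT l0 Hv t t0.
pose f s := `|a s - ainf|.
pose c := (a1 + ainf) / ainf * lam.
have a10 : 0 < a1.
  by have /andP[h1 h2] := a_bnd 0 (lexx 0); rewrite (lt_le_trans a0_gt0)// (le_trans h1).
have c0 : 0 < c by rewrite mulr_gt0// divr_gt0// addr_gt0.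
have ca u : 0 <= u -> {within `[0, u], continuous a}.
  by move=> u0; apply: hder_within_continuous => // s /andP[/a_der].
have cf u : 0 <= u -> {within `[0, u], continuous f}.
  move=> u0; apply/subspace_continuousP => s su.
  move/subspace_continuousP : (ca u u0) => /(_ s su) h.
  by apply: cvg_norm; apply: cvgB => //; exact: cvg_cst.
have intf u : 0 <= u -> mu.-integrable `[0, u] (EFin \o f).
  by move=> u0; apply: continuous_compact_integrable; [exact: segment_compact|exact: cf].
pose G s := c * parameterized_integral mu 0 s f.
have Gt : G t <= c * Theta t.
  rewrite ler_wpM2l ?(ltW c0)// -lee_fin.
  rewrite /parameterized_integral fineK; first exact: aT.
  by apply: integrable_fin_num => //; exact: intf.
have G0 : 0 <= G 0.
  by apply: mulr_ge0; [exact: ltW|apply: Rintegral_ge0 => x _; exact: normr_ge0].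
have key := @gronwall R (osc_energy ainf lam v v1)
  (fun s => 2 * v1 s * v s * lam ^+ 2 * (ainf ^+ 2 - a s ^+ 2))
  G (fun s => c * f s) 0 t t0.
apply: (le_trans (key _ _ _ _ _)).
- apply: hder_within_continuous => // s /andP[s0 _].
  have [h1 h2] := Hv s s0.
  eexists; apply: (hderD (hderM h2 h2) (@hderZ _ _ _ _ _ (hderM h1 h1))).
- apply/subspace_continuousP => s st; apply: cvgM; first exact: cvg_cst.
  have := parameterized_integral_continuous t0 (intf t t0).
  by move/subspace_continuousP => /(_ s st).
- move=> s /andP[s0 st]; apply: hder_is_derive => //.
  have [h1 h2] := Hv s (ltW s0).
  have := hderD (hderM h2 h2) (@hderZ _ _ _ _ (ainf ^+ 2 * lam ^+ 2) (hderM h1 h1)).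
  by congr hder; ring.
- move=> s /andP[s0 st].
  have [] := @continuous_FTC1_closed R f 0 s t st (intf t t0) s0.
    have [l /hder_is_derive] := a_der s (ltW s0).
    move=> /(_ s0) [/derivable1_diffP/differentiable_continuous ac _].
    by apply: cvg_norm; apply: cvgB => //; exact: cvg_cst.
  move=> dF F'; have dF' : is_derive s 1 (parameterized_integral mu 0 ^~ f) (f s).
    by split; [exact: dF|rewrite -derive1E; exact: F'].
  have := is_deriveZ c dF'; rewrite /GRing.scale /=; apply.
- move=> s /andP[s0 st]; rewrite /osc_energy.
  have /andP[as0 as1] := a_bnd s (ltW s0).
  (* Factoring the difference of squares isolates [|a - ainf|], the part that [Theta] controls. The
     factor [(a + ainf) / ainf] gives the constant in the exponent, and the bracket is at most the
     energy by the arithmetic-geometric mean inequality. *)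
  have -> : 2 * v1 s * v s * lam ^+ 2 * (ainf ^+ 2 - a s ^+ 2) =
    (a s + ainf) / ainf * lam * ((ainf - a s) * (2 * v1 s * (ainf * lam * v s))).
    by field; rewrite gt_eqF.
  apply: (@le_trans _ _ ((a s + ainf) / ainf * lam * (f s *
    (v1 s ^+ 2 + (ainf * lam * v s) ^+ 2)))).
    rewrite ler_wpM2l//.
      by rewrite mulr_ge0 ?(ltW l0)// divr_ge0 ?(ltW ainf0)// addr_ge0 ?(ltW ainf0)// (le_trans (ltW a0_gt0)).
    apply: (le_trans (ler_norm _)); rewrite normrM /f distrC ler_wpM2l//.
    rewrite ler_norml; set p := _ * v s.
    have := sqr_ge0 (v1 s + p); have := sqr_ge0 (v1 s - p) => h1 h2.
    by apply/andP; split; nra.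
  rewrite (_ : _ + ainf ^+ 2 * _ * _ = v1 s ^+ 2 + (ainf * lam * v s) ^+ 2); last by ring.
  rewrite mulrA ler_wpM2r ?addr_ge0 ?sqr_ge0// ler_wpM2r ?normr_ge0//.
  by rewrite ler_wpM2r ?(ltW l0)// ler_wpM2r ?invr_ge0 ?(ltW ainf0)// lerD2r.
- rewrite ler_wpM2l ?osc_energy_ge0// ler_expR (le_trans _ Gt)//.
  by rewrite lerBlDr lerDl.
Qed.

(** A decreasing [g] is at least [g (t + 1)] on the unit interval starting at [t]. With
    [g = Xi ^- m] this produces the function [J] that [hyperbolic_zone] asks for. *)
Lemma tail_integral_step (g : R -> R) : (forall t, 0 <= t -> 0 <= g t) ->
  {in `[0, +oo[ &, {homo g : s t /~ s <= t}} ->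
  mu.-integrable `[0%R, +oo[ (fun t => (g t)%:E) ->
  forall t, 0 <= t ->
  let J u := \int[mu]_(s in `[u, +oo[) g s in
  0 <= J t /\ g (t + 1) <= J t - J (t + 1).
Proof.
move=> g0 gd gi t t0 J.
have sub u : 0 <= u -> [set` `[u, +oo[] `<=` [set` `[(0:R), +oo[].
  by move=> u0 x /=; rewrite !in_itv /= !andbT; exact: le_trans.
have gi' u : 0 <= u -> mu.-integrable `[u, +oo[ (fun t => (g t)%:E).
  by move=> u0; apply: integrableS gi => //; exact: sub.
have J0 u : 0 <= u -> 0 <= J u.
  move=> u0; apply: Rintegral_ge0 => x /=; rewrite in_itv /= andbT => ux.
  by apply: g0; exact: le_trans ux.
split; first exact: J0.
have t10 : 0 <= t + 1 by rewrite addr_ge0.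
have tt1 : t <= t + 1 by rewrite lerDl.
have E : [set` `[t, +oo[] = [set` `[t, t + 1[] `|` [set` `[t + 1, +oo[] :> set R.
  by rewrite -itv_bndbnd_setU// bnd_simp.
have JE : (\int[mu]_(s in `[t, +oo[) (g s)%:E = \int[mu]_(s in `[t, (t+1)%R[) (g s)%:E +
   \int[mu]_(s in `[(t + 1)%R, +oo[) (g s)%:E)%E.
  rewrite E ge0_integral_setU//.
  - by rewrite -E; exact: measurable_int (gi' t t0).
  - move=> x; rewrite -E /= in_itv /= andbT => tx; rewrite lee_fin g0//.
    exact: le_trans tx.
  - apply/disj_setPS => x [] /=; rewrite !in_itv /= andbT => /andP[_ x1] x2.
    by move: (lt_le_trans x1 x2); rewrite ltxx.
have st : [set` `[t, (t+1)%R[] `<=` [set` `[(0:R), +oo[].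
  by move=> x; rewrite /= !in_itv /= andbT => /andP[+ _]; exact: le_trans.
have low : ((g (t + 1))%:E <= \int[mu]_(s in `[t, (t+1)%R[) (g s)%:E)%E.
  have -> : ((g (t + 1))%:E = \int[mu]_(s in `[t, (t+1)%R[) (cst (g (t + 1))%:E s))%E.
    rewrite integral_cst//= lebesgue_measure_itv /= lte_fin ltrDl ltr01.
    by rewrite -EFinB addrAC subrr add0r mule1.
  apply: ge0_le_integral => //.
  - by move=> x _; rewrite lee_fin g0.
  - by apply: measurable_funS (measurable_int _ gi) => //.
  - move=> x /[dup] /st /=; rewrite !in_itv /= andbT => x0 /andP[_ x1].
    by rewrite lee_fin; apply: gd => //; rewrite ?in_itv /= ?andbT// ltW.
have fin u : 0 <= u -> (\int[mu]_(s in `[u, +oo[) (g s)%:E)%E = (J u)%:E.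
  by move=> u0; rewrite /J fineK//; apply: integrable_fin_num => //; exact: gi'.
rewrite -lee_fin EFinB -!fin// JE addeK//.
by rewrite fin.
Qed.

End PseudoZone.

(** * The inverse of [Lambda] *)

Section LinvTheory.
Context {R : realType}.
Variable Lambda : R -> R.
Hypothesis Lambda_cont : {within `[0, +oo[, continuous Lambda}.
Hypothesis Lambda_homo : {in `[0, +oo[ &, {homo Lambda : s t / s < t}}.
Hypothesis Lambda_oo : Lambda t @[t --> +oo] --> +oo.

Let in0 (t : R) : 0 <= t -> t \in `[0, +oo[.
Proof. by move=> t0; rewrite in_itv /= t0. Qed.

Lemma Lambda_le s t : 0 <= s -> s <= t -> Lambda s <= Lambda t.
Proof.
move=> s0; rewrite le_eqVlt => /predU1P[->//|st]; apply: ltW.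
by apply: Lambda_homo => //; apply: in0 => //; exact: le_trans (ltW st).
Qed.

Lemma Linv_ge0 r : 0 <= Linv Lambda r.
Proof. by rewrite /Linv; case: xgetP => // t _ []. Qed.

Lemma LinvK r : Lambda 0 <= r -> Lambda (Linv Lambda r) = r.
Proof.
move=> r0; rewrite /Linv; case: xgetP => [t _ []//|H].
have /cvgryPge /(_ r) [T [_ HT]] := Lambda_oo.
pose S := Num.max (T + 1) 0.
have S0 : 0 <= S by rewrite le_max lexx orbT.
have rS : r <= Lambda S by apply: HT; rewrite lt_max ltrDl ltr01.
have [||c] := @IVT R Lambda 0 S r S0.
- apply: continuous_subspaceW Lambda_cont => x /=.
  by rewrite !in_itv /= andbT => /andP[].
- by rewrite ge_min r0 /= le_max rS orbT.
by rewrite in_itv /= => /andP[c0 _] cr; exfalso; apply: (H c).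
Qed.

Lemma Linv_lt r : r < Lambda 0 -> Linv Lambda r = 0.
Proof.
move=> r0; rewrite /Linv; case: xgetP => // t _ [t0 tr].
by move: (Lambda_le (lexx 0) t0); rewrite tr leNgt r0.
Qed.

Lemma Linv_homo r s : r <= s -> Linv Lambda r <= Linv Lambda s.
Proof.
move=> rs; have [r0|r0] := ltP r (Lambda 0); first by rewrite Linv_lt// Linv_ge0.
rewrite leNgt; apply/negP => H.
have := Lambda_homo (in0 (Linv_ge0 s)) (in0 (Linv_ge0 r)) H.
by rewrite !LinvK// ?(le_trans r0)// ltNge rs.
Qed.

(** Valid for all [r] thanks to the default value 0 of [Linv] below [Lambda 0]; this spares a case
    distinction where the zones meet. *)
Lemma Lambda_Linv_ge r : r <= Lambda (Linv Lambda r).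
Proof. by have [r0|r0] := ltP r (Lambda 0); [rewrite Linv_lt// ltW|rewrite LinvK]. Qed.

Variable Theta : R -> R.
Hypothesis Lambda_gt0 : forall t, 0 <= t -> 0 < Lambda t.
Hypothesis ratio_homo : {in `[0, +oo[ &, {homo (fun t => Theta t / Lambda t) : s t / s <= t}}.

(** Monotonicity of [Theta / Lambda] between the times [Linv Lambda r] and [Linv Lambda (k * r)], at
    which [Lambda] takes the values [r] and [k * r]. Below [Lambda 0] the second identity may fail,
    whence the lower bound on [r]. *)
Lemma Theta_Linv_scale k r : 1 <= k -> Lambda 0 <= r ->
  k * Theta (Linv Lambda r) <= Theta (Linv Lambda (k * r)).
Proof.
move=> k1 r0; have rgt0 : 0 < r by apply: lt_le_trans r0; exact: Lambda_gt0.
have rkr : r <= k * r by rewrite ler_peMl// ltW.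
have := ratio_homo (in0 (Linv_ge0 r)) (in0 (Linv_ge0 (k * r))) (Linv_homo rkr).
rewrite /= !LinvK ?(le_trans r0)// ler_pdivlMr ?(lt_le_trans rgt0)//.
by apply: le_trans; apply: eq_ler; field; rewrite gt_eqF.
Qed.

End LinvTheory.

(** * The energy of one mode, uniformly in the frequency *)

Section EnergyEstimate.
Context {R : realType}.
Local Notation mu := (@lebesgue_measure R).
Variables (m : nat) (a Theta Xi Lambda : R -> R) (a0 a1 ainf : R).
Hypotheses (m_gt1 : (1 < m)%N) (a0_gt0 : 0 < a0).
Hypothesis a_bnd : forall t, 0 <= t -> a0 <= a t <= a1.
Hypothesis a_der : forall k t, (k < m)%N -> 0 <= t ->
  hder (hderiven k a) t (hderiven k.+1 a t).
Hypothesis Theta_gt0 : forall t, 0 <= t -> 0 < Theta t.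
Hypothesis Theta_homo : {in `[0, +oo[ &, {homo Theta : s t / s <= t}}.
Hypothesis Xi_gt0 : forall t, 0 <= t -> 0 < Xi t.
Hypothesis Xi_homo : {in `[0, +oo[ &, {homo Xi : s t / s <= t}}.
Hypothesis Lambda_gt0 : forall t, 0 <= t -> 0 < Lambda t.
Hypothesis Lambda_cont : {within `[0, +oo[, continuous Lambda}.
Hypothesis Lambda_homo : {in `[0, +oo[ &, {homo Lambda : s t / s < t}}.
Hypothesis Lambda_oo : Lambda t @[t --> +oo] --> +oo.
Hypothesis ainf_gt0 : 0 < ainf.
Hypothesis a_stab : forall t, 0 <= t ->
    (\int[mu]_(s in `[0%R, t]) `|a s - ainf|%:E <= (Theta t)%:E)%E.
Hypothesis a_symbol : forall k, (1 <= k <= m)%N -> exists2 Ck : R, 0 < Ck &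
  forall t, 0 <= t -> `|hderiven k a t| <= Ck * Xi t ^- k.
Hypothesis ratio_homo : {in `[0, +oo[ &, {homo (fun t => Theta t / Lambda t) : s t / s <= t}}.
Hypothesis Lambda_Xi : exists2 C0 : R, 0 < C0 & forall t, 0 <= t -> Lambda t <= C0 * Xi t.
Hypothesis Xi_int : mu.-integrable `[0%R, +oo[ (fun t => (Xi t ^- m)%:E).
Hypothesis tail_sup : (ereal_sup [set ((Lambda t ^+ m / Theta t)%:E *
       \int[mu]_(s in `[t, +oo[) (Xi s ^- m)%:E)%E | t in [set t | (0 <= t)%R]] < +oo)%E.

Lemma tail_bound : exists (J : R -> R) (S : R), 0 < S /\
  [/\ (forall t, 0 <= t -> 0 <= J t),
      (forall t, 0 <= t -> Xi (t + 1) ^- m <= J t - J (t + 1)) &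
      forall t, 0 <= t -> J t <= S * Theta t * Lambda t ^- m].
Proof.
pose J u := \int[mu]_(s in `[u, +oo[) (Xi s ^- m).
have Xi0 t : 0 <= t -> 0 <= Xi t ^- m.
  by move=> t0; rewrite invr_ge0 exprn_ge0// ltW// Xi_gt0.
have Xid : {in `[0, +oo[ &, {homo (fun t => Xi t ^- m) : s t /~ s <= t}}.
  move=> t s; rewrite !in_itv /= !andbT => t0 s0 ts.
  rewrite lef_pV2 ?posrE ?exprn_gt0 ?Xi_gt0//.
  apply: lerXn2r; rewrite ?nnegrE ?(ltW (Xi_gt0 _))//.
  by apply: Xi_homo => //; rewrite in_itv /= ?s0 ?t0.
have H := tail_integral_step Xi0 Xid Xi_int.
have := tail_sup; set A := ereal_sup _ => Aoo.
(* The constant is the finite supremum in the hypothesis, enlarged to be positive. *)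
exists J, (1 + `|fine A|); split; first by rewrite ltr_pwDl.
split.
- by move=> t t0; have [] := H t t0.
- by move=> t t0; have [] := H t t0.
move=> t t0; have JE : (\int[mu]_(s in `[t, +oo[) (Xi s ^- m)%:E = (J t)%:E)%E.
  rewrite /J fineK//; apply: integrable_fin_num => //.
  apply: integrableS Xi_int => // x /=; rewrite !in_itv /= !andbT; exact: le_trans.
have : ((Lambda t ^+ m / Theta t * J t)%:E <= A)%E.
  by apply: ereal_sup_ubound; exists t => //; rewrite JE.
move: Aoo; case: (A) => [r _ /=|//|]; last by rewrite leeNy_eq.
rewrite lee_fin => h.
have h' : Lambda t ^+ m / Theta t * J t <= 1 + `|r|.
  by apply: (le_trans h); rewrite (le_trans (ler_norm _))// lerDr.
have L0 : 0 < Lambda t ^+ m by rewrite exprn_gt0 ?Lambda_gt0.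
rewrite ler_pdivlMr//.
by move: h'; rewrite mulrAC [_ * J t]mulrC ler_pdivrMr ?Theta_gt0.
Qed.

Lemma osc_energy_compare (b b' lam : R) (v v1 : R -> R) t : b' != 0 ->
  osc_energy b lam v v1 t <= (1 + b ^+ 2 / b' ^+ 2) * osc_energy b' lam v v1 t.
Proof.
move=> b'0; rewrite /osc_energy.
have h2 : 0 <= b' ^+ 2 * lam ^+ 2 * v t ^+ 2 by rewrite -!exprMn sqr_ge0.
have h3 : 0 <= b ^+ 2 / b' ^+ 2 * v1 t ^+ 2 by rewrite -expr_div_n -exprMn sqr_ge0.
have -> : (1 + b ^+ 2 / b' ^+ 2) * (v1 t ^+ 2 + b' ^+ 2 * lam ^+ 2 * v t ^+ 2) =
  v1 t ^+ 2 + b ^+ 2 / b' ^+ 2 * v1 t ^+ 2 + b' ^+ 2 * lam ^+ 2 * v t ^+ 2 +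
  b ^+ 2 * lam ^+ 2 * v t ^+ 2 by field.
lra.
Qed.

(** The two zones are glued at [tx = Linv Lambda (N / lam)]. The bound [lmax] on the frequency
    enters only the factor [C]. *)
Lemma osc_energy_estimate lmax : exists N0 C, [/\ 1 <= N0, 0 < C &
  forall lam v v1, 0 <= lam <= lmax -> oscillator a lam v v1 ->
  forall t, 0 <= t -> osc_energy (a t) lam v v1 t <=
    C * expR (2 * lam * Theta (Linv Lambda (N0 / lam))) * osc_energy (a 0) lam v v1 0].
Proof.
have [kappa [K [k0 K0 hyp]]] := hyperbolic_zone Xi_homo a0_gt0 a_bnd m_gt1 a_der a_symbol.
have [J [S [S0 [J0 Jstep Jtail]]]] := tail_bound.
have [C0 C00 LX] := Lambda_Xi.
have ader0 t : 0 <= t -> exists l, hder a t l.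
  by move=> t0; eexists; apply: (a_der (k := 0)) => //; exact: ltn_trans m_gt1.
have [a00 a01] : a0 <= a 0 /\ a 0 <= a1 by apply/andP; exact: a_bnd.
have a10 : 0 < a1 by rewrite (lt_le_trans a0_gt0)// (le_trans a00).
(* At [tx] one has [lam * Lambda tx >= N]. With [Lambda <= C0 * Xi] this yields
   [lam * Xi tx >= kappa], the entrance condition of the second zone; [N >= 1] lets the tail be
   bounded by [Theta tx]. *)
have [N N1 Nk] : exists2 N, 1 <= N & kappa * C0 <= N.
  by exists (Num.max 1 (kappa * C0)); rewrite le_max lexx ?orbT.
have [c1 c10 c1E] : exists2 c1, 0 <= c1 & c1 = (a1 + ainf) / ainf.
  by exists ((a1 + ainf) / ainf) => //; rewrite divr_ge0 ?ltW// addr_gt0.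
have [c c0 cE] : exists2 c, 0 < c & c = c1 + K * S.
  by exists (c1 + K * S) => //; rewrite ltr_wpDl// mulr_gt0.
pose k := Num.max 1 c.
have k1 : 1 <= k by rewrite le_max lexx.
have ck : c <= k by rewrite le_max lexx orbT.
have [D D1 DE] : exists2 D, 1 <= D &
    D = (1 + a1 ^+ 2 / ainf ^+ 2) * (1 + ainf ^+ 2 / a0 ^+ 2).
  by eexists; last reflexivity; rewrite mulr_ege1// lerDl -expr_div_n sqr_ge0.
pose lm := Num.max lmax 0.
(* Collects what the weight cannot absorb: the term [K * lam] of the second zone, and the whole
   exponent when [N / lam < Lambda 0], in which case [tx = 0]. *)
pose X := expR (K * lm + c * lm * Theta 0).
have lm0 : 0 <= lm by rewrite le_max lexx orbT.
have X1 : 1 <= X.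
  rewrite -expR0 ler_expR addr_ge0 ?mulr_ge0 ?(ltW K0) ?(ltW c0)//.
  exact/ltW/Theta_gt0.
exists (k * N), ((1 + K) * D * X); split.
- by rewrite mulr_ege1.
- apply: mulr_gt0; last exact: lt_le_trans X1.
  by apply: mulr_gt0; [exact: addr_gt0|exact: lt_le_trans D1].
(* At [lam = 0] the zones make no sense, but then [v1] is constant and the energy is [v1 ^ 2]. *)
move=> lam v v1 /andP[]; rewrite le_eqVlt => /predU1P[<- _ Hv t t0|l0 llm Hv t t0].
  rewrite mulr0 mul0r expR0 mulr1 /osc_energy !expr0n /= !mulr0 !mul0r !addr0.
  have h := @hder_lip R v1 (fun s => - (a s ^+ 2 * 0 ^+ 2 * v s)) 0 t 0 (lexx 0) t0.
  have /h : forall s, 0 <= s <= t -> hder v1 s (- (a s ^+ 2 * 0 ^+ 2 * v s)).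
    by move=> s /andP[s0 _]; have [] := Hv s s0.
  have z s : 0 <= s <= t -> `|- (a s ^+ 2 * 0 ^+ 2 * v s)| <= 0.
    by move=> _; rewrite expr0n /= mulr0 mul0r oppr0 normr0.
  move=> /(_ z); rewrite mul0r normr_le0 subr_eq0 => /eqP ->.
  rewrite ler_peMl ?sqr_ge0//.
  by rewrite mulr_ege1// mulr_ege1// lerDl ltW.
have llm' : lam <= lm by rewrite le_max llm.
set E := osc_energy (a 0) lam v v1 0.
have E0 : 0 <= E by exact: osc_energy_ge0.
pose tx := Linv Lambda (N / lam).
have tx0 : 0 <= tx by exact: Linv_ge0.
have Ltx : N / lam <= Lambda tx by exact: Lambda_Linv_ge.
have T0 : 0 < Theta tx by exact: Theta_gt0.
have zone1 s : 0 <= s -> s <= tx ->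
    osc_energy (a s) lam v v1 s <= D * expR (c1 * lam * Theta tx) * E.
  move=> s0 stx; have /andP[as0 as1] := a_bnd s0.
  apply: (le_trans (osc_energy_compare (a s) lam v v1 s (lt0r_neq0 ainf_gt0))).
  apply: (@le_trans _ _ ((1 + a1 ^+ 2 / ainf ^+ 2) * osc_energy ainf lam v v1 s)).
    rewrite ler_wpM2r ?osc_energy_ge0// lerD2l ler_wpM2r ?invr_ge0 ?sqr_ge0//.
    by apply: lerXn2r; rewrite ?nnegrE ?(ltW a10)// (le_trans (ltW a0_gt0)).
  have rA : 0 <= 1 + a1 ^+ 2 / ainf ^+ 2 by rewrite addr_ge0// -expr_div_n sqr_ge0.
  rewrite DE -!(mulrA (1 + _)); apply: ler_wpM2l => //.
  apply: (le_trans (pseudo_zone a0_gt0 a_bnd ader0 ainf_gt0 a_stab l0 Hv s0)).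
  apply: (@le_trans _ _ (osc_energy ainf lam v v1 0 * expR (c1 * lam * Theta tx))).
    rewrite ler_wpM2l ?osc_energy_ge0// ler_expR -c1E ler_wpM2l//.
      by rewrite mulr_ge0// ltW.
    by apply: Theta_homo => //; rewrite in_itv /= ?s0 ?tx0.
  rewrite mulrC -mulrA [X in _ <= X]mulrCA ler_wpM2l ?expR_ge0//.
  apply: (le_trans (osc_energy_compare ainf lam v v1 0 (lt0r_neq0 (lt_le_trans a0_gt0 a00)))).
  apply: ler_wpM2r => //; rewrite lerD2l; apply: ler_wpM2l; first exact: sqr_ge0.
  rewrite lef_pV2 ?posrE ?exprn_gt0 ?(lt_le_trans a0_gt0 a00)//.
  by apply: lerXn2r; rewrite ?nnegrE// ?(ltW a0_gt0) ?(le_trans (ltW a0_gt0)).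
have both : osc_energy (a t) lam v v1 t <=
    (1 + K) * D * expR (K * lm + c * lam * Theta tx) * E.
  have [ttx|txt] := leP t tx.
    apply: (le_trans (zone1 t t0 ttx)); rewrite ler_wpM2r//.
    apply: ler_pM; [exact: le_trans D1|exact: expR_ge0| |].
      by rewrite ler_peMl ?(le_trans ler01 D1)// lerDl ltW.
    rewrite ler_expR -!mulrA cE mulrDl addrA [_ + c1 * _]addrC -addrA lerDl.
    by rewrite addr_ge0// mulr_ge0 ?(ltW K0)// mulr_ge0// ltW.
  have ks : kappa <= lam * Xi tx.
    have h1 : N <= lam * Lambda tx by rewrite mulrC -ler_pdivrMr.
    have h2 := ler_wpM2l (ltW l0) (LX tx tx0).
    have : kappa * C0 <= lam * Xi tx * C0.
      by apply: (le_trans Nk); apply: (le_trans h1); apply: (le_trans h2); rewrite mulrA mulrAC.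
    by rewrite ler_pM2r.
  apply: (le_trans (hyp _ _ _ _ _ _ l0 Hv J0 Jstep tx0 ks (ltW txt))).
  have z1 := zone1 tx tx0 (lexx _).
  have tail : lam ^- m * J tx <= S * Theta tx.
    apply: (le_trans (ler_wpM2l _ (Jtail tx tx0))).
      by rewrite invr_ge0 exprn_ge0 ?ltW.
    rewrite mulrCA -invfM -exprMn ler_pdivrMr; last first.
      by rewrite exprn_gt0// mulr_gt0// Lambda_gt0.
    apply: ler_peMr; first by rewrite mulr_ge0// ltW.
    by apply: exprn_ege1; rewrite (le_trans N1)// mulrC -ler_pdivrMr.
  apply: (@le_trans _ _ (K * expR (K * lam * (1 + S * Theta tx)) *
      (D * expR (c1 * lam * Theta tx) * E))).
    apply: ler_pM => //; rewrite ?mulr_ge0 ?expR_ge0 ?osc_energy_ge0 ?(ltW K0)//.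
    rewrite ler_wpM2l ?(ltW K0)// ler_expR ler_wpM2l ?mulr_ge0 ?(ltW K0) ?(ltW l0)//.
    by rewrite lerD2l.
  rewrite (_ : K * _ * _ = K * D * expR (K * lam * (1 + S * Theta tx) + c1 * lam * Theta tx) * E);
    last by rewrite expRD; ring.
  apply: ler_wpM2r => //; apply: ler_pM.
  - by rewrite mulr_ge0 ?(ltW K0)// (le_trans ler01 D1).
  - exact: expR_ge0.
  - by apply: ler_wpM2r; [exact: le_trans D1|rewrite lerDr].
  rewrite ler_expR cE (_ : K * lam * _ + _ = K * lam + (c1 + K * S) * lam * Theta tx);
    last by ring.
  by rewrite lerD2r ler_wpM2l// ltW.
apply: (le_trans both); rewrite ler_wpM2r//.
rewrite -!mulrA; apply: ler_wpM2l; first by rewrite addr_ge0// ltW.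
apply: ler_wpM2l; first exact: (le_trans ler01 D1).
rewrite /X -expRD ler_expR.
have TT0 := Theta_gt0 (lexx 0).
have [r0|r0] := ltP (N / lam) (Lambda 0).
  have -> : tx = 0 by exact: Linv_lt.
  have h1 : c * lam * Theta 0 <= c * lm * Theta 0.
    by rewrite ler_wpM2r ?(ltW TT0)// ler_wpM2l ?(ltW c0).
  have h2 : 0 <= 2 * (lam * Theta (Linv Lambda (k * (N * lam^-1)))).
    by rewrite mulr_ge0// mulr_ge0 ?(ltW l0)// ltW// Theta_gt0// Linv_ge0.
  rewrite !mulrA in h2 *; lra.
have h := Theta_Linv_scale Lambda_cont Lambda_homo Lambda_oo Lambda_gt0 ratio_homo k1 r0.
have h1 : c * lam * Theta tx <= 2 * lam * Theta (Linv Lambda (k * (N / lam))).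
  rewrite mulrAC [X in _ <= X]mulrAC ler_wpM2r ?(ltW l0)//.
  have h3 : c * Theta tx <= k * Theta tx by rewrite ler_wpM2r ?(ltW T0).
  apply: (le_trans h3); apply: (le_trans h); rewrite ler_peMl ?ler1n//.
  by rewrite ltW// Theta_gt0// Linv_ge0.
have h2 : 0 <= c * lm * Theta 0.
  by apply: mulr_ge0; [apply: mulr_ge0 => //; exact: ltW|exact: ltW].
rewrite !mulrA in h1 *; lra.
Qed.

End EnergyEstimate.

Lemma ler_sum_subset (R : numDomainType) (I : choiceType) (s t : seq I) (g : I -> R) :
  (forall i, 0 <= g i) -> uniq s -> uniq t -> {subset s <= t} ->
  \sum_(i <- s) g i <= \sum_(i <- t) g i.
Proof.
move=> g0 us ut st; rewrite [leRHS](bigID (mem s)) /=.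
have -> : \sum_(i <- t | i \in s) g i = \sum_(i <- s) g i.
  rewrite -big_filter; apply: perm_big; apply: uniq_perm => //.
    exact: filter_uniq.
  by move=> i; rewrite mem_filter; have [/st ->|] := boolP (i \in s).
by rewrite lerDl sumr_ge0.
Qed.

(** * Absolutely summable functions on the lattice *)

Section LatticeBoxes.
Context {d : nat}.
Local Notation Zd := 'rV[int]_d.

Definition zsup (k : Zd) : nat := \max_(j < d) absz (k 0%R j).

(** Shifting by [n] identifies the cube with the maps into [2 n + 1] values, so its cardinality is
    immediate. *)
Definition zpoint n (f : {ffun 'I_d -> 'I_(n.*2.+1)}) : Zd :=
  \row_j ((f j)%:Z - n%:Z).

Definition zbox n : seq Zd := map (@zpoint n) (enum {: {ffun 'I_d -> 'I_(n.*2.+1)}}).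

Lemma zsup_le (k : Zd) n : (zsup k <= n)%N = [forall j, `|k 0 j| <= n%:Z].
Proof.
apply/bigmax_leqP/forallP => H j; last first.
  by move=> _; have := H j; rewrite -abszE lez_nat.
by rewrite -abszE lez_nat H.
Qed.

Lemma mem_zbox n k : (k \in zbox n) = (zsup k <= n)%N.
Proof.
rewrite zsup_le /zbox; apply/mapP/forallP => [[f _ ->] j|H].
  rewrite mxE ler_norml; have := ltn_ord (f j).
  move: (nat_of_ord _) => i; rewrite ltnS -addnn => h.
  by rewrite lerBrDl addrN lerBlDl -PoszD !lez_nat h.
have lt j : (absz (k 0 j + n%:Z)%R < n.*2.+1)%N.
  have := H j; rewrite ler_norml => /andP[h1 h2].
  rewrite ltnS -addnn -lez_nat gez0_abs; last by rewrite -lerBlDr sub0r.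
  by rewrite PoszD lerD2r.
exists [ffun j => Ordinal (lt j)]; first exact: mem_enum.
apply/rowP => j; rewrite mxE ffunE /= gez0_abs ?addrK//.
by have := H j; rewrite ler_norml => /andP[h1 _]; rewrite -lerBlDr sub0r.
Qed.

Lemma zpoint_inj n : injective (@zpoint n).
Proof.
move=> f g /rowP E; apply/ffunP => j; have := E j; rewrite !mxE => /addIr [].
exact: val_inj.
Qed.

Lemma zbox_uniq n : uniq (zbox n).
Proof. by rewrite map_inj_uniq ?enum_uniq//; exact: zpoint_inj. Qed.

Lemma size_zbox n : size (zbox n) = (n.*2.+1 ^ d)%N.
Proof. by rewrite size_map -cardE card_ffun !card_ord. Qed.

Lemma sum_cube (V : nmodType) (g : Zd -> V) n :
  \sum_(k \in cube n) g k = \sum_(k <- zbox n) g k.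
Proof.
rewrite (_ : cube n = [set` zbox n]); first by rewrite -fsbig_seq ?zbox_uniq.
apply/seteqP; split=> k /=; rewrite mem_zbox zsup_le => H.
- by apply/forallP => j; exact: H.
- by move=> j; move/forallP : H; exact.
Qed.

Lemma zsupD (k l : Zd) : (zsup (k + l) <= zsup k + zsup l)%N.
Proof.
apply/bigmax_leqP => j _; rewrite mxE -lez_nat PoszD.
apply: (@le_trans _ _ (`|k 0 j| + `|l 0 j|)); first by rewrite abszE ler_normD.
by rewrite lerD// -abszE lez_nat; exact: (leq_bigmax (F := fun j => absz (_ 0 j))).
Qed.

Lemma zsupN (k : Zd) : zsup (- k) = zsup k.
Proof. by apply: eq_bigr => j _; rewrite mxE abszN. Qed.

Lemma zsup_delta (j : 'I_d) : (zsup (delta_mx 0%R j) <= 1)%N.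
Proof. by apply/bigmax_leqP => i _; rewrite mxE; case: (_ && _). Qed.

End LatticeBoxes.

Section LatticeSums.
Context {R : realType} {d : nat}.
Local Notation Zd := 'rV[int]_d.
Implicit Types (g h : Zd -> R).

Definition rpart g n : R := \sum_(k <- zbox n) g k.

Definition rsum g : R := limn (rpart g).

(** Absolute summability as boundedness of partial sums over cubes, a form in which domination
    arguments need no limits. *)
Definition asum g := exists B, forall n, rpart (fun k => `|g k|) n <= B.

Lemma rpart_le g h n : (forall k, g k <= h k) -> rpart g n <= rpart h n.
Proof. by move=> gh; apply: ler_sum. Qed.

Lemma rpart_homo g : (forall k, 0 <= g k) -> nondecreasing_seq (rpart g).
Proof.
move=> g0 n m nm; apply: ler_sum_subset => //; try exact: zbox_uniq.
by move=> k; rewrite !mem_zbox => /leq_trans; apply.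
Qed.

Lemma rpartD g h n : rpart (fun k => g k + h k) n = rpart g n + rpart h n.
Proof. exact: big_split. Qed.

Lemma rpartB g h n : rpart (fun k => g k - h k) n = rpart g n - rpart h n.
Proof. by rewrite rpartD /rpart sumrN. Qed.

Lemma rpartZ c g n : rpart (fun k => c * g k) n = c * rpart g n.
Proof. by rewrite /rpart -mulr_sumr. Qed.

Lemma rpart_norm g n : `|rpart g n| <= rpart (fun k => `|g k|) n.
Proof. exact: ler_norm_sum. Qed.

Lemma asum_dom g h c : (forall k, `|g k| <= c * h k) -> asum h -> asum g.
Proof.
move=> gh [B HB]; exists (`|c| * B) => n.
apply: (@le_trans _ _ (rpart (fun k => `|c| * `|h k|) n)).
  by apply: rpart_le => k; rewrite -normrM (le_trans (gh k))// ler_norm.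
by rewrite rpartZ ler_wpM2l.
Qed.

Lemma asumD g h : asum g -> asum h -> asum (fun k => g k + h k).
Proof.
move=> [B HB] [C HC]; exists (B + C) => n.
apply: (@le_trans _ _ (rpart (fun k => `|g k| + `|h k|) n)).
  by apply: rpart_le => k; exact: ler_normD.
by rewrite rpartD lerD.
Qed.

Lemma asumZ c g : asum g -> asum (fun k => c * g k).
Proof.
move=> [B HB]; exists (`|c| * B) => n.
rewrite (_ : (fun k => `|c * g k|) = fun k => `|c| * `|g k|).
  by rewrite rpartZ ler_wpM2l.
by apply/funext => k; rewrite normrM.
Qed.

Lemma asum_norm g : asum g -> asum (fun k => `|g k|).
Proof.
move=> [B HB]; exists B => n; apply: le_trans (HB n).
by apply: rpart_le => k; rewrite normr_id.
Qed.

Let cvg_rpart_ge0 g : (forall k, 0 <= g k) -> asum g -> cvgn (rpart g).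
Proof.
move=> g0 [B HB]; apply: nondecreasing_is_cvgn; first exact: rpart_homo.
exists B => _ [n _ <-]; apply: le_trans (HB n).
by apply: rpart_le => k; exact: ler_norm.
Qed.

Lemma cvg_rpart g : asum g -> rpart g n @[n --> \oo] --> rsum g.
Proof.
move=> ag; suff : cvgn (rpart g) by [].
have -> : rpart g = (fun n => rpart (fun k => g k + `|g k|) n - rpart (fun k => `|g k|) n).
  by apply/funext => n; rewrite rpartD addrK.
apply: is_cvgB; last by apply: cvg_rpart_ge0; [|exact: asum_norm].
apply: cvg_rpart_ge0; last by apply: asumD => //; exact: asum_norm.
by move=> k; rewrite -lerBlDr sub0r lerNl -normrN ler_norm.
Qed.

Lemma rsum_unique g l : rpart g n @[n --> \oo] --> l -> rsum g = l.
Proof. exact: cvg_lim. Qed.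

Lemma rsumD g h : asum g -> asum h -> rsum (fun k => g k + h k) = rsum g + rsum h.
Proof.
move=> ag ah; apply: rsum_unique.
rewrite (_ : rpart _ = fun n => rpart g n + rpart h n); last first.
  by apply/funext => n; exact: rpartD.
by apply: cvgD; exact: cvg_rpart.
Qed.

Lemma rsumZ c g : asum g -> rsum (fun k => c * g k) = c * rsum g.
Proof.
move=> ag; apply: rsum_unique.
rewrite (_ : rpart _ = fun n => c * rpart g n); last first.
  by apply/funext => n; exact: rpartZ.
by apply: cvgM; [exact: cvg_cst|exact: cvg_rpart].
Qed.

Lemma rsumB g h : asum g -> asum h -> rsum (fun k => g k - h k) = rsum g - rsum h.
Proof.
move=> ag ah; have := rsumD ag (asumZ (-1) ah); rewrite rsumZ// mulN1r => <-.
by congr rsum; apply/funext => k; rewrite mulN1r.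
Qed.

Lemma rsum_le g h : asum g -> asum h -> (forall k, g k <= h k) -> rsum g <= rsum h.
Proof.
move=> ag ah gh; apply: ler_lim; [exact: cvg_rpart|exact: cvg_rpart|].
by apply: nearW => n; exact: rpart_le.
Qed.

Lemma rsum_norm g : asum g -> `|rsum g| <= rsum (fun k => `|g k|).
Proof.
move=> ag; have an := asum_norm ag; rewrite ler_norml; apply/andP; split.
  rewrite lerNl -[leLHS]mulN1r -rsumZ//; apply: rsum_le => //; first exact: asumZ.
  by move=> k; rewrite mulN1r -normrN ler_norm.
by apply: rsum_le => // k; exact: ler_norm.
Qed.

Lemma rsum_norm_le g h c : asum h -> (forall k, `|g k| <= c * h k) ->
  `|rsum g| <= c * rsum h.
Proof.
move=> ah gh; have ag := asum_dom gh ah.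
apply: (le_trans (rsum_norm ag)); rewrite -rsumZ//; apply: rsum_le => //.
- exact: asum_norm.
- exact: asumZ.
Qed.

Lemma rpart_le_rsum g n : (forall k, 0 <= g k) -> asum g -> rpart g n <= rsum g.
Proof.
move=> g0 ag; apply: nondecreasing_cvgn_le; first exact: rpart_homo.
exact: cvg_rpart.
Qed.

(** A cube translated by [e] lies in the cube enlarged by [zsup e]; this replaces any rearrangement
    of series. *)
Lemma asum_shift (e : Zd) g : asum g -> asum (fun k => g (k + e)).
Proof.
move=> [B HB]; exists B => n; apply: le_trans (HB (n + zsup e)%N).
rewrite /rpart -(big_map (fun k => k + e) predT (fun k => `|g k|)).
apply: ler_sum_subset => //.
- by rewrite map_inj_uniq ?zbox_uniq//; exact: addIr.
- exact: zbox_uniq.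
- move=> _ /mapP[k + ->]; rewrite !mem_zbox => kn.
  by apply: leq_trans (zsupD _ _) _; rewrite leq_add2r.
Qed.

Let rsum_shift_le (e : Zd) g : (forall k, 0 <= g k) -> asum g ->
  rsum (fun k => g (k + e)) <= rsum g.
Proof.
move=> g0 ag; apply: limr_le; first exact: (cvg_rpart (asum_shift e ag)).
apply: nearW => n; apply: le_trans (rpart_le_rsum (n + zsup e) g0 ag).
rewrite /rpart -(big_map (fun k => k + e) predT g).
apply: ler_sum_subset => //.
- by rewrite map_inj_uniq ?zbox_uniq//; exact: addIr.
- exact: zbox_uniq.
- move=> _ /mapP[k + ->]; rewrite !mem_zbox => kn.
  by apply: leq_trans (zsupD _ _) _; rewrite leq_add2r.
Qed.

(** The missing inequality is the known one for the translated function and [- e]. Signs are handled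
    afterwards by [g = (g + |g|) - |g|]. *)
Let rsum_shift_ge0 (e : Zd) g : (forall k, 0 <= g k) -> asum g ->
  rsum (fun k => g (k + e)) = rsum g.
Proof.
move=> g0 ag; apply/eqP; rewrite eq_le rsum_shift_le//=.
have := @rsum_shift_le (- e) (fun k => g (k + e)) (fun k => g0 _) (asum_shift e ag).
by under eq_fun do rewrite subrK.
Qed.

Lemma rsum_shift (e : Zd) g : asum g -> rsum (fun k => g (k + e)) = rsum g.
Proof.
move=> ag; have an := asum_norm ag; have agn := asumD ag an.
have gg k : g k = (g k + `|g k|) - `|g k| by rewrite addrK.
have -> : rsum g = rsum (fun k => (g k + `|g k|) - `|g k|).
  by congr rsum; apply/funext.
have -> : rsum (fun k => g (k + e)) =
    rsum (fun k => (g (k + e) + `|g (k + e)|) - `|g (k + e)|).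
  by congr rsum; apply/funext => k; rewrite addrK.
rewrite !rsumB//; [|exact: (asum_shift e agn)|exact: (asum_shift e an)].
rewrite (@rsum_shift_ge0 e (fun k => g k + `|g k|))//; last first.
  by move=> k; rewrite -lerBlDr sub0r lerNl -normrN ler_norm.
by rewrite (@rsum_shift_ge0 e (fun k => `|g k|)).
Qed.

(** The exponent [d.+1] is the least integer one that is summable on the lattice, and it is the
    power of [|k|] in the decay condition. *)
Definition weight (k : Zd) : R := (zsup k).+1%:R ^- d.+1.

Lemma weight_gt0 k : 0 < weight k.
Proof. by rewrite invr_gt0 exprn_gt0. Qed.

Lemma weight_le1 k : weight k <= 1.
Proof. by rewrite invf_le1 ?exprn_gt0// exprn_ege1// ler1n. Qed.

Lemma subXn_le (x y : R) n : 0 <= x -> x <= y ->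
  y ^+ n - x ^+ n <= n%:R * (y - x) * y ^+ n.-1.
Proof.
move=> x0 xy; have y0 := le_trans x0 xy.
rewrite subrXX [n%:R * _]mulrC -mulrA ler_wpM2l ?subr_ge0//.
apply: (@le_trans _ _ (\sum_(i < n) y ^+ n.-1)); last first.
  by rewrite sumr_const card_ord mulr_natl.
apply: ler_sum => i _; have [n1|] := posnP n; first by case: i => i; rewrite n1.
move=> n0; rewrite -[X in _ <= _ ^+ X](@subnK i); last by rewrite -ltnS prednK.
rewrite exprD; apply: ler_wpM2l; first exact: exprn_ge0.
by apply: lerXn2r; rewrite ?nnegrE.
Qed.

(** The shell [zsup k = n.+1] has at most a constant times [n.+2 ^ (d - 1)] points, each of weight
    [n.+2 ^- d.+1], so it contributes at most [C / (n.+1 * n.+2)]. *)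
Lemma asum_weight : asum weight.
Proof.
pose C : R := d%:R * 2 * 2 ^+ d.
have C0 : 0 <= C by rewrite mulr_ge0 ?exprn_ge0// mulr_ge0.
exists (1 + C) => n.
have -> : rpart (fun k => `|weight k|) n = rpart weight n.
  by apply: eq_bigr => k _; rewrite gtr0_norm ?weight_gt0.
(* The increments of [1 - 1 / n.+1] are exactly [1 / (n.+1 * n.+2)], so the sum over shells
   telescopes. *)
suff : rpart weight n <= 1 + C * (1 - n.+1%:R^-1).
  by move/le_trans; apply; rewrite lerD2l ler_piMr// gerBl.
elim: n => [|n IH].
  rewrite invr1 subrr mulr0 addr0 /rpart.
  have : size (zbox (d := d) 0) = 1%N by rewrite size_zbox exp1n.
  by case: (zbox 0) => [//|k []//= _]; rewrite big_seq1 weight_le1.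
pose w : R := n.+2%:R ^- d.+1.
have w0 : 0 < w by rewrite invr_gt0 exprn_gt0.
have -> : rpart weight n.+1 = rpart weight n + w *+ (size (zbox (d := d) n.+1) - size (zbox (d := d) n)).
  rewrite /rpart (bigID (fun k => k \in zbox n)) /=.
  have P : perm_eq [seq k <- zbox n.+1 | k \in zbox n] (zbox (d := d) n).
    apply: uniq_perm; [exact/filter_uniq/zbox_uniq|exact: zbox_uniq|move=> k].
    rewrite mem_filter !mem_zbox; have [kn|//] := leqP (zsup k) n.
    by rewrite (leq_trans kn).
  rewrite -big_filter (perm_big _ P); congr (_ + _).
  rewrite -(perm_size P) size_filter -(count_predC (fun k => k \in zbox n) (zbox n.+1)) addKn -big_filter.
  rewrite (eq_big_seq (fun=> w)); last first.
    move=> k; rewrite mem_filter !mem_zbox -ltnNge => /andP[k1 k2].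
    by rewrite /weight (_ : zsup k = n.+1)//; apply/eqP; rewrite eqn_leq k2.
  by rewrite big_const_seq count_predT iter_addr_0 size_filter.
have cnt : (size (zbox (d := d) n.+1) - size (zbox (d := d) n))%:R <=
    d%:R * 2 * (2 * n.+2%:R : R) ^+ d.-1.
  rewrite !size_zbox natrB; last first.
    by have [->|d0] := posnP d; rewrite ?expn0// leq_exp2r// ltnS leq_double.
  rewrite !natrX; have h := @subXn_le (n.*2.+1%:R) (n.+1.*2.+1%:R) d.
  have h2 : (n.*2.+1)%:R <= (n.+1.*2.+1)%:R :> R by rewrite ler_nat !doubleS ltnS ltnW.
  apply: (le_trans (h (ler0n _ _) h2)).
  have -> : (n.+1.*2.+1)%:R - (n.*2.+1)%:R = 2 :> R.
    by rewrite -natrB ?doubleS 2?leqW// !subSS subSn ?leqW// subSnn.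
  apply: ler_wpM2l; first by rewrite mulr_ge0.
  apply: lerXn2r; rewrite ?nnegrE//.
  by rewrite -natrM ler_nat mul2n !doubleS ltnW.
apply: (le_trans (lerD IH (lexx _))); rewrite -addrA lerD2l -lerBrDl -mulrBr.
have -> : 1 - n.+2%:R^-1 - (1 - n.+1%:R^-1) = (n.+1%:R * n.+2%:R)^-1 :> R.
  have key (x : R) : 0 < x -> 1 - (x + 1)^-1 - (1 - x^-1) = (x * (x + 1))^-1.
    by move=> x0; field; rewrite !gt_eqF// addr_gt0.
  by rewrite -[n.+2%:R]natr1 key.
rewrite -[w *+ _]mulr_natl.
apply: (le_trans (ler_wpM2r (ltW w0) cnt)).
have [d0|] := posnP d; first by rewrite /C d0 !mul0r.
move=> d0; rewrite /C -!mulrA; apply: ler_wpM2l => //; apply: ler_wpM2l => //.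
have gen e : (2 * n.+2%:R : R) ^+ e * n.+2%:R ^- e.+2 <=
    2 ^+ e.+1 * (n.+1%:R * n.+2%:R)^-1.
  rewrite -[e.+2]addn2 exprD invfM exprMn -mulrA mulVKf ?expf_neq0 ?pnatr_eq0//.
  apply: ler_pM; rewrite ?invr_ge0 ?exprn_ge0//.
    by rewrite exprS ler_peMl ?exprn_ge0 ?ler1n.
  by rewrite lef_pV2 ?posrE ?exprn_gt0 ?mulr_gt0// expr2 ler_wpM2r// ler_nat.
by have := gen d.-1; rewrite !prednK.
Qed.

End LatticeSums.

(** * Parseval's identity on the torus *)

Section TorusIntegral.
Context {R : realType}.
Local Notation Rm := (measurableTypeR R).
Local Notation leb := (@lebesgue_measure R).

Lemma sin_natpi n : sin (n%:R * pi) = 0 :> R.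
Proof.
elim: n => [|n IH]; first by rewrite mul0r sin0.
by rewrite -natr1 mulrDl mul1r sinDpi IH oppr0.
Qed.

Lemma sin_intpi (m : int) : sin (m%:~R * pi) = 0 :> R.
Proof.
case: m => n; first exact: sin_natpi.
by rewrite NegzE mulrNz mulNr sinN -[n.+1%:~R]/(n.+1%:R) sin_natpi oppr0.
Qed.

(* The summand 1 makes the integrand nonnegative, so that Tonelli applies in
   on the torus. *)
Lemma integral_circle_cos (m : int) (c : R) :
  (\int[leb]_(x in `[(- pi)%R, pi]) (1 + cos (m%:~R * x + c))%:E =
   (2 * pi * (1 + (m == 0)%:R * cos c))%:E)%E.
Proof.
have pi0 := @pi_gt0 R; have pp : - pi < pi :> R by rewrite gt0_cp.
have [->|m0] := eqVneq m 0.
  rewrite mul1r; under eq_integral do rewrite mul0r add0r.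
  rewrite integral_cst//= lebesgue_measure_itv /= lte_fin pp.
  by rewrite -EFinB -EFinM; congr (_%:E); ring.
have mn0 : m%:~R != 0 :> R by rewrite intr_eq0.
pose f x := 1 + cos (m%:~R * x + c).
pose F x := x + sin (m%:~R * x + c) / m%:~R.
have dF (x : R) : is_derive x 1 F (f x).
  have d1 : is_derive x 1 (fun x : R => m%:~R * x + c) m%:~R.
    by apply: is_derive_eq; rewrite /GRing.scale /= mulr1 addr0.
  have d2 : is_derive x 1 (sin \o (fun x : R => m%:~R * x + c))
     (cos (m%:~R * x + c) * m%:~R) by exact: is_derive1_comp.
  have d0 : is_derive x 1 (id : R -> R) 1 by exact: is_derive_id.
  have := is_deriveD d0 (is_deriveZ (m%:~R^-1) d2).
  rewrite /GRing.scale /= mulrCA mulVf// mulr1.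
  rewrite (_ : _ + _ = F)//; apply/funext => y /=.
  by rewrite /F mulrC.
have cF : continuous F.
  by move=> x; apply/differentiable_continuous/derivable1_diffP; have [] := dF x.
have cf : continuous f.
  move=> x; apply: cvgD; first exact: cvg_cst.
  apply: (@cvg_comp _ _ _ (fun x : R => m%:~R * x + c) cos _ (nbhs (m%:~R * x + c))).
    by apply: cvgD; [apply: cvgM; [exact: cvg_cst|exact: cvg_id]|exact: cvg_cst].
  exact: continuous_cos.
rewrite (@continuous_FTC2 R f F (- pi) pi pp).
- rewrite mul0r addr0 mulr1 -EFinB; congr (_%:E); rewrite /F.
  have -> : m%:~R * - pi + c = c - m%:~R * pi by ring.
  have -> : m%:~R * pi + c = c + m%:~R * pi by ring.
  rewrite sinB sinD sin_intpi !mulr0 addr0 subr0; ring.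
- exact: continuous_subspaceT.
- split; first by move=> x _; have [] := dF x.
  + exact: cvg_at_right_filter (cF _).
  + exact: cvg_at_left_filter (cF _).
- by move=> x _; rewrite derive1E; have [] := dF x.
Qed.

Lemma measurable_tnthT d (j : 'I_d) : measurable_fun setT (fun t : d.-tuple Rm => tnth t j).
Proof. exact: measurable_tnth. Qed.

Lemma measurable_zdot d (k : 'rV[int]_d) : measurable_fun setT (fun t : d.-tuple Rm => zdot k t).
Proof.
apply: measurable_sum => j.
by apply: measurable_funM => //; exact: measurable_tnthT.
Qed.

Lemma measurable_cos_zdot d (k : 'rV[int]_d) (c : R) :
  measurable_fun setT (fun t : d.-tuple Rm => cos (zdot k t + c)).
Proof.
apply: (measurableT_comp (f := cos)); first by apply: continuous_measurable_fun; exact: continuous_cos.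
by apply: measurable_funD => //; exact: measurable_zdot.
Qed.

Lemma measurable_torus d : measurable (torus : set (d.-tuple Rm)).
Proof.
rewrite (_ : torus = \bigcap_(j in [set: 'I_d])
   ((fun t : d.-tuple Rm => tnth t j) @^-1` `[- pi, pi])).
  apply: fin_bigcap_measurable => // j _.
  by rewrite -[X in measurable X]setTI; apply: measurable_tnthT => //.
apply/seteqP; split=> t /= H j; first by move=> _; rewrite /= in_itv /=; exact: H.
by have := H j I; rewrite /= in_itv.
Qed.

Lemma torus_consT d (x : R) (t : d.-tuple Rm) :
  torus (consT (x, t)) <-> - pi <= x <= pi /\ torus t.
Proof.
split=> [H|[hx ht] j].
  split; first exact: (H ord0).
  by move=> j; have := H (lift ord0 j); rewrite tnthS.
by have [k ->|->] := unliftP ord0 j; rewrite ?tnthS //; exact: ht.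
Qed.

Lemma zdot_consT d (k : 'rV[int]_d.+1) (x : R) (t : d.-tuple Rm) :
  zdot k (consT (x, t)) = (k 0 0)%:~R * x + zdot (\row_j k 0 (lift 0 j)) t.
Proof.
rewrite /zdot big_ord_recl; congr (_ + _); apply: eq_bigr => j _.
by rewrite mxE tnthS.
Qed.

Lemma row_eq0_recl d (k : 'rV[int]_d.+1) :
  (k == 0) = (k 0 0 == 0) && (\row_j k 0 (lift 0 j) == 0 :> 'rV[int]_d).
Proof.
apply/eqP/andP => [->|[/eqP k0 /eqP/rowP k1]].
  by split; [rewrite mxE|apply/eqP/rowP => j; rewrite !mxE].
apply/rowP => j; rewrite mxE; have [i ->|->//] := unliftP ord0 j.
by have := k1 i; rewrite !mxE.
Qed.

(** Tonelli in the first coordinate. The phase [c] is arbitrary because in the inner integral the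
    remaining coordinates are part of it. *)
Lemma integral_torus_cos d (k : 'rV[int]_d) (c : R) :
  (\int[lebesgue_tuple d]_(t in torus) (1 + cos (zdot k t + c))%:E =
   ((2 * pi) ^+ d * (1 + (k == 0)%:R * cos c))%:E)%E.
Proof.
elim: d k c => [|d IH] k c.
  rewrite /= integral_dirac; [|exact: measurable_torus|].
    rewrite diracE mem_set; last by case.
    by rewrite mul1e /zdot big_ord0 add0r expr0 mul1r (_ : k == 0) ?mul1r//; apply/eqP/rowP; case.
  apply/measurable_EFinP; apply: measurable_funTS.
  by apply: measurable_funD => //; exact: measurable_cos_zdot.
pose F (t : d.+1.-tuple Rm) := (1 + cos (zdot k t + c))%:E.
have F0 t : (0 <= F t)%E by rewrite lee_fin -lerBlDl sub0r cos_geN1.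
have mF : measurable_fun setT F.
  by apply/measurable_EFinP; apply: measurable_funD => //; exact: measurable_cos_zdot.
pose mu := lebesgue_tuple (R := R) d.
have mC := @measurable_consT R d.
have mD : measurable (@consT R d @^-1` torus).
  by rewrite -[X in measurable X]setTI; apply: mC => //; exact: measurable_torus.
transitivity (\int[leb \x mu]_(z in @consT R d @^-1` torus) (F \o @consT R d) z)%E.
  apply: (@ge0_integral_pushforward _ _ _ _ R (@consT R d) mC (leb \x mu)%E torus F).
  - exact: measurable_torus.
  - exact: measurable_funS mF.
  - by move=> t _; exact: F0.
rewrite integral_mkcond.
pose g := (F \o @consT R d) \_ (@consT R d @^-1` torus).
rewrite (@fubini_tonelli2 _ _ _ _ _ leb mu g); first last.
- by move=> x; rewrite /g patchE; case: ifP => _ //; exact: F0.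
- have mFC : measurable_fun setT (F \o @consT R d) by exact: measurableT_comp.
  by have := (measurable_restrictT (F \o @consT R d) mD).1 (measurable_funTS mFC).
pose k' := (\row_j k 0 (lift 0 j)) : 'rV[int]_d.
have inner t : fubini_G leb g t =
   ((fun t => (2 * pi)%:E * (1 + (k 0 0 == 0)%:R * cos (zdot k' t + c))%:E)%E \_ torus) t.
  rewrite patchE /fubini_G; have [/[!inE] tt|/negP tt] := boolP (t \in torus).
    rewrite -EFinM -integral_circle_cos [RHS]integral_mkcond; apply: eq_integral => x _.
    rewrite /g !patchE; congr (if _ then _ else _).
      apply/idP/idP; rewrite !inE /= in_itv /=.
        by move/torus_consT => [].
      by move=> hx; apply/torus_consT.
    by rewrite /= /F zdot_consT addrA.
  rewrite (_ : (fun x => g (x, t)) = cst 0%E) ?integral0//.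
  apply/funext => x; rewrite /g patchE ifF//; apply/negP; rewrite inE => /torus_consT[_].
  by move=> h; apply: tt; rewrite inE.
under eq_integral do rewrite inner.
rewrite -integral_mkcond ge0_integralZl//; last 4 first.
- exact: measurable_torus.
- apply/measurable_EFinP; apply: measurable_funTS.
  by apply: measurable_funD => //; apply: measurable_funM => //; exact: measurable_cos_zdot.
- move=> t _; rewrite lee_fin; have := @cos_geN1 R (zdot k' t + c).
  by case: (_ == 0) => /=; lra.
- by rewrite lee_fin mulr_ge0// pi_ge0.
rewrite row_eq0_recl -/k'; have [k0|k0] := eqVneq (k 0 0) 0.
  under eq_integral do rewrite mul1r.
  by rewrite IH -EFinM exprS mulrA.
(* If the first coordinate of [k] is nonzero, the inner integral no longer depends on [t]. The
   measure of the smaller torus is then read off from the induction hypothesis with a phase where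
   the cosine vanishes. *)
have := IH 0 (pi / 2); rewrite cos_pihalf mulr0 addr0 mulr1 => IH0.
under eq_integral => t _.
  rewrite mul0r addr0 (_ : 1 = 1 + cos (zdot (0 : 'rV[int]_d) t + pi / 2)); last first.
    rewrite /zdot big1; first by rewrite add0r cos_pihalf addr0.
    by move=> j _; rewrite mxE mul0r.
  over.
by rewrite IH0 -EFinM exprS mul0r addr0 mulr1.
Qed.

End TorusIntegral.

(** * From orthogonality on boxes to an inequality for summable functions *)

Section Parseval.
Context {R : realType} {d : nat}.
Local Notation Rm := (measurableTypeR R).
Local Notation Zd := 'rV[int]_d.
Local Notation freq := (d.-tuple Rm).
Local Notation mu := (lebesgue_tuple (R := R) d).
Implicit Types (x y g h : Zd -> R) (t : freq).

Lemma torus_measure : mu torus = ((2 * pi) ^+ d)%:E.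
Proof.
have := @integral_torus_cos R d 0 (pi / 2).
rewrite cos_pihalf mulr0 addr0 mulr1 => <-.
under eq_integral => t _.
  rewrite /zdot big1; last by move=> j _; rewrite mxE mul0r.
  rewrite add0r cos_pihalf addr0.
  over.
by rewrite integral_cst ?mul1e//; exact: measurable_torus.
Qed.

Lemma integral_torus_cst (r : R) :
  (\int[mu]_(t in torus) (cst r%:E t) = (r * (2 * pi) ^+ d)%:E)%E.
Proof.
rewrite integral_cst; last exact: measurable_torus.
by rewrite EFinM; congr (_ * _)%E; exact: torus_measure.
Qed.

Lemma torus_integrable (f : freq -> R) (B : R) : measurable_fun setT f ->
  (forall t, `|f t| <= B) -> mu.-integrable torus (EFin \o f).
Proof.
move=> mf fB; apply: measurable_bounded_integrable.
- exact: measurable_torus.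
- by apply: (@le_lt_trans _ _ (mu torus)) => //; rewrite torus_measure ltry.
- exact: measurable_funTS.
- exists B; split; first exact: num_real.
  by move=> M BM t _; exact: le_trans (fB t) (ltW BM).
Qed.

Lemma norm_cos (u : R) : `|cos u| <= 1.
Proof. by rewrite ler_norml cos_geN1 cos_le1. Qed.

Lemma norm_sin (u : R) : `|sin u| <= 1.
Proof. by rewrite ler_norml sin_geN1 sin_le1. Qed.

Lemma integral_torus_cos0 (k : Zd) (c : R) :
  (\int[mu]_(t in torus) (cos (zdot k t + c))%:E =
   ((2 * pi) ^+ d * ((k == 0)%:R * cos c))%:E)%E.
Proof.
have i1 : mu.-integrable torus (EFin \o (cst 1 : freq -> R)).
  by apply: (@torus_integrable _ 1) => // t; rewrite normr1.
have i2 : mu.-integrable torus (EFin \o (fun t : freq => cos (zdot k t + c))).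
  apply: (@torus_integrable _ 1); first exact: measurable_cos_zdot.
  by move=> t; exact: norm_cos.
have := @integral_torus_cos R d k c.
under eq_integral do rewrite EFinD.
rewrite integralD //; [|exact: measurable_torus..].
rewrite integral_torus_cst.
case: (\int[_]_(_ in _) _)%E => [r [E]|//|//]; congr (_%:E).
by apply: (addrI (1 * (2 * pi) ^+ d)); rewrite E; ring.
Qed.

(* The real and imaginary parts of [exp(- i k.t) (x k + i y k)]. *)
Definition Ckern x y t (k : Zd) := cos (zdot k t) * x k + sin (zdot k t) * y k.

Definition Skern x y t (k : Zd) := cos (zdot k t) * y k - sin (zdot k t) * x k.

Lemma zdotB (k l : Zd) t : zdot (k - l) t = zdot k t - zdot l t :> R.
Proof.
rewrite /zdot -sumrB; apply: eq_bigr => j _.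
by rewrite !mxE intrD intrN mulrBl.
Qed.

(** The real part of one Fourier term times the conjugate of another. The sine of the phase
    difference is written as a shifted cosine, so one integral formula covers both terms. *)
Lemma kern_product x y t k l : Ckern x y t k * Ckern x y t l + Skern x y t k * Skern x y t l =
  (x k * x l + y k * y l) * cos (zdot (k - l) t + 0) +
  (y k * x l - x k * y l) * cos (zdot (k - l) t + - (pi / 2)).
Proof.
rewrite addr0 zdotB cosB (cosB _ (pi / 2)) cos_pihalf sin_pihalf mulr0 add0r mulr1 sinB.
by rewrite /Ckern /Skern; ring.
Qed.

(** After [kern_product] the double sum integrates to its diagonal; the terms with phase
    [- (pi / 2)] integrate to 0 for all [k] and [l]. *)
Lemma parseval_box x y n :
  (\int[mu]_(t in torus) (rpart (Ckern x y t) n ^+ 2 + rpart (Skern x y t) n ^+ 2)%:E =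
   ((2 * pi) ^+ d * rpart (fun k => x k ^+ 2 + y k ^+ 2) n)%:E)%E.
Proof.
pose F k l t := (x k * x l + y k * y l) * cos (zdot (k - l) t + 0) +
  (y k * x l - x k * y l) * cos (zdot (k - l) t + - (pi / 2)).
have E t : rpart (Ckern x y t) n ^+ 2 + rpart (Skern x y t) n ^+ 2 =
    \sum_(k <- zbox n) \sum_(l <- zbox n) F k l t.
  rewrite /rpart !expr2 !big_distrl /= -big_split /=; apply: eq_bigr => k _.
  rewrite !big_distrr /= -big_split /=; apply: eq_bigr => l _.
  exact: kern_product.
have ci k c b : mu.-integrable torus (EFin \o (fun t : freq => b * cos (zdot k t + c))).
  apply: (@torus_integrable _ `|b|).
    by apply: measurable_funM => //; exact: measurable_cos_zdot.
  by move=> t; rewrite normrM ler_piMr// norm_cos.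
have Fi k l : mu.-integrable torus (fun t => (F k l t)%:E).
  apply: (eq_integrable _ (fun t => ((x k * x l + y k * y l) * cos (zdot (k - l) t + 0))%:E
     + ((y k * x l - x k * y l) * cos (zdot (k - l) t + - (pi / 2)))%:E)%E) => //.
  - exact: measurable_torus.
  - by apply: integrableD; [exact: measurable_torus|exact: ci|exact: ci].
have FE k l : (\int[mu]_(t in torus) (F k l t)%:E =
    ((2 * pi) ^+ d * ((k == l)%:R * (x k ^+ 2 + y k ^+ 2)))%:E)%E.
  under eq_integral do rewrite EFinD.
  rewrite integralD //; [|exact: measurable_torus|exact: ci|exact: ci].
  under eq_integral do rewrite EFinM.
  rewrite integralZl; [|exact: measurable_torus|]; last first.
    by apply: (@torus_integrable _ 1); [exact: measurable_cos_zdot|move=> t; exact: norm_cos].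
  rewrite integral_torus_cos0.
  under eq_integral do rewrite EFinM.
  rewrite integralZl; [|exact: measurable_torus|]; last first.
    by apply: (@torus_integrable _ 1); [exact: measurable_cos_zdot|move=> t; exact: norm_cos].
  rewrite integral_torus_cos0 cosN cos_pihalf cos0 subr_eq0 -!EFinM -EFinD.
  by congr (_%:E); have [->|_] := eqVneq k l; rewrite /= ?mulr1n ?mulr0n; ring.
under eq_integral => t _ do rewrite E -sumEFin.
rewrite integral_sum; [|exact: measurable_torus|]; last first.
  move=> k; under eq_fun do rewrite -sumEFin.
  by apply: integrable_sum => //; exact: measurable_torus.
under eq_bigr => k _.
  under eq_integral do rewrite -sumEFin.
  rewrite integral_sum; [|exact: measurable_torus|by move=> l; exact: Fi].
  under eq_bigr do rewrite FE.
  rewrite sumEFin -mulr_sumr -mulr_suml.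
  over.
rewrite sumEFin; congr (_%:E); rewrite /rpart mulr_sumr.
rewrite big_seq [RHS]big_seq; apply: eq_bigr => k kn.
congr (_ * _); rewrite -[RHS]mul1r; congr (_ * _).
rewrite (bigD1_seq k) ?zbox_uniq//= eqxx big1 ?addr0// => l /negPf.
by rewrite eq_sym => ->.
Qed.

Lemma measurable_rsum (K : freq -> Zd -> R) :
  (forall k, measurable_fun setT (fun t => K t k)) -> (forall t, asum (K t)) ->
  measurable_fun setT (fun t => rsum (K t)).
Proof.
move=> mK aK; apply: (@measurable_fun_cvg _ _ _ _ (fun n t => rpart (K t) n)).
- by move=> n; apply: measurable_sum => k.
- by move=> t _; exact: cvg_rpart.
Qed.

Lemma measurable_cosz (k : Zd) : measurable_fun setT (fun t : freq => cos (zdot k t)).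
Proof.
have := @measurable_cos_zdot R d k 0; congr measurable_fun.
by apply/funext => t; rewrite addr0.
Qed.

Lemma measurable_sinz (k : Zd) : measurable_fun setT (fun t : freq => sin (zdot k t)).
Proof.
have := @measurable_cos_zdot R d k (- (pi / 2)); congr measurable_fun.
by apply/funext => t; rewrite cosB cos_pihalf sin_pihalf mulr0 add0r mulr1.
Qed.

Lemma Ckern_le x y t k : `|Ckern x y t k| <= `|x k| + `|y k|.
Proof.
apply: (le_trans (ler_normD _ _)); rewrite !normrM.
by apply: lerD; rewrite ler_piMl// ?norm_cos ?norm_sin.
Qed.

Lemma Skern_le x y t k : `|Skern x y t k| <= `|x k| + `|y k|.
Proof.
rewrite addrC; apply: (le_trans (ler_normB _ _)); rewrite !normrM.
by apply: lerD; rewrite ler_piMl// ?norm_cos ?norm_sin.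
Qed.

Lemma asum_kern x y (K : Zd -> R) : asum x -> asum y ->
  (forall k, `|K k| <= `|x k| + `|y k|) -> asum K.
Proof.
move=> ax ay H; apply: (@asum_dom _ _ _ (fun k => `|x k| + `|y k|) 1).
  by move=> k; rewrite mul1r.
by apply: asumD; exact: asum_norm.
Qed.

Lemma measurable_Csum x y : asum x -> asum y ->
  measurable_fun setT (fun t : freq => rsum (Ckern x y t)).
Proof.
move=> ax ay; apply: measurable_rsum; last first.
  by move=> t; apply: asum_kern ax ay _ => k; exact: Ckern_le.
move=> k; apply: measurable_funD; apply: measurable_funM => //.
  exact: measurable_cosz.
exact: measurable_sinz.
Qed.

Lemma measurable_Ssum x y : asum x -> asum y ->
  measurable_fun setT (fun t : freq => rsum (Skern x y t)).
Proof.
move=> ax ay; apply: measurable_rsum; last first.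
  by move=> t; apply: asum_kern ax ay _ => k; exact: Skern_le.
move=> k; apply: measurable_funB; apply: measurable_funM => //.
  exact: measurable_cosz.
exact: measurable_sinz.
Qed.

(** Both [h - g] and [h + g] are nonnegative, so their partial sums stay below their sums. *)
Lemma rsum_tail g h n : asum h -> (forall k, `|g k| <= h k) ->
  `|rsum g - rpart g n| <= rsum h - rpart h n.
Proof.
move=> ah gh; have ag : asum g by apply: (@asum_dom _ _ _ h 1) => // k; rewrite mul1r.
have h1 : rpart (fun k => h k - g k) n <= rsum (fun k => h k - g k).
  apply: rpart_le_rsum; last first.
    by apply: asumD => //; rewrite (_ : (fun k => - g k) = fun k => -1 * g k); [exact: asumZ|apply/funext => k; rewrite mulN1r].
  by move=> k; rewrite subr_ge0 (le_trans _ (gh k))// ler_norm.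
have h2 : rpart (fun k => h k + g k) n <= rsum (fun k => h k + g k).
  apply: rpart_le_rsum; last exact: asumD.
  by move=> k; rewrite -lerBlDr sub0r (le_trans _ (gh k))// -normrN ler_norm.
rewrite rpartB rsumB// in h1; rewrite rpartD rsumD// in h2.
by rewrite ler_norml; apply/andP; split; lra.
Qed.

(** For summable [x] and [y] the partial Fourier sums converge uniformly on the torus, so the
    identity on a large box passes to the limit up to [e]. *)
Lemma parseval_le x y n : asum x -> asum y ->
  (((2 * pi) ^+ d * rpart (fun k => x k ^+ 2 + y k ^+ 2) n)%:E <=
  \int[mu]_(t in torus) (rsum (Ckern x y t) ^+ 2 + rsum (Skern x y t) ^+ 2)%:E)%E.
Proof.
move=> ax ay; apply/lee_addgt0Pr => e e0.
pose h k := `|x k| + `|y k|.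
have ah : asum h by apply: asumD; exact: asum_norm.
have h0 k : 0 <= h k by rewrite addr_ge0.
pose B := rsum h.
have B0 : 0 <= B.
  apply: le_trans (rpart_le_rsum 0 h0 ah); exact: sumr_ge0.
pose V : R := (2 * pi) ^+ d.
have V0 : 0 < V by rewrite exprn_gt0// mulr_gt0// pi_gt0.
(* Replacing partial sums by sums costs [2 * B * q] in each of the two squares; [4 * B * q] times
   the torus measure [V] must stay below [e]. *)
pose q := e / (V * (4 * B + 1)).
have q0 : 0 < q by rewrite divr_gt0// mulr_gt0// ltr_wpDl// mulr_ge0.
have [p [np pq]] : exists p, (n <= p)%N /\ rsum h - rpart h p <= q.
  have /cvgrPdist_le/(_ q q0) := cvg_rpart ah; case=> N _ HN.
  exists (maxn n N); split; first exact: leq_maxl.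
  by apply: le_trans (HN _ (leq_maxr n N)); exact: ler_norm.
apply: (@le_trans _ _ (V * rpart (fun k => x k ^+ 2 + y k ^+ 2) p)%:E).
  rewrite lee_fin ler_wpM2l ?(ltW V0)//; apply: rpart_homo => // k.
  by rewrite addr_ge0 ?sqr_ge0.
rewrite -parseval_box.
have sq (K : freq -> Zd -> R) t : (forall k, `|K t k| <= h k) ->
    rpart (K t) p ^+ 2 <= rsum (K t) ^+ 2 + 2 * B * q.
  move=> Kh; have T := rsum_tail p ah Kh.
  have b1 : `|rsum (K t)| <= B.
    by have := @rsum_norm_le _ _ (K t) h 1 ah; rewrite mul1r; apply => k; rewrite mul1r.
  have b2 : `|rpart (K t) p| <= B.
    apply: (le_trans (rpart_norm _ _)); apply: le_trans (rpart_le_rsum p h0 ah).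
    exact: rpart_le.
  rewrite -lerBlDl.
  have -> : rpart (K t) p ^+ 2 - rsum (K t) ^+ 2 =
    - (rsum (K t) - rpart (K t) p) * (rpart (K t) p + rsum (K t)) by ring.
  apply: (le_trans (ler_norm _)); rewrite normrM normrN mulrC.
  apply: ler_pM => //; last exact: le_trans T pq.
  by apply: (le_trans (ler_normD _ _)); rewrite mulr_natl mulr2n lerD.
pose I t := rsum (Ckern x y t) ^+ 2 + rsum (Skern x y t) ^+ 2.
have mI : measurable_fun setT I.
  by apply: measurable_funD; apply: measurable_funX; [exact: measurable_Csum|exact: measurable_Ssum].
apply: (@le_trans _ _ (\int[mu]_(t in torus) ((I t)%:E + (4 * B * q)%:E))%E).
  apply: ge0_le_integral.
  - exact: measurable_torus.
  - by move=> t _; rewrite lee_fin addr_ge0 ?sqr_ge0.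
  - apply/measurable_EFinP; apply: measurable_funTS.
    apply: measurable_funD; apply: measurable_funX; apply: measurable_sum => k.
      by apply: measurable_funD; apply: measurable_funM => //;
        [exact: measurable_cosz|exact: measurable_sinz].
    by apply: measurable_funB; apply: measurable_funM => //;
        [exact: measurable_cosz|exact: measurable_sinz].
  - apply/measurable_EFinP; apply: measurable_funTS.
    exact: measurable_funD.
  - move=> t _; rewrite lee_fin.
    have := sq (Ckern x y) t (Ckern_le x y t); have := sq (Skern x y) t (Skern_le x y t).
    rewrite /I; lra.
have q4 : 0 <= 4 * B * q by rewrite mulr_ge0 ?(ltW q0)// mulr_ge0.
rewrite ge0_integralD; [|exact: measurable_torus
  |by move=> t _; rewrite lee_fin addr_ge0 ?sqr_ge0
  |by apply/measurable_EFinP; apply: measurable_funTS|by []|exact: measurable_cst].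
rewrite leeD2l// integral_torus_cst lee_fin -/V.
have qE : q * (V * (4 * B + 1)) = e.
  by rewrite /q divfK// gt_eqF// mulr_gt0// ltr_wpDl// mulr_ge0.
have := mulr_gt0 q0 V0; rewrite -[X in _ <= X]qE; lra.
Qed.

End Parseval.

(** * Finite propagation of spatial decay *)

Section Propagation.
Context {R : realType}.

Lemma hder_lipschitz (f df : R -> R) T C s t :
  (forall u, 0 <= u <= T -> hder f u (df u)) ->
  (forall u, 0 <= u <= T -> `|df u| <= C) ->
  0 <= s <= T -> 0 <= t <= T -> `|f s - f t| <= C * `|s - t|.
Proof.
move=> H HC; wlog ts : s t / t <= s.
  move=> W sT tT; have [ts|st] := leP t s; first exact: W.
  by rewrite distrC [`|s - t|]distrC; apply: W => //; exact: ltW.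
move=> /andP[s0 sT] /andP[t0 tT]; rewrite [`|s - t|]ger0_norm ?subr_ge0//.
apply: (@hder_lip _ f df) => //.
- by move=> u /andP[tu us]; apply: H; rewrite (le_trans t0 tu) (le_trans us sT).
- by move=> u /andP[tu us]; apply: HC; rewrite (le_trans t0 tu) (le_trans us sT).
Qed.

(** The mean value estimate applied to [f u - df t * u]. A quadratic remainder with explicit
    constant can be made proportional to [weight k], which termwise differentiation requires. *)
Lemma hder_quad (f df : R -> R) T L s t : 0 <= L ->
  (forall u, 0 <= u <= T -> hder f u (df u)) ->
  (forall u, 0 <= u <= T -> `|df u - df t| <= L * `|u - t|) ->
  0 <= s <= T -> 0 <= t <= T -> `|f s - f t - df t * (s - t)| <= L * `|s - t| ^+ 2.
Proof.
move=> L0 H HL /andP[s0 sT] /andP[t0 tT].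
pose g u := f u - df t * u.
have Hg u : 0 <= u <= T -> hder g u (df u - df t).
  move=> uT; have hid : hder (fun v : R => v) u 1.
    apply/hderP => e e0; exists 1 => // v _ _.
    by rewrite mul1r subrr normr0 mulr_ge0 ?(ltW e0).
  by have := hderB (H u uT) (@hderZ _ _ _ _ (df t) hid); rewrite mulr1.
have -> : f s - f t - df t * (s - t) = g s - g t by rewrite /g; ring.
rewrite expr2 mulrA.
have D u : 0 <= u <= T -> `|u - t| <= `|s - t| -> `|df u - df t| <= L * `|s - t|.
  by move=> uT us; apply: (le_trans (HL u uT)); rewrite ler_wpM2l.
have [ts|/ltW st] := leP t s.
  have E : `|s - t| = s - t by rewrite ger0_norm ?subr_ge0.
  rewrite [X in _ <= _ * X]E.
  apply: (@hder_lip _ g (fun u => df u - df t)) => // u /andP[tu us].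
    by apply: Hg; rewrite (le_trans t0 tu) (le_trans us sT).
  apply: D; first by rewrite (le_trans t0 tu) (le_trans us sT).
  by rewrite E ger0_norm ?subr_ge0// lerB.
have E : `|s - t| = t - s by rewrite distrC ger0_norm ?subr_ge0.
rewrite distrC [X in _ <= _ * X]E.
apply: (@hder_lip _ g (fun u => df u - df t)) => // u /andP[su ut].
  by apply: Hg; rewrite (le_trans s0 su) (le_trans ut tT).
apply: D; first by rewrite (le_trans s0 su) (le_trans ut tT).
by rewrite E distrC ger0_norm ?subr_ge0// lerB.
Qed.

Variable d : nat.
Local Notation Zd := 'rV[int]_d.

Definition lapl (f : Zd -> R) (k : Zd) : R :=
  \sum_(j < d) (f (k + delta_mx 0 j) - 2 * f k + f (k - delta_mx 0 j)).

Definition real_wave (a : R -> R) (x y : R -> Zd -> R) := forall t k, 0 <= t ->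
  hder (x ^~ k) t (y t k) /\ hder (y ^~ k) t (a t ^+ 2 * lapl (x t) k).

Definition localized (x y : R -> Zd -> R) := forall T, 0 <= T ->
  exists2 B, 0 <= B & forall t k, 0 <= t <= T ->
  `|x t k| <= B * weight k /\ `|y t k| <= B * weight k.

(** The growth restriction between neighbours makes [lapl] bounded in the supremum norm weighted by
    [w]. *)
Definition slow_weight (kap : R) (w : Zd -> R) :=
  (forall k, 0 < w k) /\ forall k (j : 'I_d),
  w (k + delta_mx 0 j) <= kap * w k /\ w (k - delta_mx 0 j) <= kap * w k.

Lemma lapl_le kap w (f : Zd -> R) S k : slow_weight kap w -> 0 <= S ->
  (forall k, `|f k| <= S * w k) ->
  `|lapl f k| <= d%:R * (2 * kap + 2) * S * w k.
Proof.
move=> [w0 wk] S0 fS; apply: (le_trans (ler_norm_sum _ _ _)).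
apply: (@le_trans _ _ (\sum_(j < d) ((2 * kap + 2) * S * w k))); last first.
  by rewrite sumr_const card_ord -[_ *+ d]mulr_natl !mulrA.
apply: ler_sum => j _; have [w1 w2] := wk k j.
apply: (le_trans (ler_normD _ _)).
have h1 := le_trans (fS (k + delta_mx 0 j)) (ler_wpM2l S0 w1).
have h2 := le_trans (fS (k - delta_mx 0 j)) (ler_wpM2l S0 w2).
have h3 := fS k.
have := ler_normB (f (k + delta_mx 0 j)) (2 * f k).
rewrite normrM [`|2|]ger0_norm// => h4.
have -> : (2 * kap + 2) * S * w k = S * (kap * w k) + 2 * (S * w k) + S * (kap * w k) by ring.
lra.
Qed.

Section Step.
Variables (a : R -> R) (a1 kap : R) (w : Zd -> R) (x y : R -> Zd -> R).
Hypotheses (a_bnd : forall t, 0 <= t -> `|a t| <= a1) (xy : real_wave a x y).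
Hypothesis wS : slow_weight kap w.
Hypothesis kap0 : 0 <= kap.

Let c := a1 ^+ 2 * (d%:R * (2 * kap + 2)).

Lemma wave_force_le S t k : 0 <= t -> 0 <= S -> (forall k, `|x t k| <= S * w k) ->
  `|a t ^+ 2 * lapl (x t) k| <= c * S * w k.
Proof.
move=> t0 S0 H; rewrite normrM.
have -> : c * S * w k = a1 ^+ 2 * (d%:R * (2 * kap + 2) * S * w k) by rewrite /c; ring.
apply: ler_pM => //.
  rewrite normrX; apply: lerXn2r; rewrite ?nnegrE ?a_bnd//.
  exact: le_trans (normr_ge0 _) (a_bnd t0).
exact: lapl_le.
Qed.

(* Duhamel turns the a priori bound [G] into [4 B + G / 2]; iterating removes [G]. *)
Lemma wave_step t0 h B G : 0 <= t0 -> 0 <= h -> h <= 1 -> h * c <= 1 / 2 -> 0 <= B -> 0 <= G ->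
  (forall k, `|x t0 k| <= B * w k /\ `|y t0 k| <= B * w k) ->
  (forall t k, t0 <= t <= t0 + h -> `|x t k| <= G * w k) ->
  forall t k, t0 <= t <= t0 + h -> `|x t k| <= 4 * B * w k /\ `|y t k| <= 4 * B * w k.
Proof.
move=> t00 h0 h1 hc B0 G0 H0 HG; have [w0 _] := wS.
have c0 : 0 <= c.
  by rewrite /c mulr_ge0 ?sqr_ge0// mulr_ge0// addr_ge0// mulr_ge0.
have Y S : 0 <= S -> (forall t k, t0 <= t <= t0 + h -> `|x t k| <= S * w k) ->
    forall t k, t0 <= t <= t0 + h -> `|y t k| <= (B + S / 2) * w k.
  move=> S0 HS t k /andP[tt0 tth].
  have L : `|y t k - y t0 k| <= c * S * w k * (t - t0).
    apply: (@hder_lip _ (y ^~ k) (fun s => a s ^+ 2 * lapl (x s) k)) => // s /andP[s1 s2].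
      by have [] := xy k (le_trans t00 s1).
    apply: wave_force_le => //; first exact: le_trans s1.
    by move=> k'; apply: HS; rewrite s1 (le_trans s2).
  have [_ y0] := H0 k.
  have -> : y t k = y t0 k + (y t k - y t0 k) by rewrite addrC subrK.
  apply: (le_trans (ler_normD _ _)); rewrite mulrDl; apply: lerD => //.
  apply: (le_trans L).
  have th : t - t0 <= h by rewrite lerBlDl.
  have Sw : 0 <= S * w k by rewrite mulr_ge0 ?(ltW (w0 k)).
  apply: (@le_trans _ _ (c * S * w k * h)).
    by rewrite ler_wpM2l// -mulrA mulr_ge0.
  rewrite (_ : _ * h = h * c * (S * w k)); last by ring.
  apply: (le_trans (ler_wpM2r Sw hc)).
  by rewrite mul1r mulrA [_ * S]mulrC.
have X S : 0 <= S -> (forall t k, t0 <= t <= t0 + h -> `|x t k| <= S * w k) ->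
    forall t k, t0 <= t <= t0 + h -> `|x t k| <= (2 * B + S / 2) * w k.
  move=> S0 HS t k /andP[tt0 tth].
  have S20 : 0 <= B + S / 2 by rewrite addr_ge0// divr_ge0.
  have L : `|x t k - x t0 k| <= (B + S / 2) * w k * (t - t0).
    apply: (@hder_lip _ (x ^~ k) (y ^~ k)) => // s /andP[s1 s2].
      by have [] := xy k (le_trans t00 s1).
    by apply: (Y S) => //; rewrite s1 (le_trans s2).
  have [x0 _] := H0 k.
  have -> : x t k = x t0 k + (x t k - x t0 k) by rewrite addrC subrK.
  apply: (le_trans (ler_normD _ _)).
  rewrite (_ : (2 * B + S / 2) * w k = B * w k + (B + S / 2) * w k); last by ring.
  apply: lerD => //; apply: (le_trans L); rewrite -[leRHS]mulr1 ler_wpM2l//.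
    by rewrite mulr_ge0 ?(ltW (w0 k)).
  by rewrite (le_trans _ h1)// lerBlDl.
(* [4 * B] is the fixed point of [S |-> 2 * B + S / 2], and each pass halves the excess over it. *)
have I n : forall t k, t0 <= t <= t0 + h -> `|x t k| <= (4 * B + G / 2 ^+ n) * w k.
  elim: n => [|n IH] t k tt.
    apply: (le_trans (HG t k tt)); rewrite ler_wpM2r ?(ltW (w0 k))//.
    by rewrite expr0 divr1 lerDr mulr_ge0.
  have S0 : 0 <= 4 * B + G / 2 ^+ n by rewrite addr_ge0 ?mulr_ge0 ?invr_ge0 ?exprn_ge0.
  apply: (le_trans (X _ S0 IH t k tt)); rewrite ler_wpM2r ?(ltW (w0 k))//.
  apply: eq_ler; rewrite exprS; field.
  by rewrite expf_neq0.
have X4 t k : t0 <= t <= t0 + h -> `|x t k| <= 4 * B * w k.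
  move=> tt; apply/ler_addgt0Pr => e e0.
  have ew : 0 < e / w k by rewrite divr_gt0.
  have [n Hn] : exists n, G / 2 ^+ n <= e / w k.
    exists (Num.truncn (G / (e / w k))).+1.
    rewrite ler_pdivrMr ?exprn_gt0// mulrC -ler_pdivrMr//.
    apply: (le_trans (ltW (truncnS_gt _))).
    by rewrite -natrX ler_nat ltnW// ltn_expl.
  apply: (le_trans (I n t k tt)); rewrite mulrDl lerD2l -ler_pdivlMr//.
move=> t k tt; split; first exact: X4.
have B40 : 0 <= 4 * B by rewrite mulr_ge0.
apply: (le_trans (Y _ B40 X4 t k tt)); rewrite ler_wpM2r ?(ltW (w0 k))//.
lra.
Qed.

(** The a priori bound [G] is absent from the conclusion of [wave_step], so the same one serves on
    every interval and only the factor 4 accumulates. *)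
Lemma wave_growth h B G n : 0 <= h -> h <= 1 -> h * c <= 1 / 2 -> 0 <= B -> 0 <= G ->
  (forall k, `|x 0 k| <= B * w k /\ `|y 0 k| <= B * w k) ->
  (forall t k, 0 <= t <= n%:R * h -> `|x t k| <= G * w k) ->
  forall t k, 0 <= t <= n%:R * h ->
    `|x t k| <= 4 ^+ n * B * w k /\ `|y t k| <= 4 ^+ n * B * w k.
Proof.
move=> h0 h1 hc B0 G0 H0; elim: n => [|n IH] HG t k.
  rewrite mul0r => tt; have -> : t = 0 by apply/eqP; rewrite eq_le andbC.
  by rewrite expr0 mul1r.
have nh : n%:R * h <= n.+1%:R * h by rewrite ler_wpM2r// ler_nat.
have {}IH := IH (fun s k' H => HG s k' (andb_true_intro (conj (proj1 (andP H)) (le_trans (proj2 (andP H)) nh)))).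
have w0 := wS.1 k.
move=> /andP[tt0 tn].
have [tnh|nht] := leP t (n%:R * h).
  have [|h3 h4] := IH t k; first by rewrite tt0.
  have e : 4 ^+ n * B * w k <= 4 ^+ n.+1 * B * w k.
    rewrite ler_wpM2r ?(ltW w0)// ler_wpM2r// exprS ler_peMl ?exprn_ge0// ler1n//.
  by split; [exact: le_trans h3 e|exact: le_trans h4 e].
have nh0 : 0 <= n%:R * h by rewrite mulr_ge0.
have E : n.+1%:R * h = n%:R * h + h by rewrite -natr1 mulrDl mul1r.
rewrite exprS -!mulrA (mulrA (4 ^+ n)) (mulrA 4).
apply: (@wave_step (n%:R * h) h (4 ^+ n * B) G) => //.
- by rewrite mulr_ge0// exprn_ge0.
- by move=> k'; apply: IH; rewrite nh0 lexx.
- move=> s k' /andP[s1 s2]; apply: HG; rewrite (le_trans nh0 s1) /=.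
  by rewrite E.
- by rewrite (ltW nht) -E.
Qed.

End Step.

(** A step to a neighbour changes [zsup] by at most 1, hence [(zsup k).+1] by a factor of at most 2.
    The maximum with a positive constant has the same property and is bounded below. *)
Lemma slow_weight_max (r : R) : 0 < r ->
  slow_weight (2 ^+ d.+1) (fun k => Num.max (weight k) r).
Proof.
move=> r0; split=> [k|k j]; first by rewrite lt_max r0 orbT.
have key (k' : Zd) : (zsup k <= (zsup k').+1)%N ->
    Num.max (weight k') r <= 2 ^+ d.+1 * Num.max (weight k) r.
  move=> kk'.
  have p1 : 1 <= (2 : R) ^+ d.+1 by rewrite exprn_ege1// ler1n.
  rewrite ge_max; apply/andP; split.
    apply: (@le_trans _ _ (2 ^+ d.+1 * weight k)); last first.
      by rewrite ler_wpM2l ?exprn_ge0// le_max lexx.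
    rewrite /weight ler_pdivlMr ?exprn_gt0// mulrC ler_pdivrMr ?exprn_gt0// -exprMn.
    apply: lerXn2r; rewrite ?nnegrE// -natrM ler_nat mul2n -addnn addSn ltnS.
    by rewrite (leq_trans kk')// addnS ltnS leq_addr.
  apply: (@le_trans _ _ (2 ^+ d.+1 * r)); first by rewrite ler_peMl// ltW.
  by rewrite ler_wpM2l ?exprn_ge0// le_max lexx orbT.
split; apply: key.
- rewrite -[k in leqLHS](addrK (delta_mx 0%R j)) (leq_trans (zsupD _ _))//.
  by rewrite zsupN -[(zsup _).+1]addn1 leq_add2l zsup_delta.
- rewrite -[k in leqLHS](subrK (delta_mx 0%R j)) (leq_trans (zsupD _ _))//.
  by rewrite -[(zsup _).+1]addn1 leq_add2l zsup_delta.
Qed.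

(* A solution is a priori only bounded, so the growth bound is applied with the
   weight [max(weight, weight k)], which is bounded below, and read off at [k]. *)
Lemma wave_localized (a : R -> R) a1 x y B :
  (forall t, 0 <= t -> `|a t| <= a1) -> real_wave a x y -> 0 <= B ->
  (forall k, `|x 0 k| <= B * weight k /\ `|y 0 k| <= B * weight k) ->
  (forall T, 0 <= T -> exists2 G, 0 <= G & forall t k, 0 <= t <= T -> `|x t k| <= G) ->
  localized x y.
Proof.
move=> ab xy B0 H0 HG T T0.
pose c : R := a1 ^+ 2 * (d%:R * (2 * 2 ^+ d.+1 + 2)).
have c0 : 0 <= c.
  by rewrite /c mulr_ge0 ?sqr_ge0// mulr_ge0// addr_ge0// mulr_ge0 ?exprn_ge0.
(* The step length is dictated by [h <= 1] and [h * c <= 1 / 2]; it depends on [a1] and [d] only,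
   not on the lattice point. *)
pose h := (2 * (1 + c))^-1.
have c1 : 0 < 1 + c by rewrite ltr_pwDl.
have h0 : 0 < h by rewrite invr_gt0 mulr_gt0.
have h1 : h <= 1.
  rewrite invf_le1 ?mulr_gt0//; lra.
have hc : h * c <= 1 / 2.
  by rewrite /h mulrC ler_pdivrMr ?mulr_gt0//; lra.
pose n := (Num.truncn (T / h)).+1.
have Tn : T <= n%:R * h by rewrite -ler_pdivrMr// ltW// truncnS_gt.
have nh0 : 0 <= n%:R * h by apply: mulr_ge0 => //; exact: ltW.
have [G G0 HGn] := HG _ nh0.
exists (4 ^+ n * B); first by rewrite mulr_ge0 ?exprn_ge0.
move=> t k /andP[t0 tT].
pose r : R := weight k.
have r0 : 0 < r := weight_gt0 k.
pose w (k : Zd) := Num.max (weight k) r.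
have ww k' : weight k' <= w k' by rewrite le_max lexx.
have wr k' : r <= w k' by rewrite le_max lexx orbT.
have -> : weight k = w k by rewrite /w /r maxxx.
apply: (@wave_growth a a1 (2 ^+ d.+1) w x y ab xy (slow_weight_max r0) _ h B (G / r) n) => //.
- exact: ltW.
- by rewrite divr_ge0// ltW.
- by move=> k'; have [b1 b2] := H0 k'; split; [apply: le_trans b1 _|apply: le_trans b2 _]; rewrite ler_wpM2l.
- move=> s k' hs; apply: (le_trans (HGn s k' hs)).
  by rewrite -mulrA ler_peMr// ler_pdivlMl// mulr1.
- by rewrite t0 (le_trans tT).
Qed.

End Propagation.

(** * The Fourier transform of a solution *)

Section FourierWave.
Context {R : realType} {d : nat}.
Local Notation Zd := 'rV[int]_d.
Local Notation weight := (@weight R d).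

Lemma rsum_sum (I : Type) (s : seq I) (G : I -> Zd -> R) : (forall i, asum (G i)) ->
  rsum (fun k => \sum_(i <- s) G i k) = \sum_(i <- s) rsum (G i) /\
  asum (fun k => \sum_(i <- s) G i k).
Proof.
move=> aG; elim: s => [|i s [IH1 IH2]].
  rewrite big_nil; split.
    apply: rsum_unique; rewrite (_ : rpart _ = fun=> 0); first exact: cvg_cst.
    by apply/funext => n; rewrite /rpart big1// => k _; rewrite big_nil.
  by exists 0 => n; rewrite /rpart big1// => k _; rewrite big_nil normr0.
rewrite big_cons -IH1 -rsumD//; split.
  by congr rsum; apply/funext => k; rewrite big_cons.
rewrite (_ : (fun k => _) = fun k => G i k + \sum_(j <- s) G j k); first exact: asumD.
by apply/funext => k; rewrite big_cons.
Qed.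

Lemma asum_le_weight (g : Zd -> R) B : (forall k, `|g k| <= B * weight k) -> asum g.
Proof. by move=> gB; apply: asum_dom gB asum_weight. Qed.

(** Summing the remainders costs the finite factor [rsum weight], and the total remains quadratic in
    [s - t]. *)
Lemma hder_rsum (F : R -> Zd -> R) (F' : Zd -> R) t T C : 0 <= t < T -> 0 <= C ->
  (forall s k, 0 <= s <= T -> `|F s k - F t k - F' k * (s - t)| <= C * `|s - t| ^+ 2 * weight k) ->
  (forall s, 0 <= s <= T -> asum (F s)) -> asum F' ->
  hder (fun s => rsum (F s)) t (rsum F').
Proof.
move=> /andP[t0 tT] C0 H aF aF'; apply/hderP => e e0.
pose S := rsum weight.
have S0 : 0 <= S.
  apply: le_trans (rpart_le_rsum 0 (fun k => ltW (weight_gt0 k)) asum_weight).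
  by apply: sumr_ge0 => k _; exact/ltW/weight_gt0.
have CS : 0 < C * S + 1 by rewrite ltr_wpDl// mulr_ge0.
exists (Num.min (T - t) (e / (C * S + 1))).
  by rewrite lt_min subr_gt0 tT divr_gt0.
move=> s s0; rewrite lt_min => /andP[sT se].
have sT' : 0 <= s <= T.
  by rewrite s0 /=; move: sT; rewrite ltr_norml => /andP[_]; lra.
have tT' : 0 <= t <= T by rewrite t0 ltW.
have -> : rsum (F s) - rsum (F t) - rsum F' * (s - t) =
    rsum (fun k => F s k - F t k - F' k * (s - t)).
  have aB : asum (fun k => F s k - F t k).
    have := asumD (aF s sT') (asumZ (-1) (aF t tT')).
    by congr asum; apply/funext => k; rewrite mulN1r.
  rewrite -rsumB; [|exact: aF|exact: aF].
  rewrite mulrC -rsumZ// -rsumB//; last exact: asumZ.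
  by congr rsum; apply/funext => k; rewrite [F' k * _]mulrC.
have := @rsum_norm_le R d (fun k => F s k - F t k - F' k * (s - t)) weight
   (C * `|s - t| ^+ 2) asum_weight (H s ^~ sT').
move=> /le_trans; apply; rewrite -/S.
rewrite (_ : C * _ * S = C * S * `|s - t| * `|s - t|); last by ring.
rewrite ler_wpM2r//; apply: (@le_trans _ _ ((C * S + 1) * `|s - t|)).
  by rewrite ler_wpM2r// lerDl.
by rewrite mulrC -ler_pdivlMr// ltW.
Qed.

Section Osc.
Variables (a da : R -> R) (a1 La : R) (x y : R -> Zd -> R).
Hypotheses (a_bnd : forall t, 0 <= t -> `|a t| <= a1) (xy : real_wave a x y).
Hypotheses (a_der : forall t, 0 <= t -> hder a t (da t)).
Hypotheses (da_bnd : forall t, 0 <= t -> `|da t| <= La).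
Hypothesis loc : localized x y.

Lemma weight_slow : slow_weight (2 ^+ d.+1) weight.
Proof.
split=> [k|k j]; first exact: weight_gt0.
have [_ /(_ k j)] := @slow_weight_max R d (weight k) (weight_gt0 k).
by rewrite maxxx => -[h1 h2]; split; [apply: le_trans h1|apply: le_trans h2];
  rewrite le_max lexx.
Qed.

(** By [hder_quad] it suffices that [y] and [a ^ 2 * lapl x] are Lipschitz in time with constants
    proportional to [weight k]. For the latter this uses the Lipschitz bound of [a], that of [x],
    and the slow variation of [weight]. *)
Lemma wave_quad T : 0 <= T -> exists2 C, 0 <= C &
  forall s t k, 0 <= s <= T -> 0 <= t <= T ->
  `|x s k - x t k - y t k * (s - t)| <= C * `|s - t| ^+ 2 * weight k /\
  `|y s k - y t k - a t ^+ 2 * lapl (x t) k * (s - t)| <= C * `|s - t| ^+ 2 * weight k.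
Proof.
move=> T0; have [B B0 HB] := loc T0.
have a10 : 0 <= a1 by apply: le_trans (a_bnd (lexx 0)).
have La0 : 0 <= La by apply: le_trans (da_bnd (lexx 0)).
have [e e0 eE] : exists2 e : R, 0 <= e & e = d%:R * (2 * 2 ^+ d.+1 + 2).
  by eexists; last reflexivity; rewrite mulr_ge0// addr_ge0// mulr_ge0// exprn_ge0.
have [C1 C10 C1E] : exists2 C1, 0 <= C1 & C1 = a1 ^+ 2 * e * B.
  by eexists; last reflexivity; rewrite mulr_ge0// mulr_ge0// sqr_ge0.
have [C2 C20 C2E] : exists2 C2, 0 <= C2 & C2 = 2 * a1 * La * e * B + C1.
  by eexists; last reflexivity; rewrite addr_ge0// !mulr_ge0.
have w0 (k : Zd) : 0 < weight k by exact: weight_gt0.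
have T1 u : 0 <= u <= T -> 0 <= u by case/andP.
have lx u k : 0 <= u <= T -> `|lapl (x u) k| <= e * B * weight k.
  by move=> uT; rewrite eE; apply: lapl_le weight_slow B0 _ => k'; have [] := HB u k' uT.
have xl u v k : 0 <= u <= T -> 0 <= v <= T -> `|x u k - x v k| <= B * `|u - v| * weight k.
  move=> uT vT; rewrite mulrAC; apply: (@hder_lipschitz _ (x ^~ k) (y ^~ k) T) => // s sT.
    by have [] := xy k (T1 s sT).
  by have [] := HB s k sT.
have asq u : 0 <= u <= T -> `|a u ^+ 2| <= a1 ^+ 2.
  move=> /T1 u0; rewrite normrX; apply: lerXn2r; rewrite ?nnegrE//.
  exact: a_bnd.
have dy u k : 0 <= u <= T -> `|a u ^+ 2 * lapl (x u) k| <= C1 * weight k.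
  move=> uT; rewrite normrM C1E -!(mulrA (a1 ^+ 2)).
  apply: ler_pM; [exact: normr_ge0|exact: normr_ge0| |exact: lx].
  exact: asq.
have yl u v k : 0 <= u <= T -> 0 <= v <= T -> `|y u k - y v k| <= C1 * `|u - v| * weight k.
  move=> uT vT; rewrite mulrAC.
  apply: (@hder_lipschitz _ (y ^~ k) (fun s => a s ^+ 2 * lapl (x s) k) T) => // s sT.
    by have [] := xy k (T1 s sT).
  exact: dy.
have al u v : 0 <= u <= T -> 0 <= v <= T -> `|a u - a v| <= La * `|u - v|.
  move=> uT vT; apply: (@hder_lipschitz _ a da T) => // s sT.
    by apply: a_der; exact: T1.
  by apply: da_bnd; exact: T1.
have dyl u v k : 0 <= u <= T -> 0 <= v <= T ->
    `|a u ^+ 2 * lapl (x u) k - a v ^+ 2 * lapl (x v) k| <= C2 * weight k * `|u - v|.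
  move=> uT vT.
  have -> : a u ^+ 2 * lapl (x u) k - a v ^+ 2 * lapl (x v) k =
     (a u - a v) * (a u + a v) * lapl (x u) k + a v ^+ 2 * (lapl (x u) k - lapl (x v) k) by ring.
  have -> : C2 * weight k * `|u - v| = La * `|u - v| * (2 * a1) * (e * B * weight k) +
     a1 ^+ 2 * (e * (B * `|u - v|) * weight k) by rewrite C2E C1E; ring.
  apply: (le_trans (ler_normD _ _)); apply: lerD.
    rewrite !normrM; apply: ler_pM; [exact: mulr_ge0| by []| |exact: lx].
    apply: ler_pM => //; first exact: al.
    apply: (le_trans (ler_normD _ _)); rewrite mulr_natl mulr2n.
    by apply: lerD; apply: a_bnd; exact: T1.
  rewrite normrM; apply: ler_pM => //.
    exact: asq.
  have -> : lapl (x u) k - lapl (x v) k = lapl (fun k => x u k - x v k) k.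
    by rewrite /lapl -sumrB; apply: eq_bigr => j _; ring.
  rewrite eE; apply: lapl_le weight_slow _ _; first exact: mulr_ge0.
  by move=> k'; exact: xl.
exists (C1 + C2); first exact: addr_ge0.
move=> s t k sT tT.
have c1 : C1 * weight k * `|s - t| ^+ 2 <= (C1 + C2) * `|s - t| ^+ 2 * weight k.
  have := mulr_ge0 C20 (mulr_ge0 (sqr_ge0 `|s - t|) (ltW (w0 k))); lra.
have c2 : C2 * weight k * `|s - t| ^+ 2 <= (C1 + C2) * `|s - t| ^+ 2 * weight k.
  have := mulr_ge0 C10 (mulr_ge0 (sqr_ge0 `|s - t|) (ltW (w0 k))); lra.
split.
- apply: le_trans c1; apply: (@hder_quad _ (x ^~ k) (y ^~ k) T) => //.
  + by rewrite mulr_ge0// ltW.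
  + by move=> u uT; have [] := xy k (T1 u uT).
  + by move=> u uT; rewrite mulrAC; exact: yl.
- apply: le_trans c2.
  apply: (@hder_quad _ (y ^~ k) (fun s => a s ^+ 2 * lapl (x s) k) T) => //.
  + by rewrite mulr_ge0// ltW.
  + by move=> u uT; have [] := xy k (T1 u uT).
  + by move=> u uT; exact: dyl.
Qed.

Variables (al : Zd -> R) (lam : R).
Hypotheses (al1 : forall k, `|al k| <= 1).
Hypothesis al_eigen : forall k, lapl al k = - lam ^+ 2 * al k.

Let al_le (v B : R) k : `|v| <= B -> `|al k * v| <= B.
Proof. by move=> gB; rewrite normrM (le_trans _ gB)// ler_piMl. Qed.

Lemma asum_al g : asum g -> asum (fun k => al k * g k).
Proof.
move=> ag; apply: (@asum_dom _ _ _ (fun k => `|g k|) 1).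
  by move=> k; rewrite mul1r; exact: al_le.
exact: asum_norm.
Qed.

(** Summation by parts: translation invariance of the sum moves the shifts from [f] to the
    eigenfunction [al]. Since [al] is only bounded, [f] must be summable. *)
Lemma rsum_lapl (f : Zd -> R) : asum f ->
  rsum (fun k => al k * lapl f k) = - lam ^+ 2 * rsum (fun k => al k * f k).
Proof.
move=> af.
pose e j : Zd := delta_mx 0 j.
have s1 j : rsum (fun k => al k * f (k + e j)) = rsum (fun k => al (k - e j) * f k) /\
    asum (fun k => al (k - e j) * f k).
  have ag : asum (fun k => al (k - e j) * f k).
    apply: (@asum_dom _ _ _ (fun k => `|f k|) 1); last exact: asum_norm.
    by move=> k; rewrite mul1r normrM ler_piMl.
  split=> //; rewrite -(rsum_shift (e j) ag).
  by congr rsum; apply/funext => k; rewrite addrK.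
have s2 j : rsum (fun k => al k * f (k - e j)) = rsum (fun k => al (k + e j) * f k) /\
    asum (fun k => al (k + e j) * f k).
  have ag : asum (fun k => al (k + e j) * f k).
    apply: (@asum_dom _ _ _ (fun k => `|f k|) 1); last exact: asum_norm.
    by move=> k; rewrite mul1r normrM ler_piMl.
  split=> //; rewrite -(rsum_shift (- e j) ag).
  by congr rsum; apply/funext => k; rewrite subrK.
have a0 := asum_al af.
have a0' : asum (fun k => -2 * (al k * f k)) by exact: asumZ.
have a1' j := asum_al (asum_shift (e j) af).
have a2' j := asum_al (asum_shift (- e j) af).
rewrite -rsumZ//.
transitivity (rsum (fun k => \sum_(j < d) (al k * f (k + e j) + al k * f (k - e j) + -2 * (al k * f k)))).
  congr rsum; apply/funext => k; rewrite /lapl mulr_sumr; apply: eq_bigr => j _.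
  rewrite -/(e j); ring.
have [-> _] := @rsum_sum 'I_d (index_enum 'I_d) (fun j k => al k * f (k + e j) + al k * f (k - e j) + -2 * (al k * f k))
  (fun j => asumD (asumD (a1' j) (a2' j)) a0').
transitivity (\sum_(j < d) rsum (fun k => al (k - e j) * f k + al (k + e j) * f k + -2 * (al k * f k))).
  apply: eq_bigr => j _; have [h1 h1'] := s1 j; have [h2 h2'] := s2 j.
  rewrite rsumD//; last exact: asumD (a1' j) (a2' j).
  rewrite [in LHS]rsumD// h1 h2 -rsumD// -rsumD//.
  exact: asumD.
have [<- _] := @rsum_sum 'I_d (index_enum 'I_d) (fun j k => al (k - e j) * f k + al (k + e j) * f k + -2 * (al k * f k))
  (fun j => asumD (asumD (s1 j).2 (s2 j).2) a0').
congr rsum; apply/funext => k; rewrite mulrA -al_eigen /lapl mulr_suml.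
by apply: eq_bigr => j _; rewrite -/(e j); ring.
Qed.

(** Pairing the solution with a bounded eigenfunction of [lapl] turns the lattice equation into an
    ordinary one, at each single frequency. *)
Lemma wave_oscillator :
  oscillator a lam (fun t => rsum (fun k => al k * x t k)) (fun t => rsum (fun k => al k * y t k)).
Proof.
move=> t t0; have tT : 0 <= t < t + 1 by rewrite t0 ltrDl ltr01.
have T0 : 0 <= t + 1 by rewrite addr_ge0.
have tT' : 0 <= t <= t + 1 by rewrite t0 lerDl ler01.
have [C C0 HC] := wave_quad T0.
have [B B0 HB] := loc T0.
have ax s : 0 <= s <= t + 1 -> asum (x s).
  by move=> sT; apply: (@asum_le_weight _ B) => k; have [] := HB s k sT.
have ay s : 0 <= s <= t + 1 -> asum (y s).
  by move=> sT; apply: (@asum_le_weight _ B) => k; have [] := HB s k sT.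
have afl : asum (fun k => a t ^+ 2 * lapl (x t) k).
  apply: asumZ; apply: (@asum_le_weight _ (d%:R * (2 * 2 ^+ d.+1 + 2) * B)) => k.
  by apply: lapl_le weight_slow B0 _ => k'; have [] := HB t k' tT'.
split.
- apply: (@hder_rsum _ _ t (t + 1) C) => //.
  + move=> s k sT; have -> : al k * x s k - al k * x t k - al k * y t k * (s - t) =
      al k * (x s k - x t k - y t k * (s - t)) by ring.
    by apply: al_le; have [] := HC s t k sT tT'.
  + by move=> s sT; apply: asum_al; exact: ax.
  + by apply: asum_al; exact: ay.
- have -> : - (a t ^+ 2 * lam ^+ 2 * rsum (fun k => al k * x t k)) =
    rsum (fun k => al k * (a t ^+ 2 * lapl (x t) k)).
    transitivity (a t ^+ 2 * rsum (fun k => al k * lapl (x t) k)).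
      by rewrite rsum_lapl; [ring|exact: ax].
    have al2 : asum (fun k => lapl (x t) k).
      apply: (@asum_le_weight _ (d%:R * (2 * 2 ^+ d.+1 + 2) * B)) => k.
      by apply: lapl_le weight_slow B0 _ => k'; have [] := HB t k' tT'.
    rewrite -rsumZ; last exact: asum_al.
    by congr rsum; apply/funext => k; ring.
  apply: (@hder_rsum _ _ t (t + 1) C) => //.
  + move=> s k sT.
    have -> : al k * y s k - al k * y t k - al k * (a t ^+ 2 * lapl (x t) k) * (s - t) =
      al k * (y s k - y t k - a t ^+ 2 * lapl (x t) k * (s - t)) by ring.
    by apply: al_le; have [] := HC s t k sT tT'.
  + by move=> s sT; apply: asum_al; exact: ay.
  + exact: asum_al.
Qed.

End Osc.

Lemma zdotD_delta (k : Zd) (j : 'I_d) (t : d.-tuple (measurableTypeR R)) :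
  zdot (k + delta_mx 0 j) t = zdot k t + tnth t j :> R.
Proof.
rewrite /zdot; under eq_bigr do rewrite mxE intrD mulrDl.
rewrite big_split /=; congr (_ + _); rewrite (bigD1 j)//= big1 ?addr0.
  by rewrite mxE !eqxx mul1r.
by move=> i ij; rewrite mxE (negPf ij) andbF mul0r.
Qed.

Lemma zdotB_delta (k : Zd) (j : 'I_d) (t : d.-tuple (measurableTypeR R)) :
  zdot (k - delta_mx 0 j) t = zdot k t - tnth t j :> R.
Proof.
have := zdotD_delta (k - delta_mx 0 j) j t; rewrite subrK => ->.
by rewrite addrK.
Qed.

Lemma cos_half (u : R) : cos u = 1 - 2 * sin (u / 2) ^+ 2.
Proof.
rewrite {1}(splitr u) cosD -!expr2; have := cos2Dsin2 (u / 2); lra.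
Qed.

Lemma xinorm_sqr (t : d.-tuple (measurableTypeR R)) :
  xinorm t ^+ 2 = \sum_(j < d) (2 * sin (tnth t j / 2)) ^+ 2.
Proof. by rewrite sqr_sqrtr// sumr_ge0// => j _; exact: sqr_ge0. Qed.

Lemma lapl_cos (t : d.-tuple (measurableTypeR R)) (c : R) (k : Zd) :
  lapl (fun k => cos (zdot k t + c)) k = - xinorm t ^+ 2 * cos (zdot k t + c).
Proof.
rewrite xinorm_sqr mulNr mulr_suml -sumrN; apply: eq_bigr => j _.
rewrite zdotD_delta zdotB_delta.
have -> : zdot k t + tnth t j + c = (zdot k t + c) + tnth t j :> R by ring.
have -> : zdot k t - tnth t j + c = (zdot k t + c) - tnth t j :> R by ring.
by rewrite cosD cosB (cos_half (tnth t j)); ring.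
Qed.

End FourierWave.

(** * The lattice energy in terms of the Fourier transform *)

Section EnergyFourier.
Context {R : realType} {d : nat}.
Local Notation Zd := 'rV[int]_d.
Local Notation freq := (d.-tuple (measurableTypeR R)).
Local Notation mu := (lebesgue_tuple (R := R) d).
Implicit Types (f : Zd -> R[i]) (x y : Zd -> R) (t : freq).

Lemma normc_sqr (z : R[i]) : normc z ^+ 2 = Cre z ^+ 2 + Cim z ^+ 2.
Proof. by case: z => p q /=; rewrite sqr_sqrtr// addr_ge0 ?sqr_ge0. Qed.

Lemma normc_ge0 (z : R[i]) : 0 <= normc z.
Proof. by case: z => p q; exact: sqrtr_ge0. Qed.

Lemma normRe_le (z : R[i]) : `|Cre z| <= normc z.
Proof.
rewrite -(@ler_pXn2r _ 2) ?nnegrE ?normc_ge0// normc_sqr real_normK ?num_real//.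
by rewrite lerDl sqr_ge0.
Qed.

Lemma normIm_le (z : R[i]) : `|Cim z| <= normc z.
Proof.
rewrite -(@ler_pXn2r _ 2) ?nnegrE ?normc_ge0// normc_sqr real_normK ?num_real//.
by rewrite lerDr sqr_ge0.
Qed.

Lemma Re_sum I (s : seq I) (F : I -> R[i]) :
  Cre (\sum_(i <- s) F i) = \sum_(i <- s) Cre (F i).
Proof. by apply: (big_morph Cre) => // -[p q] [p' q']. Qed.

Lemma Im_sum I (s : seq I) (F : I -> R[i]) :
  Cim (\sum_(i <- s) F i) = \sum_(i <- s) Cim (F i).
Proof. by apply: (big_morph Cim) => // -[p q] [p' q']. Qed.

Lemma Re_zpartial f n : Cre (zpartial f n) = rpart (fun k => Cre (f k)) n.
Proof. by rewrite /zpartial sum_cube Re_sum. Qed.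

Lemma Im_zpartial f n : Cim (zpartial f n) = rpart (fun k => Cim (f k)) n.
Proof. by rewrite /zpartial sum_cube Im_sum. Qed.

Definition Fsq x y t := rsum (Ckern x y t) ^+ 2 + rsum (Skern x y t) ^+ 2.

Lemma Fsq_ge0 x y t : 0 <= Fsq x y t.
Proof. by rewrite addr_ge0 ?sqr_ge0. Qed.

(** Both sides are built from limits of the same partial sums, so no summability is involved. *)
Lemma normc_fourier f t :
  normc (fourier f t) ^+ 2 = Fsq (fun k => Cre (f k)) (fun k => Cim (f k)) t.
Proof.
pose g k := cexpN (zdot k t) * f k.
have E1 : (fun n => Cre (zpartial g n)) =
    rpart (Ckern (fun k => Cre (f k)) (fun k => Cim (f k)) t).
  apply/funext => n; rewrite Re_zpartial; apply: eq_bigr => k _.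
  by rewrite /g /Ckern; case: (f k) => p q /=; ring.
have E2 : (fun n => Cim (zpartial g n)) =
    rpart (Skern (fun k => Cre (f k)) (fun k => Cim (f k)) t).
  apply/funext => n; rewrite Im_zpartial; apply: eq_bigr => k _.
  by rewrite /g /Skern; case: (f k) => p q /=; ring.
by rewrite normc_sqr /fourier /zsum /= -/g E1 E2.
Qed.

Lemma measurable_Fsq x y : asum x -> asum y -> measurable_fun setT (Fsq x y).
Proof.
move=> ax ay; change (measurable_fun setT (fun t : freq =>
  rsum (Ckern x y t) ^+ 2 + rsum (Skern x y t) ^+ 2)).
apply: measurable_funD; apply: measurable_funX;
  [exact: measurable_Csum|exact: measurable_Ssum].
Qed.

(** The difference multiplies the transform by [exp(i theta_j) - 1], whose squared modulus
    [2 - 2 cos theta_j] equals [(2 sin (theta_j / 2)) ^ 2]. *)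
Lemma Fsq_fdiff x y t (j : 'I_d) : asum x -> asum y ->
  Fsq (fun k => x (k + delta_mx 0 j) - x k) (fun k => y (k + delta_mx 0 j) - y k) t =
  (2 * sin (tnth t j / 2)) ^+ 2 * Fsq x y t.
Proof.
move=> ax ay; set e := delta_mx 0 j; set b : R := tnth t j.
have aC : asum (Ckern x y t) by apply: asum_kern ax ay _ => k; exact: Ckern_le.
have aS : asum (Skern x y t) by apply: asum_kern ax ay _ => k; exact: Skern_le.
pose gC k := cos b * Ckern x y t k - sin b * Skern x y t k.
pose gS k := cos b * Skern x y t k + sin b * Ckern x y t k.
have asN g : asum g -> asum (fun k => - g k).
  by move/(asumZ (-1)); congr asum; apply/funext => k; rewrite mulN1r.
have agC : asum gC by apply: asumD; [exact: asumZ|apply: asN; exact: asumZ].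
have agS : asum gS by apply: asumD; exact: asumZ.
have zk k : zdot k t = zdot (k + e) t - b :> R by rewrite zdotD_delta addrK.
have EC : rsum (Ckern (fun k => x (k + e) - x k) (fun k => y (k + e) - y k) t) =
    rsum gC - rsum (Ckern x y t).
  rewrite -(rsum_shift e agC) -rsumB//; last exact: asum_shift agC.
  congr rsum; apply/funext => k; rewrite /gC /Ckern /Skern (zk k) cosB sinB; ring.
have ES : rsum (Skern (fun k => x (k + e) - x k) (fun k => y (k + e) - y k) t) =
    rsum gS - rsum (Skern x y t).
  rewrite -(rsum_shift e agS) -rsumB//; last exact: asum_shift agS.
  congr rsum; apply/funext => k; rewrite /gS /Ckern /Skern (zk k) cosB sinB; ring.
rewrite /Fsq EC ES /gC /gS (rsumB (asumZ (cos b) aC) (asumZ (sin b) aS)).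
rewrite (rsumD (asumZ (cos b) aS) (asumZ (sin b) aC)).
rewrite !rsumZ//.
have h : cos b ^+ 2 + sin b ^+ 2 = 1 := cos2Dsin2 b.
have h2 := cos_half b.
set C := rsum _; set S := rsum _.
have -> : (cos b * C - sin b * S - C) ^+ 2 + (cos b * S + sin b * C - S) ^+ 2 =
  (cos b ^+ 2 + sin b ^+ 2 + 1 - 2 * cos b) * (C ^+ 2 + S ^+ 2) by ring.
by rewrite h h2; ring.
Qed.

Lemma l2sq_le f (X : \bar R) :
  (forall n, ((rpart (fun k => Cre (f k) ^+ 2 + Cim (f k) ^+ 2) n)%:E <= X)%E) ->
  (l2sq f <= X)%E.
Proof.
move=> H; apply: ge_ereal_sup => _ [A [finA _] <-].
rewrite fsbig_finite//= sumEFin.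
pose n := (\max_(k <- finmap.enum_fset (fset_set A)) zsup k)%N.
apply: le_trans (H n); rewrite lee_fin.
under eq_bigr do rewrite normc_sqr.
apply: ler_sum_subset.
- by move=> k; rewrite addr_ge0 ?sqr_ge0.
- exact: finmap.fset_uniq.
- exact: zbox_uniq.
- by move=> k kA; rewrite mem_zbox /n; exact: leq_bigmax_seq.
Qed.

Lemma l2sq_ge f k : ((normc (f k) ^+ 2)%:E <= l2sq f)%E.
Proof.
apply: esum_ge; exists [set k]; first by split=> //; exact: finite_set1.
by rewrite fsbig_set1.
Qed.

Lemma l2sq_fourier f : asum (fun k => Cre (f k)) -> asum (fun k => Cim (f k)) ->
  (l2sq f <= \int[mu]_(t in torus) (Fsq (fun k => Cre (f k)) (fun k => Cim (f k)) t)%:E)%E.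
Proof.
move=> ax ay; apply: l2sq_le => n; apply: le_trans (parseval_le n ax ay).
(* The Parseval factor [(2 pi) ^ d] is at least 1 and is simply dropped. *)
rewrite lee_fin ler_peMl//.
  by apply: sumr_ge0 => k _; rewrite addr_ge0 ?sqr_ge0.
by apply: exprn_ege1; have := @pi_ge2 R; lra.
Qed.

Lemma energy_fourier (a : R -> R) (u : R -> Zd -> R[i]) (s : R) :
  asum (fun k => Cre (u s k)) -> asum (fun k => Cim (u s k)) ->
  asum (fun k => Cre (tderive u s k)) -> asum (fun k => Cim (tderive u s k)) ->
  (energy a u s <= \int[mu]_(t in torus)
    (Fsq (fun k => Cre (tderive u s k)) (fun k => Cim (tderive u s k)) t +
     a s ^+ 2 * xinorm t ^+ 2 * Fsq (fun k => Cre (u s k)) (fun k => Cim (u s k)) t)%:E)%E.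
Proof.
move=> ax ay ax' ay'; rewrite /energy.
set x := (fun k => Cre (u s k)); set y := (fun k => Cim (u s k)).
set x' := (fun k => Cre (tderive u s k)); set y' := (fun k => Cim (tderive u s k)).
have mF := measurable_Fsq ax ay; have mF' := measurable_Fsq ax' ay'.
pose G (j : 'I_d) t := (2 * sin (tnth t j / 2)) ^+ 2 * Fsq x y t.
have G0 j t : 0 <= G j t by rewrite mulr_ge0 ?sqr_ge0 ?Fsq_ge0.
have mG j : measurable_fun setT (G j).
  have ms : measurable_fun setT (fun t : freq => sin (tnth t j / 2) : R).
    apply: (measurableT_comp (f := @sin R)).
      by apply: continuous_measurable_fun; exact: continuous_sin.
    by apply: measurable_funM => //; exact: measurable_tnthT.
  apply: measurable_funM => //; apply: measurable_funX.
  exact: measurable_funM.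
have mE (f : freq -> R) : measurable_fun setT f -> measurable_fun torus (fun t => (f t)%:E).
  by move=> mf; apply/measurable_EFinP; exact: measurable_funTS.
have mT := @measurable_torus R d.
have asN (g h : Zd -> R) : asum g -> asum h -> asum (fun k => g k - h k).
  move=> ag /(asumZ (-1)) ah; have := asumD ag ah.
  by congr asum; apply/funext => k; rewrite mulN1r.
have D j : (l2sq (fdiff j (u s)) <= \int[mu]_(t in torus) (G j t)%:E)%E.
  have ReB (z w : R[i]) : Cre (z - w) = Cre z - Cre w by case: z; case: w.
  have ImB (z w : R[i]) : Cim (z - w) = Cim z - Cim w by case: z; case: w.
  have E1 : (fun k => Cre (fdiff j (u s) k)) = (fun k => x (k + delta_mx 0 j) - x k).
    by apply/funext => k; rewrite /fdiff ReB.
  have E2 : (fun k => Cim (fdiff j (u s) k)) = (fun k => y (k + delta_mx 0 j) - y k).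
    by apply/funext => k; rewrite /fdiff ImB.
  apply: (le_trans (l2sq_fourier _ _)).
  - by rewrite E1; apply: asN => //; exact: asum_shift ax.
  - by rewrite E2; apply: asN => //; exact: asum_shift ay.
  rewrite E1 E2 le_eqVlt; apply/orP; left; apply/eqP; apply: eq_integral => t _.
  by rewrite Fsq_fdiff.
have -> : (\int[mu]_(t in torus) (Fsq x' y' t + a s ^+ 2 * xinorm t ^+ 2 * Fsq x y t)%:E =
   \int[mu]_(t in torus) (Fsq x' y' t)%:E +
   (a s ^+ 2)%:E * \sum_(j < d) \int[mu]_(t in torus) (G j t)%:E)%E.
  transitivity (\int[mu]_(t in torus) ((Fsq x' y' t)%:E + (a s ^+ 2)%:E * \sum_(j < d) (G j t)%:E))%E.
    apply: eq_integral => t _; rewrite sumEFin -EFinM -EFinD; congr (_%:E).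
    by rewrite xinorm_sqr -mulrA mulr_suml.
  have mS : measurable_fun torus (fun t => (\sum_(j < d) (G j t)%:E)%E).
    by apply: emeasurable_sum => j; exact: mE.
  have S0 t : torus t -> (0 <= \sum_(j < d) (G j t)%:E)%E.
    by move=> _; apply: sume_ge0 => j _; rewrite lee_fin.
  rewrite ge0_integralD//; first last.
  - exact: measurable_funeM.
  - by move=> t tt; apply: mule_ge0; [rewrite lee_fin sqr_ge0|exact: S0].
  - exact: mE.
  - by move=> t _; rewrite lee_fin Fsq_ge0.
  rewrite ge0_integralZl//; last by rewrite lee_fin sqr_ge0.
  rewrite ge0_integral_sum//; first by move=> j; exact: mE.
  by move=> j t _; rewrite lee_fin.
apply: leeD; first exact: l2sq_fourier.
by apply: lee_wpmul2l; [rewrite lee_fin sqr_ge0|apply: lee_sum => j _; exact: D].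
Qed.

End EnergyFourier.

(** * From a lattice solution to oscillators at each frequency *)

Section WaveSolution.
Context {R : realType} {d : nat}.
Local Notation Zd := 'rV[int]_d.

(** Continuity in l^2 bounds all values near each time, because a single value is dominated by
    [l2sq]; compactness of the time interval makes the bound uniform. It supplies the a priori bound
    of [wave_localized]. *)
Lemma l2_continuous_bounded (u : R -> Zd -> R[i]) : l2_continuous u ->
  forall T, 0 <= T -> exists2 G, 0 <= G &
    forall t k, 0 <= t <= T -> normc (u t k) <= G.
Proof.
move=> cu T T0.
have loc (t : R) : 0 <= t -> exists2 M : R, 0 <= M &
    \forall s \near t, 0 <= s -> forall k, normc (u s k) <= M.
  move=> t0; have [l2t /fine_cvgP[lfin lt]] := cu t t0.
  have ut k : normc (u t k) <= 1 + fine (l2sq (u t)).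
    have := l2sq_ge (u t) k; move: l2t; rewrite /in_l2.
    case: (l2sq (u t)) => [r _|//|//]; rewrite lee_fin /=.
    have := sqr_ge0 (normc (u t k) - 1); nra.
  exists (3 + fine (l2sq (u t))).
    by rewrite addr_ge0// fine_ge0//; apply: esum_ge0 => k _; rewrite lee_fin sqr_ge0.
  have lt1 : \forall s \near within `[0, +oo[ (nbhs t), fine (l2sq (fun k => (u s k - u t k)%R)) < 1.
    by apply: (cvgr_lt _ lt); rewrite /= ltr01.
  have : \forall s \near within `[0, +oo[ (nbhs t), forall k, normc (u s k - u t k) <= 1.
    apply: filterS2 lfin lt1 => s /fineK f1 f2 k.
    have := l2sq_ge (fun k => u s k - u t k) k; rewrite -f1 lee_fin => h.
    by rewrite -(@ler_pXn2r _ 2) ?nnegrE ?normc_ge0// expr1n (le_trans h)// ltW.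
  move=> W; have {}W : \forall s \near t, [set` `[(0:R), +oo[] s ->
    forall k, normc (u s k - u t k) <= 1 := W.
  apply: filterS W => s Hs s0 k.
  have /Hs/(_ k) h1 : [set` `[(0:R), +oo[] s by rewrite /= in_itv /= s0.
  have := le_normcD (u s k - u t k) (u t k); rewrite subrK => h2.
  apply: (le_trans h2); have := ut k; lra.
have cT : compact (`[(0:R), T]%classic) by exact: segment_compact.
have /compact_near_coveringP cov := cT.
have [|M [_ HM]] := cov R (pinfty_nbhs R)
    (fun M s => 0 <= s -> forall k, normc (u s k) <= M) _.
  move=> t; rewrite /= in_itv /= => /andP[t0 tT]; have [M M0 HM] := loc t t0.
  exists ([set s : R | 0 <= s -> forall k, normc (u s k) <= M], [set M' : R | M < M']).
    by split => //=; exists M; split => //; exact: num_real.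
  by move=> [s M'] /= [h1 h2] s0 k; exact: le_trans (h1 s0 k) (ltW h2).
exists (Num.max 0 (M + 1)); first by rewrite le_max lexx.
move=> t k /andP[t0 tT].
have MM : M < Num.max 0 (M + 1) by rewrite lt_max ltrDl ltr01 orbT.
apply: (HM _ MM) => //.
by rewrite /= in_itv /= t0.
Qed.

Lemma wave_solution_real (a : R -> R) u0 u1 (u : R -> Zd -> R[i]) : wave_solution a u0 u1 u ->
  real_wave a (fun t k => Cre (u t k)) (fun t k => Cre (tderive u t k)) /\
  real_wave a (fun t k => Cim (u t k)) (fun t k => Cim (tderive u t k)).
Proof.
case=> _ _ _ _ H.
have E t k : 0 <= t -> tderive (tderive u) t k = (a t ^+ 2)%:C%C * (\sum_(j < d)
    (u t (k + delta_mx 0 j) - 2 * u t k + u t (k - delta_mx 0 j))).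
  by move=> /H[_ _ /(_ k) /eqP]; rewrite subr_eq0 => /eqP.
have ReD (z w : R[i]) : Cre (z + w) = Cre z + Cre w by case: z; case: w.
have ImD (z w : R[i]) : Cim (z + w) = Cim z + Cim w by case: z; case: w.
have ReN (z : R[i]) : Cre (- z) = - Cre z by case: z.
have ImN (z : R[i]) : Cim (- z) = - Cim z by case: z.
have ReZ (c : R) (z : R[i]) : Cre (c%:C%C * z) = c * Cre z.
  by case: z => p q /=; rewrite mul0r subr0.
have ImZ (c : R) (z : R[i]) : Cim (c%:C%C * z) = c * Cim z.
  by case: z => p q /=; rewrite mul0r addr0.
split=> t k t0; have [d1 d2 _] := H t t0.
- have [h1 _] := d1 k; have [h2 _] := d2 k; split; first exact: h1.
  have -> : a t ^+ 2 * lapl (fun k => Cre (u t k)) k = Cre (tderive (tderive u) t k).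
    rewrite E// ReZ Re_sum /lapl; congr (_ * _); apply: eq_bigr => j _.
    by rewrite !ReD ReN !mulr_natl !mulr2n ReD.
  exact: h2.
- have [_ h1] := d1 k; have [_ h2] := d2 k; split; first exact: h1.
  have -> : a t ^+ 2 * lapl (fun k => Cim (u t k)) k = Cim (tderive (tderive u) t k).
    rewrite E// ImZ Im_sum /lapl; congr (_ * _); apply: eq_bigr => j _.
    by rewrite !ImD ImN !mulr_natl !mulr2n ImD.
  exact: h2.
Qed.

Lemma oscillatorD (a : R -> R) lam v v1 w w1 : oscillator a lam v v1 ->
  oscillator a lam w w1 -> oscillator a lam (fun t => v t + w t) (fun t => v1 t + w1 t).
Proof.
move=> Hv Hw t t0; have [h1 h2] := Hv t t0; have [h3 h4] := Hw t t0.
by split; [exact: hderD|have := hderD h2 h4; congr hder; ring].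
Qed.

Lemma oscillatorN (a : R -> R) lam v v1 : oscillator a lam v v1 ->
  oscillator a lam (fun t => - v t) (fun t => - v1 t).
Proof.
move=> Hv t t0; have [h1 h2] := Hv t t0.
by split; [exact: hderN|have := hderN h2; congr hder; ring].
Qed.

Section FourierOsc.
Variables (a da : R -> R) (a1 La : R) (x y x' y' : R -> Zd -> R).
Hypotheses (a_bnd : forall t, 0 <= t -> `|a t| <= a1).
Hypotheses (a_der : forall t, 0 <= t -> hder a t (da t)).
Hypotheses (da_bnd : forall t, 0 <= t -> `|da t| <= La).
Hypotheses (wx : real_wave a x x') (wy : real_wave a y y').
Hypothesis lx : localized x x'.
Hypothesis ly : localized y y'.
Variable th : d.-tuple (measurableTypeR R).

Lemma loc_asum (z z' : R -> Zd -> R) t : 0 <= t ->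
  localized z z' ->
  asum (z t) /\ asum (z' t).
Proof.
move=> t0 /(_ t t0)[B B0 H]; split; apply: (@asum_le_weight _ _ _ B) => k;
  by have [|] := H t k; rewrite ?t0 ?lexx.
Qed.

(** The phases 0 and [- (pi / 2)] give the cosine and sine series from which the real and imaginary
    parts of the transform are assembled. *)
Lemma cos_osc (z z' : R -> Zd -> R) (c : R) : real_wave a z z' ->
  localized z z' ->
  oscillator a (xinorm th) (fun t => rsum (fun k => cos (zdot k th + c) * z t k))
     (fun t => rsum (fun k => cos (zdot k th + c) * z' t k)).
Proof.
move=> wz lz; apply: (wave_oscillator a_bnd wz a_der da_bnd lz).
  by move=> k; exact: norm_cos.
by move=> k; exact: lapl_cos.
Qed.

Let cosN (u : R) : cos (u + - (pi / 2)) = sin u.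
Proof. by rewrite cosB cos_pihalf sin_pihalf mulr0 add0r mulr1. Qed.

Let asum_cos (g : Zd -> R) (c : R) : asum g -> asum (fun k => cos (zdot k th + c) * g k).
Proof.
move=> ag; apply: (@asum_dom _ _ _ (fun k => `|g k|) 1); last exact: asum_norm.
by move=> k; rewrite mul1r normrM ler_piMl// norm_cos.
Qed.

Lemma Csum_split (g h : Zd -> R) : asum g -> asum h -> rsum (Ckern g h th) =
  rsum (fun k => cos (zdot k th + 0) * g k) + rsum (fun k => cos (zdot k th + - (pi / 2)) * h k).
Proof.
move=> ag ah; rewrite -rsumD; [|exact: asum_cos|exact: asum_cos].
by congr rsum; apply/funext => k; rewrite cosN addr0.
Qed.

Lemma Ssum_split (g h : Zd -> R) : asum g -> asum h -> rsum (Skern g h th) =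
  rsum (fun k => cos (zdot k th + 0) * h k) - rsum (fun k => cos (zdot k th + - (pi / 2)) * g k).
Proof.
move=> ag ah; rewrite -rsumB; [|exact: asum_cos|exact: asum_cos].
by congr rsum; apply/funext => k; rewrite cosN addr0.
Qed.

(** The splitting of the Fourier sums is justified for nonnegative times only, where localization
    gives summability; [hder] sees no other times. *)
Lemma oscillator_eq (lam : R) (v w v1 w1 : R -> R) : (forall t, 0 <= t -> v t = w t) ->
  (forall t, 0 <= t -> v1 t = w1 t) -> oscillator a lam v v1 -> oscillator a lam w w1.
Proof.
move=> vw vw1 Hv t t0; have [h1 h2] := Hv t t0.
have E (f g : R -> R) l : (forall t, 0 <= t -> f t = g t) -> hder f t l -> hder g t l.
  move=> fg /hderP Hf; apply/hderP => e e0; have [dl dl0 H] := Hf e e0.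
  by exists dl => // s s0 sd; rewrite -!fg//; exact: H.
by split; [rewrite -vw1//; exact: E h1|rewrite -vw//; exact: E h2].
Qed.

Lemma Csum_osc : oscillator a (xinorm th) (fun t => rsum (Ckern (x t) (y t) th))
  (fun t => rsum (Ckern (x' t) (y' t) th)).
Proof.
apply: (oscillator_eq _ _ (oscillatorD (cos_osc 0 wx lx) (cos_osc (- (pi / 2)) wy ly))).
- by move=> t t0; have [? ?] := loc_asum t0 lx; have [? ?] := loc_asum t0 ly; rewrite Csum_split.
- by move=> t t0; have [? ?] := loc_asum t0 lx; have [? ?] := loc_asum t0 ly; rewrite Csum_split.
Qed.

Lemma Ssum_osc : oscillator a (xinorm th) (fun t => rsum (Skern (x t) (y t) th))
  (fun t => rsum (Skern (x' t) (y' t) th)).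
Proof.
apply: (oscillator_eq _ _ (oscillatorD (cos_osc 0 wy ly) (oscillatorN (cos_osc (- (pi / 2)) wx lx)))).
- by move=> t t0; have [? ?] := loc_asum t0 lx; have [? ?] := loc_asum t0 ly; rewrite Ssum_split.
- by move=> t t0; have [? ?] := loc_asum t0 lx; have [? ?] := loc_asum t0 ly; rewrite Ssum_split.
Qed.

End FourierOsc.

Lemma xinorm_ge0 (th : d.-tuple (measurableTypeR R)) : 0 <= xinorm th.
Proof. exact: sqrtr_ge0. Qed.

Lemma xinorm_le (th : d.-tuple (measurableTypeR R)) : xinorm th <= 2 * Num.sqrt d%:R.
Proof.
rewrite -(@ler_pXn2r _ 2) ?nnegrE ?xinorm_ge0 ?mulr_ge0 ?sqrtr_ge0//.
rewrite xinorm_sqr exprMn sqr_sqrtr//.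
apply: (@le_trans _ _ (\sum_(j < d) 2 ^+ 2)).
  apply: ler_sum => j _; rewrite exprMn; apply: ler_piMr; first exact: sqr_ge0.
  by rewrite -[X in _ <= X](cos2Dsin2 (tnth th j / 2)) lerDr sqr_ge0.
by rewrite sumr_const card_ord -[_ *+ d]mulr_natr.
Qed.

Lemma measurable_xinorm : measurable_fun setT (@xinorm R d).
Proof.
apply: (measurableT_comp (f := @Num.sqrt R)).
  by apply: continuous_measurable_fun; exact: sqrt_continuous.
apply: measurable_sum => j; apply: measurable_funX; apply: measurable_funM => //.
apply: (measurableT_comp (f := @sin R)).
  by apply: continuous_measurable_fun; exact: continuous_sin.
by apply: measurable_funM => //; exact: measurable_tnthT.
Qed.

(** [Theta] need not be continuous, but [Theta \o Linv Lambda] is monotone on the whole line because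
    [Linv] is nonnegative, and monotone functions are measurable. *)
Lemma measurable_growth (Theta Lambda : R -> R) (N : R) :
  {in `[0, +oo[ &, {homo Theta : s t / s <= t}} ->
  {homo Linv Lambda : r s / r <= s} ->
  measurable_fun setT (fun th : d.-tuple (measurableTypeR R) =>
    expR (2 * xinorm th * Theta (Linv Lambda (N / xinorm th)))).
Proof.
move=> Th Lh.
apply: (measurableT_comp (f := @expR R)).
  by apply: continuous_measurable_fun; exact: continuous_expR.
apply: measurable_funM.
  by apply: measurable_funM => //; exact: measurable_xinorm.
apply: (measurableT_comp (f := Theta \o Linv Lambda)).
  apply: nondecreasing_measurable => // r s rs /=.
  apply: Th; rewrite ?in_itv /= ?andbT ?Linv_ge0//; exact: Lh.
apply: measurable_funM => //.
rewrite (_ : (fun th => (xinorm th)^-1) =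
    (fun x : R => powR x (-1)) \o (@xinorm R d)).
  by apply: measurableT_comp; [exact: measurable_powR|exact: measurable_xinorm].
by apply/funext => th /=; rewrite powR_inv1// xinorm_ge0.
Qed.

End WaveSolution.

(** * Decay of the data and vanishing moments *)

Section Decay.
Context {R : realType} {d : nat}.
Local Notation Zd := 'rV[int]_d.
Implicit Types (k : Zd) (M : nat -> R).

Definition data_size (u0 u1 : Zd -> R[i]) k : R :=
  \sum_(j < d) normc (fdiff j u0 k) + normc (u1 k).

(** Condition (B) with the supremum over [j] unfolded and denominators cleared; in this form [rho]
    can be enlarged at once. *)
Definition decay_majorant M (rho B : R) (u0 u1 : Zd -> R[i]) := forall k j, (0 < j)%N ->
  data_size u0 u1 k * znorm k ^+ d.+1 * znorm k ^+ j <= B * (rho ^+ j * M j).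

Lemma data_size_ge0 u0 u1 k : 0 <= data_size u0 u1 k.
Proof. by rewrite addr_ge0 ?normc_ge0//; apply: sumr_ge0 => j _; exact: normc_ge0. Qed.

Lemma znorm_ge0 k : 0 <= znorm k :> R.
Proof. exact: sqrtr_ge0. Qed.

Lemma znorm_coord k j : (absz (k 0 j))%:R <= znorm k :> R.
Proof.
rewrite -(@ler_pXn2r _ 2) ?nnegrE ?znorm_ge0// sqr_sqrtr; last first.
  by apply: sumr_ge0 => i _; exact: sqr_ge0.
have -> : (absz (k 0 j))%:R ^+ 2 = (k 0 j)%:~R ^+ 2 :> R.
  by rewrite -[RHS]real_normK ?num_real// -intr_norm -abszE -pmulrn.
by rewrite (bigD1 j)//= lerDl; apply: sumr_ge0 => i _; exact: sqr_ge0.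
Qed.

Lemma zsup_attained k : (0 < d)%N -> exists j, zsup k = absz (k 0 j).
Proof.
move=> d0; have c0 : (0 < #|'I_d|)%N by rewrite card_ord.
by have [j Hj] := bigop.eq_bigmax (fun j => absz (k 0 j)) c0; exists j.
Qed.

Lemma zsup_le_znorm k : (zsup k)%:R <= znorm k :> R.
Proof.
have [d0|d0] := posnP d.
  rewrite /zsup big1 ?znorm_ge0// => j _.
  by have := ltn_ord j; rewrite [X in (_ < X)%N]d0.
by have [j ->] := zsup_attained k d0; exact: znorm_coord.
Qed.

Lemma zsup_eq0 k : zsup k = 0%N -> k = 0.
Proof.
move=> k0; apply/rowP => j; rewrite mxE; apply/eqP; rewrite -absz_eq0 -leqn0.
apply: leq_trans (eq_leq k0).
exact: (leq_bigmax (F := fun j => absz (k 0%R j))).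
Qed.

Lemma znorm_pow_weight k : k != 0 ->
  1 <= znorm k ^+ d.+1 * (2 ^+ d.+1 * weight k) :> R.
Proof.
move=> k0; rewrite mulrA ler_pdivlMr ?exprn_gt0// mul1r -exprMn.
apply: lerXn2r; rewrite ?nnegrE ?mulr_ge0 ?znorm_ge0//.
apply: (@le_trans _ _ ((zsup k)%:R * 2)); last by rewrite ler_wpM2r// zsup_le_znorm.
rewrite -natrM ler_nat muln2 -addnn -addn1 leq_add2l lt0n.
by apply: contra k0 => /eqP/zsup_eq0 ->.
Qed.

Lemma decay_bound M (rho : R) (u0 u1 : Zd -> R[i]) : (forall j, 0 < M j) -> 0 < rho ->
  decay_condition M rho u0 u1 -> exists2 B, 0 <= B &
  decay_majorant M rho B u0 u1.
Proof.
move=> M0 rho0; rewrite /decay_condition; set A := ereal_sup _ => Aoo.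
have H k j : (0 < j)%N ->
  ((data_size u0 u1 k * znorm k ^+ d.+1 * ((rho^-1 * znorm k) ^+ j / M j))%:E <= A)%E.
  move=> j0; rewrite EFinM.
  apply: (@le_trans _ _ ((data_size u0 u1 k * znorm k ^+ d.+1)%:E *
     assoc_fun M (rho^-1 * znorm k))%E).
    apply: lee_wpmul2l.
      by rewrite lee_fin mulr_ge0 ?data_size_ge0 ?exprn_ge0 ?znorm_ge0.
    by apply: ereal_sup_ubound; exists j.
  by apply: ereal_sup_ubound; exists k.
move: Aoo H; case: A => [r _|//|_ /(_ 0 1%N isT)]; last by rewrite leeNy_eq.
move=> H; exists `|r| => // k j j0; have := H k j j0; rewrite lee_fin => h.
have h2 : data_size u0 u1 k * znorm k ^+ d.+1 * ((rho^-1 * znorm k) ^+ j / M j) <= `|r|.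
  exact: le_trans h (ler_norm _).
have p0 : 0 < rho ^+ j * M j by rewrite mulr_gt0 ?exprn_gt0.
rewrite -ler_pdivrMr//; apply: le_trans h2.
apply: eq_ler; rewrite exprMn exprVn; field.
by rewrite !gt_eqF ?exprn_gt0.
Qed.

(** The case [j = 2] of the decay gives two powers more than [weight], to be spent on summing
    differences along a ray. At [k = 0] the decay condition says nothing, so the data there enter
    the constant. *)
Lemma data_weight M rho (u0 u1 : Zd -> R[i]) : (forall j, 0 < M j) -> 0 < rho ->
  decay_condition M rho u0 u1 -> exists2 C, 0 <= C &
  forall k, data_size u0 u1 k <= C * (weight k * (zsup k).+1%:R ^- 2).
Proof.
move=> M0 rho0 /(decay_bound M0 rho0)[B B0 HB].
pose C := B * (rho ^+ 2 * M 2) * 2 ^+ d.+3.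
have C0 : 0 <= C by rewrite mulr_ge0 ?exprn_ge0// mulr_ge0// mulr_ge0 ?exprn_ge0 ?ltW.
exists (C + data_size u0 u1 0); first by rewrite addr_ge0 ?data_size_ge0.
move=> k; have [->|k0] := eqVneq k 0.
  have -> : zsup (0 : Zd) = 0%N by rewrite /zsup big1// => j _; rewrite mxE.
  have -> : weight (0 : Zd) = 1 :> R.
    by rewrite /weight (_ : zsup 0 = 0%N) ?expr1n ?invr1// /zsup big1// => j _; rewrite mxE.
  by rewrite expr1n invr1 !mulr1 lerDr.
have w0 : 0 < weight k * (zsup k).+1%:R ^- 2 :> R.
  by rewrite mulr_gt0 ?weight_gt0// invr_gt0 exprn_gt0.
apply: (@le_trans _ _ (C * (weight k * (zsup k).+1%:R ^- 2))); last first.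
  by rewrite ler_wpM2r ?(ltW w0)// lerDl data_size_ge0.
have z1 : (zsup k).+1%:R <= 2 * znorm k :> R.
  apply: (@le_trans _ _ (2 * (zsup k)%:R)); last by rewrite ler_wpM2l// zsup_le_znorm.
  rewrite -natrM ler_nat mul2n -addnn -addn1 leq_add2l lt0n.
  by apply: contra k0 => /eqP/zsup_eq0 ->.
rewrite /weight -invfM -exprD addn2 ler_pdivlMr ?exprn_gt0//.
apply: (@le_trans _ _ (data_size u0 u1 k * (2 * znorm k) ^+ d.+3)).
  rewrite ler_wpM2l ?data_size_ge0//; apply: lerXn2r; rewrite ?nnegrE ?mulr_ge0 ?znorm_ge0//.
rewrite exprMn mulrCA mulrC /C; apply: ler_wpM2r; first exact: exprn_ge0.
by rewrite -[d.+3]addn2 exprD mulrA; exact: HB.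
Qed.

(** The differences are summed from infinity inwards, with the telescoping majorant
    [1 / p ^ 2 <= 2 / p - 2 / (p + 1)] for [p >= 1]. The last hypothesis says that 0 is approached
    along the sequence. *)
Lemma ray_bound (z : nat -> R) (A K : R) : 0 <= A -> 0 <= K ->
  (forall n, `|z n.+1 - z n| <= A * (1 + K + n%:R) ^- 2) ->
  (forall e, 0 < e -> exists n, `|z n| <= e) -> `|z 0%N| <= 2 * A.
Proof.
move=> A0 K0 dz fz.
have H n : `|z 0%N - z n| <= A * (2 - 2 * (1 + K + n%:R)^-1).
  elim: n => [|n IH].
    rewrite subrr normr0 addr0 mulr_ge0// subr_ge0 ler_pdivrMr ?ltr_pwDl//.
    by rewrite ler_peMr// lerDl.
  have -> : z 0%N - z n.+1 = (z 0%N - z n) - (z n.+1 - z n) by ring.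
  apply: (le_trans (ler_normB _ _)); apply: (le_trans (lerD IH (dz n))).
  rewrite -mulrDr; apply: ler_wpM2l => //.
  rewrite -[n.+1%:R]natr1 addrA; set p := 1 + K + n%:R.
  have p1 : 1 <= p by rewrite /p -addrA lerDl addr_ge0.
  have p0 : 0 < p by exact: lt_le_trans p1.
  have p10 : 0 < p + 1 by rewrite addr_gt0.
  rewrite -subr_ge0 (_ : _ - _ = (p - 1) / (p ^+ 2 * (p + 1))); last first.
    by field; rewrite !gt_eqF.
  by rewrite divr_ge0 ?subr_ge0// mulr_ge0 ?sqr_ge0// ltW.
apply/ler_addgt0Pr => e e0; have [n ne] := fz e e0.
have -> : z 0%N = (z 0%N - z n) + z n by rewrite subrK.
apply: (le_trans (ler_normD _ _)); apply: lerD => //.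
apply: (le_trans (H n)); rewrite mulrC ler_wpM2r// lerBlDr lerDl.
by rewrite mulr_ge0// invr_ge0 addr_ge0// addr_ge0.
Qed.

Lemma l2_small (f : Zd -> R[i]) (kk : nat -> Zd) : in_l2 f -> injective kk ->
  forall e, 0 < e -> exists n, normc (f (kk n)) <= e.
Proof.
move=> l2f ki e e0; apply: contrapT => /forallNP H.
have big n : e < normc (f (kk n)) by rewrite ltNge; apply/negP/H.
move: l2f; rewrite /in_l2.
have S m : ((m%:R * e ^+ 2)%:E <= l2sq f)%E.
  apply: esum_ge; exists [set` [seq kk i | i <- iota 0 m]].
    by split => //; exact: finite_seq.
  rewrite -fsbig_seq; last by rewrite map_inj_uniq ?iota_uniq.
  rewrite big_map sumEFin lee_fin.
  apply: (@le_trans _ _ (\sum_(i <- iota 0 m) e ^+ 2)).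
    by rewrite big_const_seq count_predT size_iota iter_addr_0 mulr_natl.
  apply: ler_sum => i _; apply: lerXn2r; rewrite ?nnegrE ?normc_ge0 ?ltW//.
case E : (l2sq f) => [r| |] // _; last by have := S 0%N; rewrite E leeNy_eq.
have := S (Num.truncn (r / e ^+ 2)).+1; rewrite E lee_fin leNgt => /negP; apply.
by rewrite -ltr_pdivrMr ?exprn_gt0// truncnS_gt.
Qed.

(* Follow from [k] the half line in the coordinate direction that attains [zsup k]:
   [zsup] increases along it, and [f] tends to 0 on it because [f] is in [l^2]. *)
Lemma weight_of_differences (f : Zd -> R[i]) C : (0 < d)%N -> 0 <= C -> in_l2 f ->
  (forall k j, normc (fdiff j f k) <= C * (weight k * (zsup k).+1%:R ^- 2)) ->
  forall k, `|Cre (f k)| <= 2 * C * weight k /\ `|Cim (f k)| <= 2 * C * weight k.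
Proof.
move=> d0 C0 l2f Df k.
have [j kj] := zsup_attained k d0.
pose sg : int := if 0 <= k 0 j then 1 else -1.
pose e : Zd := delta_mx 0 j.
pose kk n : Zd := k + (sg *+ n) *: e.
have kkS n : kk n.+1 = kk n + sg *: e by rewrite /kk mulrSr scalerDl addrA.
have kkj n : absz ((kk n) 0 j) = (zsup k + n)%N.
  rewrite /kk !mxE !eqxx mulr1 kj /sg; case: (k 0 j) => p /=.
    by rewrite -[1 *+ n]/(n%:R) natz -PoszD absz_nat.
  by rewrite mulNrn -[1 *+ n]/(n%:R) natz NegzE -opprD -PoszD !abszN !absz_nat.
have kk0 : kk 0%N = k by rewrite /kk mulr0n scale0r addr0.
have kki : injective kk.
  by move=> n m E; have := kkj n; rewrite E kkj => /addnI.
have kn n : (zsup k + n <= zsup (kk n))%N.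
  by rewrite -kkj; exact: (leq_bigmax (F := fun j => absz ((kk n) 0%R j))).
have B1 k' n : (zsup k + n <= zsup k')%N ->
    C * (weight k' * (zsup k').+1%:R ^- 2) <= C * weight k * (1 + (zsup k)%:R + n%:R) ^- 2.
  move=> h; rewrite -mulrA; apply: ler_wpM2l => //.
  apply: ler_pM; rewrite ?invr_ge0 ?exprn_ge0 ?(ltW (weight_gt0 _))//.
    rewrite lef_pV2 ?posrE ?exprn_gt0//; apply: lerXn2r; rewrite ?nnegrE// ler_nat ltnS.
    by rewrite (leq_trans _ h)// leq_addr.
  have -> : 1 + (zsup k)%:R + n%:R = (zsup k + n).+1%:R :> R.
    by rewrite -addrA -natrD nat1r.
  by rewrite lef_pV2 ?posrE ?exprn_gt0//; apply: lerXn2r; rewrite ?nnegrE// ler_nat ltnS.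
have step n : normc (f (kk n.+1) - f (kk n)) <= C * weight k * (1 + (zsup k)%:R + n%:R) ^- 2.
  have := kkS n; rewrite /sg; case: ifP => _.
    by rewrite scale1r => ->; apply: (le_trans (Df (kk n) j)); exact: B1.
  rewrite scaleN1r => /eqP; rewrite eq_sym subr_eq => /eqP E.
  rewrite E -[X in normc X]opprB normcN.
  apply: (le_trans (Df (kk n.+1) j)); apply: B1.
  by apply: leq_trans (kn n.+1); rewrite leq_add2l.
have W0 : 0 <= C * weight k by rewrite mulr_ge0// ltW// weight_gt0.
have ReB (z w : R[i]) : Cre (z - w) = Cre z - Cre w by case: z; case: w.
have ImB (z w : R[i]) : Cim (z - w) = Cim z - Cim w by case: z; case: w.
rewrite -!mulrA -kk0; split.
- apply: (@ray_bound (fun n => Cre (f (kk n))) _ (zsup k)%:R) => //; rewrite ?kk0//.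
    by move=> n; rewrite -ReB; apply: le_trans (step n); exact: normRe_le.
  move=> r r0; have [n Hn] := l2_small l2f kki r0; exists n.
  exact: le_trans (normRe_le _) Hn.
- apply: (@ray_bound (fun n => Cim (f (kk n))) _ (zsup k)%:R) => //; rewrite ?kk0//.
    by move=> n; rewrite -ImB; apply: le_trans (step n); exact: normIm_le.
  move=> r r0; have [n Hn] := l2_small l2f kki r0; exists n.
  exact: le_trans (normIm_le _) Hn.
Qed.

End Decay.

(** * Taylor remainder of the cosine and a lower bound of the sine *)

Section Taylor.
Context {R : realType}.

Lemma is_derive_hder (f : R -> R) (t l : R) : is_derive t 1 f l -> hder f t l.
Proof.
case=> df fl; apply/hderP => e e0.
have cv : (fun h => h^-1 *: (f (h *: 1 + t) - f t)) @ 0^' --> l.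
  by rewrite -fl; exact: df.
move/cvgrPdist_le : cv => /(_ e e0).
rewrite /dnbhs /within /= => /nbhs_ballP[dl /= dl0 H]; exists dl => // s _ sd.
have [->|st] := eqVneq s t; first by rewrite !subrr mulr0 subrr normr0 mulr0.
have st0 : s - t != 0 by rewrite subr_eq0.
have := H (s - t); rewrite /ball /= sub0r normrN => /(_ sd st0).
rewrite /GRing.scale /= mulr1 subrK distrC => h.
have -> : f s - f t - l * (s - t) = ((s - t)^-1 * (f s - f t) - l) * (s - t).
  by rewrite mulrBl mulrAC mulVf ?mul1r.
by rewrite normrM ler_wpM2r.
Qed.

Lemma hder_id (t : R) : hder (fun s : R => s) t 1.
Proof. by apply: is_derive_hder; exact: is_derive_id. Qed.

Lemma hderX n (t : R) : hder (fun s : R => s ^+ n.+1) t (n.+1%:R * t ^+ n).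
Proof.
elim: n => [|n IH]; first by rewrite expr0 mul1r; exact: hder_id.
have := hderM (hder_id t) IH; rewrite [X in hder _ _ X](_ : _ = n.+2%:R * t ^+ n.+1).
  exact: id.
by rewrite mul1r mulrCA -exprS -[n.+2%:R]natr1 mulrDl mul1r addrC.
Qed.

Lemma hder_sum (I : Type) (s : seq I) (F : I -> R -> R) (dF : I -> R) (t : R) :
  (forall i, hder (F i) t (dF i)) ->
  hder (fun u => \sum_(i <- s) F i u) t (\sum_(i <- s) dF i).
Proof.
move=> H; elim: s => [|i s IH].
  rewrite big_nil (_ : (fun u => _) = fun=> 0); first exact: hder_cst.
  by apply/funext => u; rewrite big_nil.
rewrite big_cons (_ : (fun u => _) = fun u => F i u + \sum_(j <- s) F j u).
  exact: hderD.
by apply/funext => u; rewrite big_cons.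
Qed.

(** The [i]-th derivative of the cosine at [c] is [cos (c + i pi / 2)], so no distinction modulo 4
    is needed. *)
Definition cos_taylor (c : R) j (y : R) : R :=
  \sum_(i < j) cos (c + i%:R * (pi / 2)) * y ^+ i / i`!%:R.

(** Differentiating the remainder in [t] gives [y] times the remainder of one order less at phase
    [c + pi / 2], and the bound on the right differentiates in the same way. Moving along the ray
    [t * y] confines the calculus to the half line for either sign of [y]. *)
Lemma cos_taylor_ray (c y : R) j t : 0 <= t ->
  `|cos (t * y + c) - cos_taylor c j (t * y)| <= `|y| ^+ j * t ^+ j / j`!%:R.
Proof.
elim: j c t => [|j IH] c t t0.
  by rewrite /cos_taylor big_ord0 subr0 !expr0 fact0 invr1 !mulr1 ler_norml cos_geN1 cos_le1.
pose phi s := cos (s * y + c) - cos_taylor c j.+1 (s * y).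
pose dphi s := y * (cos (s * y + (c + pi / 2)) - cos_taylor (c + pi / 2) j (s * y)).
pose b s := `|y| ^+ j.+1 / j.+1`!%:R * s ^+ j.+1.
pose db s := `|y| * (`|y| ^+ j * s ^+ j / j`!%:R).
have fn0 n : n`!%:R != 0 :> R by rewrite pnatr_eq0 -lt0n fact_gt0.
have hb s : hder b s (db s).
  have := @hderZ _ _ _ _ (`|y| ^+ j.+1 / j.+1`!%:R) (@hderX j s); congr hder.
  rewrite /db factS natrM exprS; field.
  by rewrite fn0 /=; rewrite -[1 + _]/(1 + j%:R) nat1r pnatr_eq0.
have hphi s : hder phi s (dphi s).
  have h1 : hder (fun s => cos (s * y + c)) s (- sin (s * y + c) * y).
    apply: is_derive_hder.
    have d1 : is_derive s 1 (fun s : R => s * y + c) y.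
      by apply: is_derive_eq; rewrite /GRing.scale /= mulr1 mulr0 add0r addr0.
    exact: (@is_derive1_comp _ (@cos R) (fun s : R => s * y + c)).
  have h2 : hder (fun s => cos_taylor c j.+1 (s * y)) s (y * cos_taylor (c + pi / 2) j (s * y)).
    rewrite (_ : (fun s => _) = fun s => cos c + \sum_(i < j)
        (cos (c + i.+1%:R * (pi / 2)) * y ^+ i.+1 / i.+1`!%:R) * s ^+ i.+1); last first.
      apply/funext => u; rewrite /cos_taylor big_ord_recl /=; congr (_ + _).
        by rewrite mul0r addr0 expr0 fact0 invr1 !mulr1.
      by apply: eq_bigr => i _; rewrite exprMn; ring.
    rewrite -[y * _]add0r; apply: hderD; first exact: hder_cst.
    rewrite /cos_taylor mulr_sumr; apply: hder_sum => i.
    have := @hderZ _ _ _ _ (cos (c + i.+1%:R * (pi / 2)) * y ^+ i.+1 / i.+1`!%:R) (@hderX i s).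
    congr hder; rewrite (_ : c + pi / 2 + i%:R * (pi / 2) = c + i.+1%:R * (pi / 2)).
      rewrite factS natrM exprMn exprS; field.
      by rewrite fn0 /=; rewrite -[1 + _]/(1 + i%:R) nat1r pnatr_eq0.
    by rewrite -[i.+1%:R]natr1; ring.
  have := hderB h1 h2; congr hder; rewrite /dphi addrA cosD cos_pihalf sin_pihalf; ring.
have phi0 : phi 0 = 0.
  rewrite /phi mul0r add0r /cos_taylor big_ord_recl /= big1.
    by rewrite mul0r addr0 expr0 fact0 invr1 !mulr1 addr0 subrr.
  by move=> i _; rewrite expr0n /= mulr0 mul0r.
have b0 : b 0 = 0 by rewrite /b expr0n /= mulr0.
have dle s : 0 <= s -> `|dphi s| <= db s.
  by move=> s0; rewrite normrM /db ler_wpM2l//; exact: IH.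
have mono (Q dQ : R -> R) : (forall s, hder Q s (dQ s)) -> (forall s, 0 <= s -> dQ s <= 0) ->
    Q t <= Q 0.
  move=> hQ Q0; have := @hder_gronwall R Q dQ 0 t 0 (lexx 0) t0.
  rewrite mul0r expR0 mulr1; apply => s /andP[s0 _]; first exact: hQ.
  by rewrite mul0r Q0.
have -> : `|y| ^+ j.+1 * t ^+ j.+1 / j.+1`!%:R = b t by rewrite /b mulrAC.
rewrite ler_norml; apply/andP; split.
- have := mono (fun s => - phi s - b s) (fun s => - dphi s - db s).
  rewrite phi0 b0 => /(_ (fun s => hderB (hderN (hphi s)) (hb s))).
  have H s : 0 <= s -> - dphi s - db s <= 0.
    by move=> /dle; rewrite ler_norml => /andP[h _]; lra.
  by move/(_ H); rewrite /phi; lra.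
- have := mono (fun s => phi s - b s) (fun s => dphi s - db s).
  rewrite phi0 b0 => /(_ (fun s => hderB (hphi s) (hb s))).
  have H s : 0 <= s -> dphi s - db s <= 0.
    by move=> /dle; rewrite ler_norml => /andP[_ h]; lra.
  by move/(_ H); rewrite /phi; lra.
Qed.

Lemma cos_taylor_bound (c y : R) j :
  `|cos (y + c) - cos_taylor c j y| <= `|y| ^+ j / j`!%:R.
Proof. by have := @cos_taylor_ray c y j 1 ler01; rewrite !mul1r expr1n mulr1. Qed.

(** The mean value theorem gives [sin (x / 2) >= (x / 2) cos (x / 2)]; hence
    [sin x >= x cos (x / 2) ^ 2], and [2 cos (x / 2) ^ 2 = 1 + cos x >= 1]. *)
Lemma sin_ge_half (x : R) : 0 <= x <= pi / 2 -> x / 2 <= sin x.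
Proof.
move=> /andP[x0 xp]; have pi0 := @pi_gt0 R.
have y0 : 0 <= x / 2 by rewrite divr_ge0.
have [c /andP[c0 cy]] := @hder_MVT R (@sin R) (@cos R) 0 (x / 2) (lexx 0) y0
  (fun s _ => is_derive_hder (is_derive_sin s)).
rewrite sin0 !subr0 => sE.
have cc : cos (x / 2) <= cos c.
  move: cy; rewrite le_eqVlt => /predU1P[->//|cy]; apply: ltW.
  by rewrite ltr_cos// in_itv /=; apply/andP; split => //; lra.
have cx : 0 <= cos (x / 2) by apply: cos_ge0_pihalf; apply/andP; split; lra.
have cx2 : 0 <= cos x by apply: cos_ge0_pihalf; apply/andP; split; lra.
have sE2 : sin x = 2 * sin (x / 2) * cos (x / 2).
  by rewrite {1}(splitr x) sinD; ring.
have cE : cos x = 2 * cos (x / 2) ^+ 2 - 1.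
  rewrite {1}(splitr x) cosD; have := cos2Dsin2 (x / 2); lra.
have h1 : cos (x / 2) * (x / 2) * cos (x / 2) <= sin (x / 2) * cos (x / 2).
  by rewrite ler_wpM2r// sE ler_wpM2r.
have h2 : x * 1 <= x * (2 * cos (x / 2) ^+ 2) by rewrite ler_wpM2l//; lra.
rewrite sE2; lra.
Qed.

End Taylor.

(** * Vanishing moments and smallness of the transform at low frequencies *)

Section Moments.
Context {R : realType} {d : nat}.
Local Notation Zd := 'rV[int]_d.
Local Notation freq := (d.-tuple (measurableTypeR R)).

Definition zmonomR (alpha : 'I_d -> nat) (k : Zd) : R :=
  (\prod_(j < d) k 0 j ^+ alpha j)%:~R.

Definition moments (g : Zd -> R) := forall alpha,
  rpart (fun k => zmonomR alpha k * g k) n @[n --> \oo] --> (0 : R).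

Lemma zmonomR_incr alpha (j : 'I_d) (k : Zd) :
  zmonomR (fun i => alpha i + (i == j))%N k = zmonomR alpha k * (k 0 j)%:~R.
Proof.
rewrite /zmonomR -intrM; congr (_%:~R).
under eq_bigr do rewrite exprD.
rewrite big_split /=; congr (_ * _); rewrite (bigD1 j)//= eqxx expr1 big1 ?mulr1//.
by move=> i /negPf ->.
Qed.

Lemma cvg_sum0 p (C : 'I_p -> R) (F : 'I_p -> nat -> R) :
  (forall i, F i n @[n --> \oo] --> (0 : R)) ->
  \sum_(i < p) C i * F i n @[n --> \oo] --> (0 : R).
Proof.
move=> FC; rewrite -[X in _ --> X](_ : \sum_(i < p) C i * 0 = 0); last first.
  by rewrite big1// => i _; rewrite mulr0.
elim: (index_enum _) => [|i r IH].
  rewrite big_nil (_ : (fun n => _) = fun=> 0); first exact: cvg_cst.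
  by apply/funext => n; rewrite big_nil.
rewrite big_cons (_ : (fun n => _) = fun n => C i * F i n + \sum_(i <- r) C i * F i n).
  by apply: cvgD => //; apply: cvgM; [exact: cvg_cst|exact: FC].
by apply/funext => n; rewrite big_cons.
Qed.

(** One factor [zdot k t] is expanded at a time, each coordinate raising one exponent of the
    monomial; this is why [alpha] is general. *)
Lemma moments_zdot g (t : freq) : moments g -> forall l alpha,
  rpart (fun k => zmonomR alpha k * zdot k t ^+ l * g k) n @[n --> \oo] --> (0 : R).
Proof.
move=> mg; elim=> [|l IH] alpha.
  rewrite (_ : (fun k => _) = fun k => zmonomR alpha k * g k); first exact: mg.
  by apply/funext => k; rewrite expr0 mulr1.
have E n : rpart (fun k => zmonomR alpha k * zdot k t ^+ l.+1 * g k) n =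
   \sum_(j < d) tnth t j * rpart (fun k =>
      zmonomR (fun i => alpha i + (i == j))%N k * zdot k t ^+ l * g k) n.
  under [RHS]eq_bigr do rewrite -rpartZ.
  rewrite /rpart exchange_big /=; apply: eq_bigr => k _.
  rewrite exprS {1}/zdot !mulr_suml mulr_sumr mulr_suml; apply: eq_bigr => j _.
  by rewrite zmonomR_incr; ring.
rewrite (_ : (fun n => _) = (fun n => \sum_(j < d) tnth t j * rpart (fun k =>
      zmonomR (fun i => alpha i + (i == j))%N k * zdot k t ^+ l * g k) n)); last exact/funext.
by apply: cvg_sum0 => j; exact: IH.
Qed.

(** The partial sums [P n] of the Taylor polynomial tend to 0, so subtracting them leaves the limit
    unchanged, while the Taylor remainder bounds every partial sum of the difference by [Q]. *)
Lemma moments_cos_le g h (t : freq) (c : R) (j : nat) (Q : R) : moments g -> asum g ->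
  (forall k, `|g k| <= h k) ->
  (forall n, rpart (fun k => `|zdot k t| ^+ j / j`!%:R * h k) n <= Q) ->
  `|rsum (fun k => cos (zdot k t + c) * g k)| <= Q.
Proof.
move=> mg ag gh HQ.
have ac : asum (fun k => cos (zdot k t + c) * g k).
  apply: (@asum_dom _ _ _ (fun k => `|g k|) 1); last exact: asum_norm.
  by move=> k; rewrite mul1r normrM ler_piMl// norm_cos.
pose P n := rpart (fun k => cos_taylor c j (zdot k t) * g k) n.
have P0 : P n @[n --> \oo] --> (0 : R).
  rewrite (_ : P = fun n => \sum_(i < j) (cos (c + i%:R * (pi / 2)) / i`!%:R) *
     rpart (fun k => zmonomR (fun=> 0%N) k * zdot k t ^+ i * g k) n); last first.
    apply/funext => n; under [RHS]eq_bigr do rewrite -rpartZ.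
    rewrite /P /rpart exchange_big /=; apply: eq_bigr => k _.
    rewrite /cos_taylor mulr_suml; apply: eq_bigr => i _.
    have -> : zmonomR (fun=> 0%N) k = 1 by rewrite /zmonomR big1// => i' _; rewrite expr0.
    by rewrite mul1r; ring.
  by apply: cvg_sum0 => i; exact: moments_zdot.
have C : rpart (fun k => cos (zdot k t + c) * g k) n - P n @[n --> \oo] -->
    rsum (fun k => cos (zdot k t + c) * g k).
  by rewrite -[X in _ --> X]subr0; apply: cvgB; [exact: cvg_rpart|exact: P0].
have bd n : `|rpart (fun k => cos (zdot k t + c) * g k) n - P n| <= Q.
  rewrite -rpartB; apply: (le_trans (rpart_norm _ _)); apply: le_trans (HQ n).
  apply: rpart_le => k; rewrite -mulrBl normrM; apply: ler_pM => //.
  exact: cos_taylor_bound.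
rewrite ler_norml; apply/andP; split.
- rewrite -(cvg_lim _ C)//; apply: limr_ge; first by apply/cvg_ex; eexists; exact: C.
  by apply: nearW => n; have := bd n; rewrite ler_norml => /andP[].
- rewrite -(cvg_lim _ C)//; apply: limr_le; first by apply/cvg_ex; eexists; exact: C.
  by apply: nearW => n; have := bd n; rewrite ler_norml => /andP[].
Qed.

Lemma zsum_is_moments (f : Zd -> R[i]) :
  (forall alpha, zsum_is (fun k => zmonom alpha k * f k) 0) ->
  moments (fun k => Cre (f k)) /\ moments (fun k => Cim (f k)).
Proof.
move=> H.
have zm alpha k : zmonom alpha k = (zmonomR alpha k)%:C%C by rewrite /zmonomR rmorph_int.
have ReZ (c : R) (z : R[i]) : Cre (c%:C%C * z) = c * Cre z.
  by case: z => p q /=; rewrite mul0r subr0.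
have ImZ (c : R) (z : R[i]) : Cim (c%:C%C * z) = c * Cim z.
  by case: z => p q /=; rewrite mul0r addr0.
split=> alpha; have [h1 h2] := H alpha.
- rewrite (_ : rpart _ = fun n => Cre (zpartial (fun k => zmonom alpha k * f k) n)) //.
  apply/funext => n; rewrite Re_zpartial.
  by apply: eq_bigr => k _; rewrite zm ReZ.
- rewrite (_ : rpart _ = fun n => Cim (zpartial (fun k => zmonom alpha k * f k) n)) //.
  apply/funext => n; rewrite Im_zpartial.
  by apply: eq_bigr => k _; rewrite zm ImZ.
Qed.

(** On the torus half the angle lies in the range of [sin_ge_half]; here the choice of the period
    cell around 0 matters. *)
Lemma torus_coord_le (t : freq) (j : 'I_d) : torus t -> `|tnth t j| <= 2 * xinorm t.
Proof.
move=> /(_ j) /andP[t1 t2].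
pose x : R := `|tnth t j| / 2.
have x0 : 0 <= x <= pi / 2.
  by rewrite divr_ge0//= ler_pM2r// ler_norml t1.
have h := sin_ge_half x0.
have sx : `|2 * sin (tnth t j / 2)| = 2 * sin x.
  have [p|p] := leP 0 (tnth t j).
    have xE : tnth t j / 2 = x by rewrite /x ger0_norm.
    by rewrite xE ger0_norm// mulr_ge0// (le_trans _ h)// divr_ge0//; case/andP: x0.
  have xE : tnth t j / 2 = - x by rewrite /x ltr0_norm// mulNr opprK.
  rewrite xE sinN mulrN normrN ger0_norm// mulr_ge0// (le_trans _ h)// divr_ge0//; by case/andP: x0.
have le : `|2 * sin (tnth t j / 2)| <= xinorm t.
  rewrite -(@ler_pXn2r _ 2) ?nnegrE ?xinorm_ge0// xinorm_sqr real_normK ?num_real//.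
  by rewrite (bigD1 j)//= lerDl; apply: sumr_ge0 => i _; exact: sqr_ge0.
move: h le; rewrite sx /x; lra.
Qed.

Lemma zdot_le (k : Zd) (t : freq) : torus t ->
  `|zdot k t| <= 2 * d%:R * xinorm t * znorm k.
Proof.
move=> tt; apply: (le_trans (ler_norm_sum _ _ _)).
apply: (@le_trans _ _ (\sum_(j < d) (znorm k * (2 * xinorm t)))); last first.
  rewrite sumr_const card_ord -[_ *+ d]mulr_natl le_eqVlt; apply/orP; left; apply/eqP; ring.
apply: ler_sum => j _; rewrite normrM; apply: ler_pM => //; last exact: torus_coord_le.
by rewrite -intr_norm -abszE -pmulrn; exact: znorm_coord.
Qed.

Section Density.
Variables (M : nat -> R) (rho B : R) (u0 u1 : Zd -> R[i]).
Hypotheses (M0 : forall j, 0 < M j) (rho0 : 0 < rho) (B0 : 0 <= B).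
Hypothesis HB : decay_majorant M rho B u0 u1.
Let S : R := rsum (@weight R d).

(** The factor [2 * d%:R * xinorm t] comes from [zdot_le], [rho] and [M j] from the decay,
    [2 ^+ d.+1] from comparing [|k| ^- d.+1] with [weight], and [S] from summing the weights. *)
Lemma data_cos_le g (t : freq) c j : (0 < j)%N -> torus t -> moments g -> asum g ->
  (forall k, `|g k| <= data_size u0 u1 k) ->
  `|rsum (fun k => cos (zdot k t + c) * g k)| <=
    B * 2 ^+ d.+1 * S * ((2 * d%:R * rho * xinorm t) ^+ j * (M j / j`!%:R)).
Proof.
move=> j0 tt mg ag gs; apply: (@moments_cos_le g (data_size u0 u1) t c j _ mg ag gs) => n.
pose q : R := (2 * d%:R * rho * xinorm t) ^+ j * (M j / j`!%:R).
have q0 : 0 <= q.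
  rewrite mulr_ge0 ?exprn_ge0// ?divr_ge0 ?(ltW (M0 j))//.
  by rewrite mulr_ge0 ?xinorm_ge0// mulr_ge0 ?(ltW rho0)// mulr_ge0.
have c0 : 0 <= B * 2 ^+ d.+1 * q by rewrite mulr_ge0// mulr_ge0// exprn_ge0.
apply: (@le_trans _ _ (rpart (fun k => B * 2 ^+ d.+1 * q * weight k) n)); last first.
  rewrite rpartZ [leRHS](_ : _ = B * 2 ^+ d.+1 * q * S); last by rewrite /q; ring.
  rewrite ler_wpM2l//; apply: rpart_le_rsum; last exact: asum_weight.
  by move=> k; exact/ltW/weight_gt0.
apply: rpart_le => k; have [->|k0] := eqVneq k 0.
  have -> : zdot 0 t = 0 :> R by rewrite /zdot big1// => i _; rewrite mxE mul0r.
  rewrite normr0 expr0n gtn_eqF// !mul0r mulr_ge0//; exact/ltW/weight_gt0.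
have z1 := @znorm_pow_weight R d k k0.
have zp : `|zdot k t| ^+ j <= (2 * d%:R * xinorm t) ^+ j * znorm k ^+ j.
  rewrite -exprMn; apply: lerXn2r; rewrite ?nnegrE//; last exact: zdot_le.
  by rewrite mulr_ge0 ?znorm_ge0// mulr_ge0 ?xinorm_ge0// mulr_ge0.
pose X : R := (2 * d%:R * xinorm t) ^+ j.
have X0 : 0 <= X by rewrite exprn_ge0// mulr_ge0 ?xinorm_ge0// mulr_ge0.
have s0 := @data_size_ge0 R d u0 u1 k.
have W0 : 0 <= 2 ^+ d.+1 * weight k :> R.
  by rewrite mulr_ge0 ?exprn_ge0//; exact/ltW/weight_gt0.
have zj0 : 0 <= znorm k ^+ j :> R by rewrite exprn_ge0 ?znorm_ge0.
have step : znorm k ^+ j * data_size u0 u1 k <= B * (rho ^+ j * M j) * (2 ^+ d.+1 * weight k).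
  apply: (@le_trans _ _ (znorm k ^+ j * data_size u0 u1 k * (znorm k ^+ d.+1 * (2 ^+ d.+1 * weight k)))).
    by rewrite ler_peMr// mulr_ge0.
  rewrite mulrA; apply: ler_wpM2r => //; apply: le_trans (HB k j0).
  by apply: eq_ler; ring.
apply: (@le_trans _ _ (X * znorm k ^+ j / j`!%:R * data_size u0 u1 k)).
  by rewrite ler_wpM2r// ler_wpM2r// invr_ge0 ltW.
rewrite (_ : _ * data_size u0 u1 k = X / j`!%:R * (znorm k ^+ j * data_size u0 u1 k)); last by ring.
apply: (@le_trans _ _ (X / j`!%:R * (B * (rho ^+ j * M j) * (2 ^+ d.+1 * weight k)))).
  by rewrite ler_wpM2l// divr_ge0// ltW.
rewrite /q (_ : 2 * d%:R * rho * xinorm t = 2 * d%:R * xinorm t * rho); last by ring.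
by rewrite [(_ * rho) ^+ j]exprMn -/X le_eqVlt; apply/orP; left; apply/eqP; ring.
Qed.

Lemma data_Fsq_le f (t : freq) j : (0 < j)%N -> torus t ->
  (forall alpha, zsum_is (fun k => zmonom alpha k * f k) 0) ->
  asum (fun k => Cre (f k)) -> asum (fun k => Cim (f k)) ->
  (forall k, normc (f k) <= data_size u0 u1 k) ->
  Fsq (fun k => Cre (f k)) (fun k => Cim (f k)) t <=
    8 * (B * 2 ^+ d.+1 * S * ((2 * d%:R * rho * xinorm t) ^+ j * (M j / j`!%:R))) ^+ 2.
Proof.
move=> j0 tt mf ax ay fs; have [mx my] := zsum_is_moments mf.
set q := B * _ * _ * _.
have hx c := data_cos_le c j0 tt mx ax (fun k => le_trans (normRe_le (f k)) (fs k)).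
have hy c := data_cos_le c j0 tt my ay (fun k => le_trans (normIm_le (f k)) (fs k)).
rewrite /Fsq Csum_split// Ssum_split//.
have sq (p r : R) : `|p| <= q -> `|r| <= q -> (p + r) ^+ 2 <= 4 * q ^+ 2.
  move=> hp hr; have h : `|p + r| <= 2 * q.
    by apply: (le_trans (ler_normD _ _)); rewrite mulr_natl mulr2n lerD.
  rewrite -[_ ^+ 2]real_normK ?num_real// (_ : 4 * q ^+ 2 = (2 * q) ^+ 2); last by ring.
  by apply: lerXn2r; rewrite ?nnegrE// (le_trans _ h).
have h1 := sq _ _ (hx 0) (hy (- (pi / 2))).
have h2 := sq _ (- _) (hy 0) (eq_rect _ (fun z => z <= q) (hx (- (pi / 2))) _ (esym (normrN _))).
lra.
Qed.

End Density.

End Moments.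

(** * The energy bound and the finiteness of U *)

Section EnergyBound.
Context {R : realType} {d : nat}.
Local Notation Zd := 'rV[int]_d.
Local Notation freq := (d.-tuple (measurableTypeR R)).
Local Notation mu := (lebesgue_tuple (R := R) d).
Variables (a Theta Lambda : R -> R).
Hypothesis Theta_homo : {in `[0, +oo[ &, {homo Theta : s t / s <= t}}.
Hypothesis Linv_le : {homo Linv Lambda : r s / r <= s}.

Lemma density_Fsq (u0 u1 : Zd -> R[i]) (t : freq) : energy_density0 a u0 u1 t =
  Fsq (fun k => Cre (u1 k)) (fun k => Cim (u1 k)) t +
  a 0 ^+ 2 * xinorm t ^+ 2 * Fsq (fun k => Cre (u0 k)) (fun k => Cim (u0 k)) t.
Proof. by rewrite /energy_density0 !normc_fourier. Qed.

Lemma density_ge0 (u0 u1 : Zd -> R[i]) (t : freq) : 0 <= energy_density0 a u0 u1 t.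
Proof.
by rewrite density_Fsq addr_ge0 ?Fsq_ge0// mulr_ge0 ?Fsq_ge0// -exprMn sqr_ge0.
Qed.

Definition l1data (f : Zd -> R[i]) := asum (fun k => Cre (f k)) /\ asum (fun k => Cim (f k)).

Lemma measurable_integrand (u0 u1 : Zd -> R[i]) N0 : l1data u0 -> l1data u1 ->
  measurable_fun torus (fun t : freq =>
    (expR (2 * xinorm t * Theta (Linv Lambda (N0 / xinorm t))) *
     energy_density0 a u0 u1 t)%:E).
Proof.
move=> [x0 y0] [x1 y1]; apply/measurable_EFinP; apply: measurable_funTS.
apply: measurable_funM; first exact: measurable_growth.
have -> : energy_density0 a u0 u1 = (fun t => Fsq (fun k => Cre (u1 k)) (fun k => Cim (u1 k)) t +
  a 0 ^+ 2 * xinorm t ^+ 2 * Fsq (fun k => Cre (u0 k)) (fun k => Cim (u0 k)) t).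
  by apply/funext => t; exact: density_Fsq.
apply: measurable_funD; first exact: measurable_Fsq.
apply: measurable_funM; last exact: measurable_Fsq.
by apply: measurable_funM => //; apply: measurable_funX; exact: measurable_xinorm.
Qed.

(** The real and imaginary parts of the transform solve the same oscillator equation, so their
    energy estimates add up to the pointwise bound that is integrated over the torus. *)
Lemma energy_le_U (da : R -> R) (a1 La N0 C B : R) (u0 u1 : Zd -> R[i]) :
  (forall t, 0 <= t -> `|a t| <= a1) -> (forall t, 0 <= t -> hder a t (da t)) ->
  (forall t, 0 <= t -> `|da t| <= La) -> 0 <= B -> 0 < C ->
  (forall lam v v1, 0 <= lam <= 2 * Num.sqrt d%:R -> oscillator a lam v v1 ->
    forall t, 0 <= t -> osc_energy (a t) lam v v1 t <=
      C * expR (2 * lam * Theta (Linv Lambda (N0 / lam))) * osc_energy (a 0) lam v v1 0) ->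
  (forall k, `|Cre (u0 k)| <= B * weight k /\ `|Cim (u0 k)| <= B * weight k) ->
  (forall k, `|Cre (u1 k)| <= B * weight k /\ `|Cim (u1 k)| <= B * weight k) ->
  forall u, wave_solution a u0 u1 u -> forall t, 0 <= t ->
    (energy a u t <= C%:E * U a Theta Lambda N0 u0 u1)%E.
Proof.
move=> a_bnd a_der da_bnd B0 C0 est w0 w1 u sol s s0.
have [wx wy] := wave_solution_real sol.
have [cu cu' u0E u1E _] := sol.
have bd (z : R[i] -> R) : (forall c, `|z c| <= normc c) ->
    forall T, 0 <= T -> exists2 G, 0 <= G & forall t k, 0 <= t <= T -> `|z (u t k)| <= G.
  move=> zn T T0; have [G G0 HG] := l2_continuous_bounded cu T0.
  by exists G => // t k tT; exact: le_trans (zn _) (HG t k tT).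
have lx := @wave_localized R d a a1 _ _ B a_bnd wx B0 _ (bd _ (@normRe_le R)).
have ly := @wave_localized R d a a1 _ _ B a_bnd wy B0 _ (bd _ (@normIm_le R)).
have {}lx := lx (fun k => conj (eq_ind_r (fun f => `|Cre (f k)| <= B * weight k) (w0 k).1 u0E)
  (eq_ind_r (fun f => `|Cre (f k)| <= B * weight k) (w1 k).1 u1E)).
have {}ly := ly (fun k => conj (eq_ind_r (fun f => `|Cim (f k)| <= B * weight k) (w0 k).2 u0E)
  (eq_ind_r (fun f => `|Cim (f k)| <= B * weight k) (w1 k).2 u1E)).
have [ax ax'] := loc_asum s0 lx; have [ay ay'] := loc_asum s0 ly.
have [ax0 ax0'] := loc_asum (lexx 0) lx; have [ay0 ay0'] := loc_asum (lexx 0) ly.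
rewrite u0E in ax0 ay0; rewrite u1E in ax0' ay0'.
apply: (le_trans (energy_fourier a ax ay ax' ay')).
rewrite /U -ge0_integralZl; first last.
- by rewrite lee_fin ltW.
- by move=> t _; rewrite lee_fin mulr_ge0 ?expR_ge0 ?density_ge0.
- exact: measurable_integrand.
- exact: measurable_torus.
apply: ge0_le_integral.
- exact: measurable_torus.
- move=> t _; rewrite lee_fin addr_ge0 ?Fsq_ge0// mulr_ge0 ?Fsq_ge0//.
  by rewrite -exprMn sqr_ge0.
- apply/measurable_EFinP; apply: measurable_funTS.
  apply: measurable_funD; first exact: measurable_Fsq.
  apply: measurable_funM; last exact: measurable_Fsq.
  by apply: measurable_funM => //; apply: measurable_funX; exact: measurable_xinorm.
- by apply: measurable_funeM; exact: measurable_integrand.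
move=> t _; rewrite -EFinM lee_fin density_Fsq.
have lam : 0 <= xinorm t <= 2 * Num.sqrt d%:R by rewrite xinorm_ge0 xinorm_le.
have e1 := est _ _ _ lam (Csum_osc a_bnd a_der da_bnd wx wy lx ly t) s s0.
have e2 := est _ _ _ lam (Ssum_osc a_bnd a_der da_bnd wx wy lx ly t) s s0.
move: e1 e2; rewrite /osc_energy u0E u1E /Fsq => e1 e2.
move: (lerD e1 e2) => e; apply: (le_trans (le_trans _ e)).
  by apply: eq_ler; ring.
by apply: eq_ler; ring.
Qed.

(** The moments of the differences of [u0] vanish, not those of [u0]; this suffices because only
    [|xi| ^ 2] times the square of its transform occurs, a sum of squared transforms of
    differences. *)
Lemma density_le M rho B (u0 u1 : Zd -> R[i]) (t : freq) j :
  (forall j, 0 < M j) -> 0 < rho -> 0 <= B ->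
  decay_majorant M rho B u0 u1 ->
  moment_condition u0 u1 -> l1data u0 -> l1data u1 -> (0 < j)%N -> torus t ->
  energy_density0 a u0 u1 t <=
   8 * (B * 2 ^+ d.+1 * rsum (@weight R d)) ^+ 2 * (1 + a 0 ^+ 2 * d%:R) *
   ((2 * d%:R * rho * xinorm t) ^+ j * (M j / j`!%:R)) ^+ 2.
Proof.
move=> M0 rho0 B0 HB mom [ax0 ay0] [ax1 ay1] j0 tt.
set A := B * _ * _; set q := (_ * _ * _ * _) ^+ j * _.
have asN (g h : Zd -> R) : asum g -> asum h -> asum (fun k => g k - h k).
  move=> ag /(asumZ (-1)) ah; have := asumD ag ah.
  by congr asum; apply/funext => k; rewrite mulN1r.
have ReB (z w : R[i]) : Cre (z - w) = Cre z - Cre w by case: z; case: w.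
have ImB (z w : R[i]) : Cim (z - w) = Cim z - Cim w by case: z; case: w.
have H1 : Fsq (fun k => Cre (u1 k)) (fun k => Cim (u1 k)) t <= 8 * (A * q) ^+ 2.
  apply: (data_Fsq_le M0 rho0 B0 HB j0 tt _ ax1 ay1).
    by move=> alpha; have [] := mom alpha.
  by move=> k; rewrite lerDr; apply: sumr_ge0 => i _; exact: normc_ge0.
have H0 (i : 'I_d) : (2 * sin (tnth t i / 2)) ^+ 2 *
    Fsq (fun k => Cre (u0 k)) (fun k => Cim (u0 k)) t <= 8 * (A * q) ^+ 2.
  rewrite -Fsq_fdiff//.
  have E1 : (fun k => Cre (u0 (k + delta_mx 0 i)) - Cre (u0 k)) = (fun k => Cre (fdiff i u0 k)).
    by apply/funext => k; rewrite /fdiff ReB.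
  have E2 : (fun k => Cim (u0 (k + delta_mx 0 i)) - Cim (u0 k)) = (fun k => Cim (fdiff i u0 k)).
    by apply/funext => k; rewrite /fdiff ImB.
  rewrite E1 E2; apply: (data_Fsq_le M0 rho0 B0 HB j0 tt).
  - by move=> alpha; have [+ _] := mom alpha; apply.
  - by rewrite -E1; apply: asN => //; exact: asum_shift ax0.
  - by rewrite -E2; apply: asN => //; exact: asum_shift ay0.
  - move=> k; rewrite /data_size (bigD1 i)//= -addrA lerDl addr_ge0 ?normc_ge0//.
    by apply: sumr_ge0 => i' _; exact: normc_ge0.
rewrite density_Fsq xinorm_sqr -mulrA mulr_suml.
have H2 : \sum_(i < d) (2 * sin (tnth t i / 2)) ^+ 2 *
    Fsq (fun k => Cre (u0 k)) (fun k => Cim (u0 k)) t <= d%:R * (8 * (A * q) ^+ 2).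
  apply: (@le_trans _ _ (\sum_(i < d) (8 * (A * q) ^+ 2))); first exact: ler_sum.
  by rewrite sumr_const card_ord -[_ *+ d]mulr_natl.
apply: (le_trans (lerD H1 (ler_wpM2l (sqr_ge0 (a 0)) H2))).
by apply: eq_ler; ring.
Qed.

(** Solving the hypothesis for [x ^- j / (M j / j!)] bounds the associated function at [1 / x] by
    [sqrt (K / g)]. The infimum defining [Lfunctional], taken at [tau = 1 / x], then bounds the
    exponential. *)
Lemma growth_le M N' (l K g x : R) : (forall j, 0 < M j) -> 0 < l -> 0 <= K -> 0 <= g ->
  (l%:E <= Lfunctional Theta Lambda N' M)%E -> 0 < x <= 1 ->
  (forall j, (0 < j)%N -> g <= K * (x ^+ j * (M j / j`!%:R)) ^+ 2) ->
  g * expR (x * Theta (Linv Lambda (N' / x))) ^+ 2 <= K / l ^+ 2.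
Proof.
move=> M0 l0 K0 g0 lL /andP[x0 x1] gq.
have [->|gn0] := eqVneq g 0; first by rewrite mul0r divr_ge0// sqr_ge0.
have {g0 gn0} g0 : 0 < g by rewrite lt_neqAle eq_sym gn0.
set e := expR _.
have e0 : 0 < e := expR_gt0 _.
pose r := Num.sqrt K / Num.sqrt g.
have sg0 : 0 < Num.sqrt g by rewrite sqrtr_gt0.
have T : (assoc_fun (fun j => M j / j`!%:R)%R x^-1 <= r%:E)%E.
  apply: ge_ereal_sup => _ [j j0 <-]; rewrite lee_fin.
  have m0 : 0 < M j / j`!%:R by rewrite divr_gt0// ltr0n fact_gt0.
  have xj0 : 0 < x ^+ j by rewrite exprn_gt0.
  have := gq j j0; rewrite -(ler_sqrt _); last first.
    by rewrite mulr_ge0// sqr_ge0.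
  rewrite sqrtrM// sqrtr_sqr ger0_norm; last by rewrite mulr_ge0// ltW.
  move=> h; rewrite ler_pdivrMr// /r mulrAC ler_pdivlMr// exprVn mulrC ler_pdivrMr//.
  by apply: (le_trans h); apply: eq_ler; ring.
have : (l%:E <= r%:E * (e^-1)%:E)%E.
  apply: (le_trans lL); apply: (@le_trans _ _ (assoc_fun (fun j => M j / j`!%:R)%R x^-1 * (e^-1)%:E)%E).
    apply: ereal_inf_lbound; exists x^-1; first by rewrite /= invf_ge1.
    by rewrite invrK.
  by apply: lee_wpmul2r => //; rewrite lee_fin invr_ge0 ltW.
rewrite -EFinM lee_fin ler_pdivlMr// /r ler_pdivlMr// => h.
rewrite ler_pdivlMr ?exprn_gt0//.
have -> : g * e ^+ 2 * l ^+ 2 = (l * e * Num.sqrt g) ^+ 2.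
  by rewrite !exprMn sqr_sqrtr ?ltW//; ring.
rewrite -(sqr_sqrtr K0); apply: lerXn2r; rewrite ?nnegrE ?sqrtr_ge0//.
by rewrite !mulr_ge0 ?ltW.
Qed.

Hypothesis Theta_gt0 : forall t, 0 <= t -> 0 < Theta t.

(** The last hypothesis translates the exponent of [U], at frequency [xi] and parameter [N0], into
    the exponent of [Lfunctional], at [x = 2 * d%:R * rho * xi] and parameter [N']. *)
Lemma U_finite M rho B N0 N' (u0 u1 : Zd -> R[i]) : (0 < d)%N ->
  (forall j, 0 < M j) -> 0 < rho -> 0 <= B -> 0 < N0 ->
  decay_majorant M rho B u0 u1 ->
  moment_condition u0 u1 -> l1data u0 -> l1data u1 ->
  (0 < Lfunctional Theta Lambda N' M)%E ->
  (forall xi, 0 < xi <= 2 * Num.sqrt d%:R ->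
    Theta (Linv Lambda (N0 / xi)) <=
      2 * d%:R * rho * Theta (Linv Lambda (N' / (2 * d%:R * rho * xi)))) ->
  (U a Theta Lambda N0 u0 u1 < +oo)%E.
Proof.
move=> d0 M0 rho0 B0 N00 HB mom l0 l1 L0 cmp.
have [l lgt0 lL] : exists2 l : R, 0 < l & (l%:E <= Lfunctional Theta Lambda N' M)%E.
  move: L0; case: (Lfunctional _ _ _ _) => [l h|_|//]; first by exists l.
  by exists 1 => //; rewrite leey.
have [r r0 rE] : exists2 r, 0 < r & r = 2 * d%:R * rho.
  by eexists; last reflexivity; rewrite mulr_gt0// mulr_gt0// ltr0n.
have S0 : 0 <= rsum (@weight R d).
  apply: le_trans (rpart_le_rsum 0 (fun k => ltW (weight_gt0 k)) asum_weight).
  by apply: sumr_ge0 => k _; exact/ltW/weight_gt0.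
have [K K0 HK] : exists2 K, 0 <= K & forall t j, torus t -> (0 < j)%N ->
    energy_density0 a u0 u1 t <= K * ((r * xinorm t) ^+ j * (M j / j`!%:R)) ^+ 2.
  exists (8 * (B * 2 ^+ d.+1 * rsum (@weight R d)) ^+ 2 * (1 + a 0 ^+ 2 * d%:R)).
    apply: mulr_ge0; first by apply: mulr_ge0 => //; exact: sqr_ge0.
    by apply: addr_ge0 => //; apply: mulr_ge0 => //; exact: sqr_ge0.
  by move=> t j tt j0; rewrite rE; exact: density_le.
pose sd : R := 2 * Num.sqrt d%:R.
pose K2 := expR (2 * sd * Theta (Linv Lambda (N0 * r))) * (K * (r * sd * M 1) ^+ 2).
have K20 : 0 <= K2 by rewrite mulr_ge0 ?expR_ge0// mulr_ge0 ?sqr_ge0.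
pose K1 := K / l ^+ 2.
have K10 : 0 <= K1 by rewrite divr_ge0 ?sqr_ge0.
have bound t : torus t ->
    expR (2 * xinorm t * Theta (Linv Lambda (N0 / xinorm t))) * energy_density0 a u0 u1 t <= K1 + K2.
  move=> tt; set xi := xinorm t.
  have xi0 : 0 <= xi by exact: xinorm_ge0.
  have xisd : xi <= sd by exact: xinorm_le.
  have g0 := density_ge0 u0 u1 t.
  have [xz|xn0] := eqVneq xi 0.
    rewrite xz mulr0 mul0r expR0 mul1r.
    have := HK t 1%N tt isT; rewrite -/xi xz mulr0 expr1 mul0r expr0n /= mulr0 => h.
    by apply: (le_trans h); exact: addr_ge0.
  have xp : 0 < xi by rewrite lt_neqAle eq_sym xn0.
  (* [Lfunctional] looks only at [tau = 1 / (r * xi) >= 1]. For larger [xi] the argument [N0 / xi]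
     is below [N0 * r], so the exponential is bounded, and [j = 1] bounds the density; their product
     is [K2]. *)
  have [x1|x1] := leP (r * xi) 1.
    have := @growth_le M N' l K (energy_density0 a u0 u1 t) (r * xi) M0 lgt0 K0 g0 lL.
    rewrite x1 mulr_gt0// => /(_ isT (fun j j0 => HK t j tt j0)) h.
    apply: (@le_trans _ _ K1); last by rewrite lerDl.
    apply: le_trans h; rewrite mulrC; apply: ler_wpM2l => //.
    rewrite expr2 -expRD ler_expR.
    have := cmp xi; rewrite xp xisd -rE => /(_ isT) c.
    have := ler_wpM2l xi0 c; lra.
  apply: (@le_trans _ _ K2); last by rewrite lerDr.
  apply: ler_pM; [exact: expR_ge0|exact: g0| |].
    rewrite ler_expR; apply: ler_pM.
    - exact: mulr_ge0.
    - by apply/ltW/Theta_gt0; exact: Linv_ge0.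
    - exact: ler_wpM2l.
    - apply: Theta_homo; rewrite ?in_itv /= ?Linv_ge0//; apply: Linv_le.
      by rewrite ler_pdivrMr// -mulrA ler_peMr ?ltW.
  apply: (le_trans (HK t 1%N tt isT)); apply: ler_wpM2l => //.
  rewrite expr1 factS fact0 muln1 divr1 -/xi; apply: lerXn2r; rewrite ?nnegrE.
  - by rewrite mulr_ge0 ?mulr_ge0 ?(ltW r0) ?(ltW (M0 1%N)).
  - by rewrite mulr_ge0 ?mulr_ge0 ?(ltW r0) ?(ltW (M0 1%N)).
  - by rewrite ler_wpM2r ?(ltW (M0 1%N))// ler_wpM2l ?(ltW r0).
apply: (@le_lt_trans _ _ (\int[mu]_(t in torus) (cst (K1 + K2)%:E t))%E).
  apply: ge0_le_integral.
  - exact: measurable_torus.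
  - by move=> t _; rewrite lee_fin mulr_ge0 ?expR_ge0 ?density_ge0.
  - exact: measurable_integrand.
  - exact: measurable_cst.
  - by move=> t tt; rewrite lee_fin; exact: bound.
by rewrite integral_torus_cst ltry.
Qed.

End EnergyBound.

Lemma decay_data_weight (R : realType) (d : nat) M (rho : R) (u0 u1 : 'rV[int]_d -> R[i]) :
  (0 < d)%N -> (forall j, 0 < M j) -> 0 < rho -> in_l2 u0 -> decay_condition M rho u0 u1 ->
  exists2 B, 0 <= B &
    (forall k, `|Cre (u0 k)| <= B * weight k /\ `|Cim (u0 k)| <= B * weight k) /\
    (forall k, `|Cre (u1 k)| <= B * weight k /\ `|Cim (u1 k)| <= B * weight k).
Proof.
move=> d0 M0 rho0 l2u0 dec; have [C C0 HC] := data_weight M0 rho0 dec.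
have w0 (k : 'rV[int]_d) : 0 <= weight k :> R by exact/ltW/weight_gt0.
exists (2 * C); first exact: mulr_ge0.
split.
  apply: weight_of_differences => // k j; apply: le_trans (HC k).
  rewrite /data_size (bigD1 j)//= -addrA lerDl addr_ge0 ?normc_ge0//.
  by apply: sumr_ge0 => i _; exact: normc_ge0.
move=> k; have H : normc (u1 k) <= 2 * C * weight k.
  apply: (@le_trans _ _ (data_size u0 u1 k)).
    by rewrite lerDr; apply: sumr_ge0 => i _; exact: normc_ge0.
  apply: (le_trans (HC k)); rewrite [2 * C]mulrC -[leRHS]mulrA; apply: ler_wpM2l => //.
  apply: (@le_trans _ _ (weight k)).
    by rewrite ler_piMr// invf_le1 ?exprn_gt0// exprn_ege1// ler1n.
  by rewrite ler_peMl// ler1n.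
by split; apply: le_trans H; [exact: normRe_le|exact: normIm_le].
Qed.

Theorem theorem3p9 (R : realType) (d m : nat) (a : R -> R) (a0 a1 : R)
    (Theta Xi Lambda : R -> R) (M : nat -> R) (N : R) :
  (1 <= d)%N -> (2 <= m)%N ->
  Cm_halfline m a ->
  0 < a0 -> a0 <= a1 ->
  (forall t, 0 <= t -> a0 <= a t <= a1) ->
  (forall t, 0 <= t -> 0 < Theta t) ->
  {in `[0, +oo[ &, {homo Theta : s t / s <= t}} ->
  (forall t, 0 <= t -> 0 < Xi t) ->
  {in `[0, +oo[ &, {homo Xi : s t / s <= t}} ->
  (forall t, 0 <= t -> 0 < Lambda t) ->
  {within `[0, +oo[, continuous Lambda} ->
  {in `[0, +oo[ &, {homo Lambda : s t / s < t}} ->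
  Lambda t @[t --> +oo] --> +oo ->
  (exists2 ainf : R, 0 < ainf & forall t, 0 <= t ->
    (\int[lebesgue_measure]_(s in `[0%R, t]) `|a s - ainf|%:E
       <= (Theta t)%:E)%E) ->
  (forall k, (1 <= k <= m)%N -> exists2 Ck : R, 0 < Ck & forall t, 0 <= t ->
    `|hderiven k a t| <= Ck * Xi t ^- k) ->
  {in `[0, +oo[ &, {homo (fun t => Theta t / Lambda t) : s t / s <= t}} ->
  Theta t / Lambda t @[t --> +oo] --> +oo ->
  (exists2 C0 : R, 0 < C0 & forall t, 0 <= t -> Lambda t <= C0 * Xi t) ->
  lebesgue_measure.-integrable `[0%R, +oo[ (fun t => (Xi t ^- m)%:E) ->
  (ereal_sup [set ((Lambda t ^+ m / Theta t)%:E *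
       \int[lebesgue_measure]_(s in `[t, +oo[) (Xi s ^- m)%:E)%E
     | t in [set t | (0 <= t)%R]] < +oo)%E ->
  (forall j, 0 < M j) -> log_convex M ->
  0 < N -> (0 < Lfunctional Theta Lambda N M)%E ->
  ((forall N' : R, 0 < N' -> (0 < Lfunctional Theta Lambda N' M)%E) ->
   exists2 C : R, 0 < C &
   forall u0 u1 : 'rV[int]_d -> R[i],
     in_l2 u0 -> in_l2 u1 -> moment_condition u0 u1 ->
     (exists2 rho : R, 0 < rho & decay_condition M rho u0 u1) ->
     exists2 N0 : R, 0 < N0 &
       (U a Theta Lambda N0 u0 u1 < +oo)%E /\
       forall u, wave_solution a u0 u1 u -> forall t, 0 <= t ->
         (energy a u t <= C%:E * U a Theta Lambda N0 u0 u1)%E)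
  /\
  ((ereal_inf [set (Theta (Linv Lambda (n * tau)) /
                    (n * Theta (Linv Lambda tau)))%:E
      | tau in [set tau | (2 * Num.sqrt d%:R)^-1 <= tau]]
      @[n --> +oo] --> +oo%E) ->
   exists rho N0 C : R, [/\ 0 < rho, 0 < N0, 0 < C &
   forall u0 u1 : 'rV[int]_d -> R[i],
     in_l2 u0 -> in_l2 u1 -> moment_condition u0 u1 ->
     decay_condition M rho u0 u1 ->
       (U a Theta Lambda N0 u0 u1 < +oo)%E /\
       forall u, wave_solution a u0 u1 u -> forall t, 0 <= t ->
         (energy a u t <= C%:E * U a Theta Lambda N0 u0 u1)%E]).
Proof.
move=> d0 m2 [a_diff _] a00 _ a_bnd Theta0 Theta_homo Xi0 Xi_homo Lambda0 Lambda_cont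
  Lambda_homo Lambda_oo [ainf ainf0 a_stab] a_symbol ratio_homo _ Lambda_Xi Xi_int
  tail M0 _ N_gt0 LN.
have a_der k t : (k < m)%N -> 0 <= t -> hder (hderiven k a) t (hderiven k.+1 a t).
  by move=> km t0; exact/hderivableE/a_diff.
pose sd : R := 2 * Num.sqrt d%:R.
have sd0 : 0 < sd by rewrite mulr_gt0// sqrtr_gt0 ltr0n.
have [N0 [C [N01 C0 est]]] := osc_energy_estimate m2 a00 a_bnd a_der Theta0 Theta_homo
  Xi0 Xi_homo Lambda0 Lambda_cont Lambda_homo Lambda_oo ainf0 a_stab a_symbol ratio_homo
  Lambda_Xi Xi_int tail sd.
have N00 : 0 < N0 by exact: lt_le_trans N01.
have Linv_le : {homo Linv Lambda : r s / r <= s} by exact: Linv_homo.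
(* [Xi] increases from the positive value [Xi 0]. The Lipschitz bound on [a] serves the termwise
   differentiation in time. *)
have da_bnd : exists La, forall t, 0 <= t -> `|hderiven 1 a t| <= La.
  have [|C1 C10 HC1] := a_symbol 1%N; first by rewrite /= ltnW.
  exists (C1 * Xi 0 ^- 1) => t t0; apply: (le_trans (HC1 t t0)).
  rewrite !expr1; apply: ler_wpM2l; first exact: ltW.
  by rewrite lef_pV2 ?posrE ?Xi0//; apply: Xi_homo; rewrite ?in_itv /= ?lexx ?t0.
have a_abs t : 0 <= t -> `|a t| <= a1.
  by move=> t0; have /andP[lo hi] := a_bnd t t0; rewrite ger0_norm// ltW// (lt_le_trans a00).
have [La HLa] := da_bnd.
(* Common to both cases: the decay rate [rho] may be replaced by a larger [r], chosen to fit the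
   comparison of the two exponents. *)
have main rho r N' (u0 u1 : 'rV[int]_d -> R[i]) : in_l2 u0 -> moment_condition u0 u1 ->
    0 < rho <= r -> decay_condition M rho u0 u1 -> (0 < Lfunctional Theta Lambda N' M)%E ->
    (forall xi, 0 < xi <= sd -> Theta (Linv Lambda (N0 / xi)) <=
      2 * d%:R * r * Theta (Linv Lambda (N' / (2 * d%:R * r * xi)))) ->
    (U a Theta Lambda N0 u0 u1 < +oo)%E /\
    forall u, wave_solution a u0 u1 u -> forall t, 0 <= t ->
      (energy a u t <= C%:E * U a Theta Lambda N0 u0 u1)%E.
  move=> l2u0 mom /andP[rho0 rhor] dec LN' cmp.
  have [B B0 [w0 w1]] := decay_data_weight d0 M0 rho0 l2u0 dec.
  split; last first.
    move=> u sol; apply: (@energy_le_U _ _ _ _ _ Theta_homo Linv_le _ _ _ _ _ _ _ _ a_abs _ HLa B0 C0 _ w0 w1 _ sol).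
      by move=> t t0; apply: a_der => //; exact: ltnW.
    exact: est.
  have [D D0 HD] := decay_bound M0 rho0 dec.
  have r0 : 0 < r by exact: lt_le_trans rhor.
  apply: (@U_finite _ _ _ _ _ Theta_homo Linv_le Theta0 _ _ _ _ _ _ _ d0 M0 r0 D0 N00 _ mom _ _ LN' cmp).
  - move=> k j j0; apply: (le_trans (HD k j j0)); apply: ler_wpM2l => //.
    apply: ler_wpM2r; first exact/ltW.
    by apply: lerXn2r => //; rewrite nnegrE ltW.
  - by split; apply: (@asum_le_weight _ _ _ B) => k; have [] := w0 k.
  - by split; apply: (@asum_le_weight _ _ _ B) => k; have [] := w1 k.
have dR : 0 < 2 * d%:R :> R by rewrite mulr_gt0// ltr0n.
split=> [LN'|lim_oo].
  exists C => // u0 u1 l2u0 _ mom [rho rho0 dec]; exists N0 => //.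
  (* This gives [2 * d%:R * r >= 1]. With [N' = N0 * (2 * d%:R * r)] both sides of the comparison
     have the same argument [N0 / xi]; positivity of [L] at this [N'] depends on [rho], which is why
     it is assumed for every parameter. *)
  pose r := Num.max rho 1.
  have r1 : 1 <= r by rewrite le_max lexx orbT.
  have q1 : 1 <= 2 * d%:R * r.
    by rewrite mulr_ege1// mulr_ege1 ?ler1n.
  have q0 : 0 < 2 * d%:R * r by exact: lt_le_trans q1.
  apply: (main rho r (N0 * (2 * d%:R * r)) u0 u1 l2u0 mom _ dec).
  - by rewrite rho0 le_max lexx.
  - by apply: LN'; rewrite mulr_gt0.
  - move=> xi /andP[xi0 _]; rewrite (_ : _ / (_ * xi) = N0 / xi); last first.
      by rewrite [_ * xi]mulrC -mulf_div divff ?gt_eqF// mulr1.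
    by rewrite ler_peMl// ltW// Theta0// Linv_ge0.
have [n [n0 Hn]] : exists n, 0 < n /\ forall tau, sd^-1 <= tau ->
    N0 / N <= Theta (Linv Lambda (n * tau)) / (n * Theta (Linv Lambda tau)).
  have /cvgeyPge/(_ (N0 / N))[A [_ HA]] := lim_oo.
  have An : A < Num.max A 0 + 1 by apply: (@le_lt_trans _ _ (Num.max A 0)); rewrite ?ltrDl// le_max lexx.
  exists (Num.max A 0 + 1); split; first by rewrite ltr_wpDl// le_max lexx orbT.
  move=> tau tau_ge; rewrite -lee_fin; apply: (le_trans (HA _ An)).
  by apply: ereal_inf_lbound; exists tau.
(* With this [r] one has [N / (r * xi) = n * (N0 / xi)], so the lower bound [N0 / N] at
   [tau = N0 / xi] is exactly the required comparison with [N' = N]. *)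
pose r := N / (n * N0); have r0 : 0 < r by rewrite divr_gt0// mulr_gt0.
exists (r / (2 * d%:R)), N0, C; split=> //; first exact: divr_gt0.
move=> u0 u1 l2u0 _ mom dec.
apply: (main _ (r / (2 * d%:R)) N _ _ l2u0 mom _ dec LN).
  by rewrite divr_gt0//=.
move=> xi /andP[xi0 xisd].
have -> : 2 * d%:R * (r / (2 * d%:R)) = r by rewrite mulrC divfK ?gt_eqF.
have -> : N / (r * xi) = n * (N0 / xi).
  by rewrite /r; field; rewrite !gt_eqF.
(* The range of [tau] in the hypothesis starts at the reciprocal of the largest possible [xi];
   [N0 >= 1] keeps [N0 / xi] inside it. *)
have tau_ge : sd^-1 <= N0 / xi.
  by rewrite ler_pdivlMr// mulrC ler_pdivrMr// (le_trans xisd)// ler_peMl// ltW.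
have T0 : 0 < Theta (Linv Lambda (N0 / xi)) by rewrite Theta0// Linv_ge0.
have := Hn _ tau_ge; rewrite ler_pdivlMr ?mulr_gt0// => h.
rewrite -(@ler_pM2l _ (n * N0 / N)) ?divr_gt0 ?mulr_gt0//.
apply: (le_trans (le_trans _ h)); apply: eq_ler.
  by ring.
by rewrite /r; field; rewrite !gt_eqF.
Qed.
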